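(* Let $\Omega\subset\mathbb{C}^n$ be a bounded domain and suppose $p>2$ ($p<\infty$). Assume that for every sequence $\{w_k\}$ in $\Omega$ with no accumulation point in $\Omega$ and for every $f\in\mathcal{A}^p(\Omega)$, $$\lim_{k\to\infty}\frac{|f(w_k)|^p}{K_p(w_k)}=0.$$ Then $\Omega$ is $p$-Skwarczyński complete.
   Context: For a bounded domain $\Omega\subset\mathbb{C}^n$ and $1\le p<\infty$, the $p$-Bergman space is $\mathcal{A}^p(\Omega)=\{f\in L^p(\Omega): f \text{ is holomorphic in }\Omega\}$, with the $L^p(\Omega)$ norm $\|\cdot\|_p$ (Lebesgue measure). For $z\in\Omega$ put $m_p(z)=\inf\{\|f\|_p: f\in\mathcal{A}^p(\Omega),\ f(z)=1\}$. It is known that there is a unique $f\in\mathcal{A}^p(\Omega)$ with $f(z)=1$ attaining this infimum; it is denoted $m_p(\cdot,z)$. The $p$-Bergman kernel is $K_p(z)=m_p(z)^{-p}$. The $p$-Skwarczyński distance on $\Omega$ is $$\rho_p(z,w)=\min_{t\in[0,2\pi]}\left\|e^{it}\frac{m_p(\cdot,z)}{m_p(z)}-\frac{m_p(\cdot,w)}{m_p(w)}\right\|_p .$$ It is a distance, since it is known that $m_p(\cdot,z)$ is not a constant multiple of $m_p(\cdot,w)$ when $z\ne w$. $\Omega$ is called $p$-Skwarczyński complete if every $\rho_p$-Cauchy sequence in $\Omega$ converges with respect to $\rho_p$ to a point of $\Omega$. *)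

(* Defs.v *)
From HB Require Import structures.
From mathcomp Require Import all_boot all_order all_algebra.
From mathcomp Require Import complex.
From mathcomp Require Import all_classical all_reals all_analysis.

Set Implicit Arguments.
Unset Strict Implicit.
Unset Printing Implicit Defensive.

Import Order.TTheory GRing.Theory Num.Theory.
Import numFieldNormedType.Exports.
Import ComplexField.Normc.

Local Open Scope classical_set_scope.
Local Open Scope ring_scope.
Local Open Scope complex_scope.

(* The norm topology of the complex numbers, with complex scalars. *)
HB.instance Definition _ (R : rcfType) := NormedModule.copy R[i] R[i]^o.

Lemma sigma_finite_product (R : realType) (d1 d2 : measure_display)
    (T1 : measurableType d1) (T2 : measurableType d2)
    (m1 : {sigma_finite_measure set T1 -> \bar R})
    (m2 : {sigma_finite_measure set T2 -> \bar R}) :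
  sigma_finite setT (m1 \x m2)%E.
Proof.
have /sigma_finiteP[F [TF ndF Foo]] := sigma_finiteT m1.
have /sigma_finiteP[G [TG ndG Goo]] := sigma_finiteT m2.
exists (fun k => F k `*` G k).
  rewrite -setXTT TF TG predeqE => -[x y]; split.
    move=> [/= [k _ Fkx] [l _ Gly]]; exists (maxn k l) => //; split.
    - by move: x Fkx; exact/subsetPset/ndF/leq_maxl.
    - by move: y Gly; exact/subsetPset/ndG/leq_maxr.
  by move=> [k _ []/= ? ?]; split; exists k.
move=> k; have [? ?] := Foo k; have [? ?] := Goo k.
split; first exact: measurableX.
by rewrite product_measure1E// lte_mul_pinfty// ge0_fin_numE.
Qed.

(* The library has binary product measures only: the n-fold power of a
   sigma-finite measure [mu] is built on [n.-tuple T] by transporting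
   [mu \x mu^n] along [(x, t) |-> x :: t]. *)
Section power_step.
Local Open Scope ereal_scope.
Context {d : measure_display} {T : measurableType d} {R : realType}.
Variables (mu : {sigma_finite_measure set T -> \bar R}) (n : nat).
Variable nu : {sigma_finite_measure set (n.-tuple T) -> \bar R}.

Definition tuple_cons (x : T * n.-tuple T) : n.+1.-tuple T :=
  [the n.+1.-tuple T of x.1 :: x.2].

Lemma measurable_tuple_cons : measurable_fun [set: T * n.-tuple T] tuple_cons.
Proof. exact: measurable_cons. Qed.

Definition power_step : set (n.+1.-tuple T) -> \bar R :=
  pushforward (mu \x nu) tuple_cons.

Let power_step0 : power_step set0 = 0.
Proof. by rewrite /power_step /pushforward preimage_set0 measure0. Qed.

Let power_step_ge0 A : 0 <= power_step A.
Proof. exact: (measure_ge0 (mu \x nu)). Qed.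

Let power_step_sigma_additive : semi_sigma_additive power_step.
Proof.
move=> F mF tF mUF; rewrite /power_step /pushforward preimage_bigcup.
apply: measure_semi_sigma_additive.
- by move=> k; rewrite -[X in measurable X]setTI; exact: measurable_tuple_cons.
- apply/trivIsetP => /= i j _ _ ij; rewrite -preimage_setI.
  by move/trivIsetP : tF => /(_ _ _ _ _ ij) ->//; rewrite preimage_set0.
- rewrite -preimage_bigcup -[X in measurable X]setTI.
  exact: measurable_tuple_cons.
Qed.

HB.instance Definition _ := isMeasure.Build _ _ _ power_step
  power_step0 power_step_ge0 power_step_sigma_additive.

Let tuple_uncons (t : n.+1.-tuple T) : T * n.-tuple T :=
  (thead t, [tuple of behead t]).

Let tuple_consK : cancel tuple_cons tuple_uncons.
Proof.
case=> x t; rewrite /tuple_uncons /tuple_cons /=; congr (_, _).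
exact/val_inj.
Qed.

Let measurable_tuple_uncons : measurable_fun setT tuple_uncons.
Proof.
apply: measurable_fun_pair; first exact: measurable_tnth.
exact: measurable_behead.
Qed.

Let power_step_sigma_finite : sigma_finite setT power_step.
Proof.
have [F UF mF] := sigma_finite_product mu nu.
exists (fun k => tuple_uncons @^-1` F k).
  by rewrite -preimage_bigcup -UF preimage_setT.
move=> k; have [mFk Fk] := mF k; split.
  by rewrite -[X in measurable X]setTI; exact: measurable_tuple_uncons.
rewrite /power_step /pushforward -comp_preimage.
rewrite (_ : tuple_uncons \o tuple_cons = id) ?preimage_id//.
by apply/funext => x /=; rewrite tuple_consK.
Qed.

HB.instance Definition _ := Measure_isSigmaFinite.Build _ _ _ power_step
  power_step_sigma_finite.

End power_step.

Section power_measure.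
Local Open Scope ereal_scope.
Context {d : measure_display} {T : measurableType d} {R : realType}.
Variable mu : {sigma_finite_measure set T -> \bar R}.

Fixpoint power_measure (n : nat) :
    {sigma_finite_measure set (n.-tuple T) -> \bar R} :=
  match n with
  | 0 => [the {sigma_finite_measure set (0.-tuple T) -> \bar R} of
           \d_[tuple]]
  | m.+1 => [the {sigma_finite_measure set (m.+1.-tuple T) -> \bar R} of
              power_step mu (power_measure m)]
  end.

Lemma power_measure_box (n : nat) (A : 'I_n -> set T) :
  (forall i, measurable (A i)) ->
  power_measure n [set t | forall i, A i (tnth t i)] = \prod_(i < n) mu (A i).
Proof.
elim: n => [|n IH] in A *; move=> mA.
  rewrite big_ord0 /= (_ : [set _ | _] = setT) ?diracT//.
  by apply/seteqP; split => // t _ [].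
have mB : measurable
    [set t : n.-tuple T | forall i, A (lift ord0 i) (tnth t i)].
  rewrite (_ : [set _ | _] = \bigcap_(i in [set: 'I_n])
      ((fun t => tnth t i) @^-1` A (lift ord0 i))); last first.
    by apply/seteqP; split => t //= h i; [move=> _|]; exact: h.
  apply: fin_bigcap_measurable => // i _.
  rewrite -[X in measurable X]setTI.
  exact: measurable_tnth.
rewrite big_ord_recl -IH// -product_measure1E// /= /power_step /pushforward.
congr (_ _); apply/seteqP; split => -[x t] /=.
  move=> h; split; first exact: (h ord0).
  by move=> i; have := h (lift ord0 i); rewrite tnthS.
move=> [h0 h] i; case: (unliftP ord0 i) => [j|] ->; last exact: h0.
by rewrite tnthS; exact: h.
Qed.

End power_measure.

Section lebesgue_plane.
Context {R : realType}.

Definition lebesgue_plane :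
    set (measurableTypeR R * measurableTypeR R) -> \bar R :=
  (@lebesgue_measure R \x @lebesgue_measure R)%E.

HB.instance Definition _ := Measure.on lebesgue_plane.

HB.instance Definition _ := Measure_isSigmaFinite.Build _ _ _ lebesgue_plane
  (sigma_finite_product (@lebesgue_measure R) (@lebesgue_measure R)).

End lebesgue_plane.

Section bergman.
Context {R : realType} (n : nat).

Definition domain (Omega : set 'rV[R[i]]_n) :=
  [/\ open Omega, connected Omega & Omega !=set0].

(* ['rV[R[i]]_n] is a normed module over [R[i]], so [differentiable] means
   complex differentiable. *)
Definition holomorphic (Omega : set 'rV[R[i]]_n) (f : 'rV[R[i]]_n -> R[i]) :=
  forall z, Omega z -> differentiable f z.

(* The identification of R^(2n), on which Lebesgue measure lives, with C^n. *)
Definition toCn (t : n.-tuple (measurableTypeR R * measurableTypeR R)) :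
  'rV[R[i]]_n := \row_j ((tnth t j).1 +i* (tnth t j).2).

Definition lebesgueCn := power_measure (@lebesgue_plane R) n.

(* Functions are total, but [Lpnorm], [Bergman] and everything derived from
   them only depend on their values on [Omega]. *)
Definition Lpnorm (Omega : set 'rV[R[i]]_n) (p : R) (f : 'rV[R[i]]_n -> R[i])
  : \bar R :=
  'N[lebesgueCn]_(p%:E)[(fun t => (normc (f (toCn t)))%:E) \_ (toCn @^-1` Omega)].

Definition Bergman (Omega : set 'rV[R[i]]_n) (p : R) :
    set ('rV[R[i]]_n -> R[i]) :=
  [set f | holomorphic Omega f /\ (Lpnorm Omega p f < +oo)%E].

Definition pnorm (Omega : set 'rV[R[i]]_n) (p : R) f : R :=
  fine (Lpnorm Omega p f).

Definition min_norm (Omega : set 'rV[R[i]]_n) (p : R) (z : 'rV[R[i]]_n) : R :=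
  inf [set pnorm Omega p f | f in [set f | Bergman Omega p f /\ f z = 1]].

(* Two minimizers agree on [Omega]; their values elsewhere are irrelevant. *)
Definition minimizer (Omega : set 'rV[R[i]]_n) (p : R) (z : 'rV[R[i]]_n) :
    'rV[R[i]]_n -> R[i] :=
  xget (fun=> 0) [set f | [/\ Bergman Omega p f, f z = 1 &
                              pnorm Omega p f = min_norm Omega p z]].

Definition Bergman_kernel (Omega : set 'rV[R[i]]_n) (p : R) z : R :=
  min_norm Omega p z `^ (- p).

(* The norms below form the image of a compact interval under a continuous
   map, so this infimum is attained. *)
Definition rho (Omega : set 'rV[R[i]]_n) (p : R) (z w : 'rV[R[i]]_n) : R :=
  inf [set pnorm Omega p (fun x =>
         (cos t +i* sin t) * (minimizer Omega p z x / (min_norm Omega p z)%:C)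
         - minimizer Omega p w x / (min_norm Omega p w)%:C)
      | t in `[0, 2 * pi]].

Definition rho_cauchy (Omega : set 'rV[R[i]]_n) (p : R)
    (w : nat -> 'rV[R[i]]_n) :=
  forall e : R, 0 < e -> exists N : nat, forall j k : nat,
    (N <= j)%N -> (N <= k)%N -> rho Omega p (w j) (w k) < e.

Definition Skwarczynski_complete (Omega : set 'rV[R[i]]_n) (p : R) :=
  forall w : nat -> 'rV[R[i]]_n,
    (forall k, Omega (w k)) -> rho_cauchy Omega p w ->
    exists2 z, Omega z & rho Omega p (w k) z @[k --> \oo] --> (0 : R).

End bergman.

(* Main.v *)
(* Write F_w = m_p(., w) / m_p(w), a unit vector with |F_w(w)| m_p(w) = 1.
   Every f in A^p satisfies |f(w)| m_p(w) <= ||f||. A rho_p-Cauchy sequence has a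
   subsequence w_j such that c_j F_{w_j} converges in A^p to some F, for suitable
   phases c_j. Evaluating at w_j gives |F(w_j)| m_p(w_j) -> 1, so by hypothesis
   (w_j) has a cluster point z in Omega. From |f(w_j)| m_p(w_j) <= ||f|| it follows
   that |f(z)| <= |F(z)| ||f|| for all f in A^p: F / F(z) is the minimizer at z,
   i.e. F is F_z up to a phase, and rho_p(w_j, z) -> 0.

   Completeness of A^p rests on pointwise evaluation being bounded, which is
   derived one variable at a time from Cauchy's formula on rectangles; existence
   and uniqueness of minimizers are obtained from Clarkson's inequality
   (p >= 2). *)
Require Import Defs.
From mathcomp Require Import all_boot all_order all_algebra.
From mathcomp Require Import complex.
From mathcomp Require Import all_classical all_reals all_analysis.
From mathcomp Require Import measurable_realfun ring lra.
Import Order.TTheory GRing.Theory Num.Theory.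
Import numFieldNormedType.Exports.
Import ComplexField.Normc.
Set Implicit Arguments.
Unset Strict Implicit.
Unset Printing Implicit Defensive.
Local Open Scope classical_set_scope.
Local Open Scope ring_scope.
Local Open Scope complex_scope.
Local Notation Re := complex.Re.
Local Notation Im := complex.Im.
#[local] Arguments normc : simpl never.

(** * Complex numbers and rectangle integrals *)

(** Every contour is a rectangle: its sides are real segments, so contour integrals are ordinary
    Lebesgue integrals, and polydiscs become products of squares, whose measure is explicit.
    Constants such as 2, 16 or 8 / r^2 are wasteful, since only finiteness and the powers of the
    radius matter.

    The delicate point of completeness is that [holomorphic] means jointly complex differentiable at
    each point, a property that pointwise limits can destroy. What survives a limit is an
    inequality: a first-order expansion whose remainder is quadratic with a constant independent of
    the index. Cauchy's formula along complex lines gives such an expansion, with coefficients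
    controlled by the norm. Convergence in norm then follows from pointwise convergence by Fatou's
    lemma.

    Since [rho] forgets phases, closeness of w_j and w_(j+1) only aligns two unit vectors up to a
    rotation; these rotations are accumulated into a product, so the subsequence must have summable
    steps.

    Functions are total, so identities between elements of the Bergman space are expressed by a
    vanishing norm of the difference. *)

Section complex_basics.
Context {R : realType}.
Implicit Types (z w : R[i]) (f g : R[i] -> R[i]).

Lemma norm_normcE z : `|z| = (normc z)%:C. Proof. by []. Qed.

Lemma normc_ge0 z : 0 <= normc z.
Proof. by rewrite -lecR -norm_normcE normr_ge0. Qed.

Lemma abs_Re_le z : `|Re z| <= normc z.
Proof. by rewrite -lecR; exact: normc_ge_Re. Qed.

Lemma abs_Im_le z : `|Im z| <= normc z.
Proof.
case: z => a b; rewrite /normc/= -sqrtr_sqr ler_wsqrtr// lerDr sqr_ge0//.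
Qed.

Lemma normc_le_ReIm z : normc z <= `|Re z| + `|Im z|.
Proof.
rewrite {1}[z]complexE; apply: (le_trans (le_normcD _ _)).
rewrite normcM /normc/= !expr0n/= expr1n !addr0 add0r sqrtr1 mul1r.
by rewrite !sqrtr_sqr.
Qed.

Lemma normc_real (x : R) : normc x%:C = `|x|.
Proof. by rewrite /normc/= expr0n/= addr0 sqrtr_sqr. Qed.

(** The norm of [R[i]] takes its values in [R[i]], so the radii of balls are complex numbers. A
    positive complex number is real, which allows all later estimates to be carried out in [R]. *)
Lemma nbhs_normcP z (P : set R[i]) :
  nbhs z P <-> exists2 e : R, 0 < e & forall w, normc (w - z) < e -> P w.
Proof.
split.
  move=> /nbhs_ballP[e /= e0 eP].
  have ereal : e = (Re e)%:C by rewrite RRe_real// gtr0_real.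
  exists (Re e); first by rewrite -ltcR -ereal.
  move=> w wz; apply: eP; rewrite -ball_normE /= distrC ereal norm_normcE ltcR//.
move=> [e e0 eP]; apply/nbhs_ballP; exists e%:C => /=; first by rewrite ltcR.
by move=> w; rewrite -ball_normE /= distrC norm_normcE ltcR; exact: eP.
Qed.

Lemma cvg_normcP {T} (F : set_system T) {FF : Filter F} (u : T -> R[i]) z :
  u t @[t --> F] --> z <-> forall e : R, 0 < e -> \forall t \near F, normc (u t - z) < e.
Proof.
split=> [uz e e0|uz].
  by move: uz => /(_ [set w | normc (w - z) < e]); apply; apply/nbhs_normcP; exists e.
move=> P /nbhs_normcP[e e0 eP].
by near=> t; apply: eP; near: t; exact: uz.
Unshelve. all: by end_near. Qed.

Lemma continuous_normcP f z : {for z, continuous f} <->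
  forall e : R, 0 < e -> exists2 d : R, 0 < d &
    forall w, normc (w - z) < d -> normc (f w - f z) < e.
Proof.
have FF := nbhs_filter z; split=> [fz e e0|fe].
  by have /cvg_normcP/(_ e e0) := fz; move=> /nbhs_normcP.
have : f w @[w --> z] --> f z by apply/cvg_normcP => e /fe; rewrite -nbhs_normcP.
exact.
Qed.

Lemma continuous_Re : continuous (@complex.Re R : R[i] -> R).
Proof.
move=> z; have FF := nbhs_filter z; apply/cvgrPdist_lt => e e0.
apply/nbhs_normcP; exists e => // w; apply: le_lt_trans.
have -> : Re z - Re w = Re (z - w) by case: (z) (w) => [? ?] [? ?].
by rewrite -normcN opprB abs_Re_le.
Qed.

Lemma continuous_Im : continuous (@complex.Im R : R[i] -> R).
Proof.
move=> z; have FF := nbhs_filter z; apply/cvgrPdist_lt => e e0.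
apply/nbhs_normcP; exists e => // w; apply: le_lt_trans.
have -> : Im z - Im w = Im (z - w) by case: (z) (w) => [? ?] [? ?].
by rewrite -normcN opprB abs_Im_le.
Qed.

Lemma continuous_hline (y : R) : continuous (fun x : R => x +i* y : R[i]).
Proof.
move=> x; apply/cvg_normcP => e e0; near=> t.
rewrite /normc/= subrr expr0n addr0 sqrtr_sqr distrC; near: t.
exact: (@cvgr_dist_lt _ _ _ (nbhs x) _ id).
Unshelve. all: by end_near. Qed.

Lemma continuous_vline (x : R) : continuous (fun y : R => x +i* y : R[i]).
Proof.
move=> y; apply/cvg_normcP => e e0; near=> t.
rewrite /normc/= subrr expr0n add0r sqrtr_sqr distrC; near: t.
exact: (@cvgr_dist_lt _ _ _ (nbhs y) _ id).
Unshelve. all: by end_near. Qed.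

Lemma continuous_normc : continuous (@normc R : R[i] -> R).
Proof.
move=> z; have FF := nbhs_filter z; apply/cvgrPdist_lt => e e0.
apply/nbhs_normcP; exists e => // w; apply: le_lt_trans.
rewrite ler_norml; apply/andP; split.
  have := le_normcD (w - z) z; rewrite subrK; lra.
by have := le_normcD (z - w) w; rewrite subrK -(normcN (z - w)) opprB; lra.
Qed.

(* The derivative of a function of one complex variable, with its modulus
   of approximation measured in R rather than in R[i]. *)
Lemma differentiable_normcP f z : differentiable f z ->
  exists l, forall e : R, 0 < e -> exists2 d : R, 0 < d &
    forall h, normc h < d -> normc (f (z + h) - f z - l * h) <= e * normc h.
Proof.
move=> /derivable1_diffP/cvg_ex[/= l fl]; exists l => e e0.
move/cvg_normcP : fl => /(_ e e0).
rewrite near_withinE /= => /nbhs_normcP[d d0 dP].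
exists d => // h hd.
have [->|h0] := eqVneq h 0.
  by rewrite addr0 subrr mulr0 subr0 normc0 mulr0.
have := dP h; rewrite subr0 => /(_ hd h0) /ltW H.
have -> : f (z + h) - f z - l * h =
    (h^-1 *: (f (h%:A + z) - f z) - l) * h.
  rewrite mulrBl; congr (_ - _).
  by rewrite [h%:A]mulr1 [_ *: _]mulrC mulfVK// [h + z]addrC.
by rewrite normcM ler_wpM2r// normc_ge0.
Qed.
End complex_basics.

(* [phi x y n] is attached to the rectangle with lower left corner (x, y) and
   sides a / 2^n, b / 2^n. If it exceeded [e] initially, nested rectangles with
   [phi > e / 4^n] would shrink to a point, against [phi_small]. *)
Section bisection.
Context {R : realType}.
Variables (a b : R) (phi : R -> R -> nat -> R) (x0 y0 e : R).
Hypotheses (a0 : 0 <= a) (b0 : 0 <= b).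
Let w n := a / 2 ^+ n.
Let h n := b / 2 ^+ n.
Hypothesis phiD : forall x y n, phi x y n <=
  phi x y n.+1 + phi (x + w n.+1) y n.+1 +
  (phi x (y + h n.+1) n.+1 + phi (x + w n.+1) (y + h n.+1) n.+1).
Hypothesis phi_small : forall X Y,
  x0 <= X <= x0 + a -> y0 <= Y <= y0 + b -> exists n, forall x y,
  x0 <= x -> x + w n <= x0 + a -> y0 <= y -> y + h n <= y0 + b ->
  x <= X <= x + w n -> y <= Y <= y + h n -> phi x y n <= e / 4 ^+ n.

Let large x y n := e / 4 ^+ n < phi x y n.

(** The fourth quarter is taken without a test. If the current rectangle is large and the first
    three quarters are not, the fourth is: otherwise [phiD] would bound [phi] by 4 (e / 4^(n+1)) = e
    / 4^n. *)
Let step n (s : R * R) : R * R :=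
  let: (x, y) := s in
  if large x y n.+1 then (x, y) else
  if large (x + w n.+1) y n.+1 then (x + w n.+1, y) else
  if large x (y + h n.+1) n.+1 then (x, y + h n.+1) else
  (x + w n.+1, y + h n.+1).

Fixpoint corner n : R * R :=
  if n is m.+1 then step m (corner m) else (x0, y0).

Let half (c : R) n : c / 2 ^+ n = c / 2 ^+ n.+1 + c / 2 ^+ n.+1.
Proof. by rewrite exprS; field; rewrite expf_neq0. Qed.

Let size_ge0 (c : R) n : 0 <= c -> 0 <= c / 2 ^+ n.
Proof. by move=> c0; rewrite divr_ge0// exprn_ge0. Qed.

Let corner_step n :
  [/\ (corner n).1 <= (corner n.+1).1,
      (corner n.+1).1 + w n.+1 <= (corner n).1 + w n,
      (corner n).2 <= (corner n.+1).2 &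
      (corner n.+1).2 + h n.+1 <= (corner n).2 + h n].
Proof.
rewrite [corner n.+1]/=; case: (corner n) => x y.
have wE := half a n; have hE := half b n.
have w1 := size_ge0 n.+1 a0; have h1 := size_ge0 n.+1 b0.
by rewrite /step; repeat case: ifP => _; split; rewrite /w /h /=; lra.
Qed.

Let corner_large : large x0 y0 0 -> forall n, large (corner n).1 (corner n).2 n.
Proof.
move=> l0; elim=> [//|n]; rewrite [corner n.+1]/=.
case: (corner n) => x y; rewrite /step /= => xyn.
case: ifP => [//|/negbT n1]; case: ifP => [//|/negbT n2].
case: ifP => [//|/negbT n3]; rewrite /large /= ltNge; apply/negP => n4.
move: xyn n1 n2 n3; rewrite /large -!leNgt => xyn n1 n2 n3.
have := phiD x y n.
have E : e / 4 ^+ n = 4 * (e / 4 ^+ n.+1).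
  by rewrite exprS; field; rewrite expf_neq0.
move: xyn n1 n2 n3 n4; rewrite E; lra.
Qed.

Let corner_mono m n : (m <= n)%N ->
  [/\ (corner m).1 <= (corner n).1,
      (corner n).1 + w n <= (corner m).1 + w m,
      (corner m).2 <= (corner n).2 &
      (corner n).2 + h n <= (corner m).2 + h m].
Proof.
elim: n => [|n IH]; first by rewrite leqn0 => /eqP ->.
rewrite leq_eqVlt => /predU1P[->//|/IH[? ? ? ?]].
by have [? ? ? ?] := corner_step n; split; lra.
Qed.

Let nested (u v : nat -> R) :
  (forall m n, (m <= n)%N -> u m <= u n /\ v n <= v m) ->
  (forall n, u n <= v n) -> exists l, forall n, u n <= l <= v n.
Proof.
move=> uv luv; have uvle m n : u m <= v n.
  have [/uv[umn _]|/ltnW/uv[_ vmn]] := leqP m n.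
    exact: le_trans (luv n).
  exact: le_trans (luv m) _.
exists (sup (range u)) => n; apply/andP; split.
  apply: ub_le_sup; last by exists n.
  by exists (v 0%N) => _ [m _ <-].
apply: ge_sup; first by exists (u 0%N), 0%N.
by move=> _ [m _ <-].
Qed.

Lemma bisection : phi x0 y0 0 <= e.
Proof.
rewrite leNgt; apply/negP => large0.
have {}large0 : large x0 y0 0 by rewrite /large expr0 divr1.
have [X XP] : exists X, forall n, (corner n).1 <= X <= (corner n).1 + w n.
  apply: nested => [m n /corner_mono[]//|n].
  by rewrite lerDl size_ge0.
have [Y YP] : exists Y, forall n, (corner n).2 <= Y <= (corner n).2 + h n.
  apply: nested => [m n /corner_mono[]//|n].
  by rewrite lerDl size_ge0.
have := XP 0%N; have := YP 0%N.
rewrite /w /h expr0 !divr1 /= => Y0 X0.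
have [n /(_ (corner n).1 (corner n).2)] := phi_small X0 Y0.
have [? + ? +] := corner_mono (leq0n n).
rewrite {2}/w /h expr0 !divr1 /= => ? ? /(_ _ _ _ _ (XP n) (YP n)).
have := corner_large large0 n; rewrite /large ltNge => /negP + H.
by apply; apply: H.
Qed.

End bisection.

(** * Integrals of complex functions over real segments *)

Section complex_integral.
Context {R : realType}.
Notation mu := (@lebesgue_measure R).
Implicit Types (a b c d m : R) (f g : R -> R[i]).

Definition cint a b f : R[i] :=
  (\int[mu]_(x in `[a, b]) Re (f x)) +i* (\int[mu]_(x in `[a, b]) Im (f x)).

(** Continuity is two-sided even at the end points, so it restricts to subsegments at no cost. It is
    available because functions are differentiable at every point of the closed rectangles
    considered. *)
Definition continuous_seg a b f := forall x, a <= x <= b -> {for x, continuous f}.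

Lemma continuous_segS a b c d f : a <= c -> d <= b ->
  continuous_seg a b f -> continuous_seg c d f.
Proof. by move=> ac db cf x /andP[cx xd]; apply: cf; lra. Qed.

Lemma continuous_seg_integrable a b (f : R -> R) :
  (forall x, a <= x <= b -> {for x, continuous f}) ->
  mu.-integrable `[a, b] (EFin \o f).
Proof.
move=> cf; apply: continuous_compact_integrable; first exact: segment_compact.
apply: continuous_in_subspaceT => x; rewrite inE /= in_itv /=; exact: cf.
Qed.

Lemma integrable_Re a b f : continuous_seg a b f ->
  mu.-integrable `[a, b] (EFin \o (fun x => Re (f x))).
Proof.
move=> cf; apply: continuous_seg_integrable => x /cf fx.
by apply: (@continuous_comp R R[i] R f (@complex.Re R)) => //; exact: continuous_Re.
Qed.

Lemma integrable_Im a b f : continuous_seg a b f ->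
  mu.-integrable `[a, b] (EFin \o (fun x => Im (f x))).
Proof.
move=> cf; apply: continuous_seg_integrable => x /cf fx.
by apply: (@continuous_comp R R[i] R f (@complex.Im R)) => //; exact: continuous_Im.
Qed.

Lemma eq_cint a b f g : (forall x, a <= x <= b -> f x = g x) ->
  cint a b f = cint a b g.
Proof.
move=> fg; congr (_ +i* _); apply: eq_Rintegral => x;
  by rewrite inE /= in_itv /= => /fg ->.
Qed.

Lemma cintD a b f g : continuous_seg a b f -> continuous_seg a b g ->
  cint a b (fun x => f x + g x) = cint a b f + cint a b g.
Proof.
move=> cf cg; rewrite /cint; simpc.
rewrite -!RintegralD//; try (exact: integrable_Re || exact: integrable_Im).
by congr (_ +i* _); apply: eq_Rintegral => x _; case: (f x) (g x) => [? ?] [? ?].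
Qed.

Lemma cintZ a b (k : R[i]) f : continuous_seg a b f ->
  cint a b (fun x => k * f x) = k * cint a b f.
Proof.
move=> cf; case: k => p q; rewrite /cint; simpc.
have iR := integrable_Re cf; have iI := integrable_Im cf.
rewrite -!RintegralZl// -RintegralB//; last 2 first.
  by apply: (integrableZl _ p iR).
  by apply: (integrableZl _ q iI).
rewrite -RintegralD//; last 2 first.
  by apply: (integrableZl _ p iI).
  by apply: (integrableZl _ q iR).
by congr (_ +i* _); apply: eq_Rintegral => x _; case: (f x) => [? ?] /=; ring.
Qed.

Lemma continuous_segD a b f g : continuous_seg a b f -> continuous_seg a b g ->
  continuous_seg a b (fun x => f x + g x).
Proof. by move=> cf cg x xab; apply: continuousD; [exact: cf|exact: cg]. Qed.

Lemma continuous_segM a b f g : continuous_seg a b f -> continuous_seg a b g ->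
  continuous_seg a b (fun x => f x * g x).
Proof. by move=> cf cg x xab; apply: continuousM; [exact: cf|exact: cg]. Qed.

Lemma continuous_seg_cst a b k : continuous_seg a b (fun=> k).
Proof. by move=> x _; exact: cst_continuous. Qed.

Lemma cintN a b f : continuous_seg a b f ->
  cint a b (fun x => - f x) = - cint a b f.
Proof.
move=> cf; rewrite -mulN1r -cintZ//.
by apply: eq_cint => x _; rewrite mulN1r.
Qed.

Lemma continuous_segN a b f : continuous_seg a b f ->
  continuous_seg a b (fun x => - f x).
Proof. by move=> cf x xab; apply: continuousN; exact: cf. Qed.

Lemma continuous_segB a b f g : continuous_seg a b f -> continuous_seg a b g ->
  continuous_seg a b (fun x => f x - g x).
Proof. by move=> cf cg; exact: (continuous_segD cf (continuous_segN cg)). Qed.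

Lemma cintB a b f g : continuous_seg a b f -> continuous_seg a b g ->
  cint a b (fun x => f x - g x) = cint a b f - cint a b g.
Proof.
move=> cf cg; apply: (etrans (cintD cf (continuous_segN cg))).
by rewrite (cintN cg).
Qed.

Lemma cint_cst a b (k : R[i]) : a <= b -> cint a b (fun=> k) = k * (b - a)%:C.
Proof.
move=> ab; rewrite /cint !Rintegral_cst//= lebesgue_measure_itv/= lte_fin.
case: ltP ab => [_ _|ba ab] /=; first by case: k => p q; simpc.
have -> : b = a by lra.
by rewrite subrr; case: k => p q; simpc.
Qed.

Lemma cint_split a b m f : a <= m <= b -> continuous_seg a b f ->
  cint a b f = cint a m f + cint m b f.
Proof.
move=> /andP[am mb] cf; rewrite /cint; simpc.
have H (g : R -> R) : mu.-integrable `[a, b] (EFin \o g) ->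
   \int[mu]_(x in `[a, b]) g x =
   \int[mu]_(x in `[a, m]) g x + \int[mu]_(x in `[m, b]) g x.
  move=> ig; have := @Rintegral_itvB _ g (BLeft a) (BRight b) m ig.
  rewrite !bnd_simp => /(_ am mb); rewrite Rintegral_itv_obnd_cbnd.
    by move=> <-; rewrite addrC subrK.
  apply: integrableS ig => //; apply: subset_itvr; rewrite bnd_simp//.
by rewrite !H//; [exact: integrable_Im|exact: integrable_Re].
Qed.

(** The real and imaginary parts are bounded separately, whence the factor 2. *)
Lemma normc_cint_le_int a b f : continuous_seg a b f ->
  normc (cint a b f) <= 2 * \int[mu]_(x in `[a, b]) normc (f x).
Proof.
move=> cf; apply: (le_trans (normc_le_ReIm _)) => /=.
have iR := integrable_Re cf; have iI := integrable_Im cf.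
have iN : mu.-integrable `[a, b] (EFin \o (fun x => normc (f x))).
  apply: continuous_seg_integrable => x /cf fx.
  by apply: (@continuous_comp R R[i] R f (@normc R)) => //; exact: continuous_normc.
rewrite mulrDl !mul1r; apply: lerD.
  apply: (le_trans (le_normr_Rintegral _ iR)) => //; apply: le_Rintegral => //.
    exact: integrable_norm iR.
  by move=> x _; exact: abs_Re_le.
apply: (le_trans (le_normr_Rintegral _ iI)) => //; apply: le_Rintegral => //.
  exact: integrable_norm iI.
by move=> x _; exact: abs_Im_le.
Qed.

Lemma normc_cint_le a b M f : a <= b -> continuous_seg a b f ->
  (forall x, a <= x <= b -> normc (f x) <= M) ->
  normc (cint a b f) <= 2 * (M * (b - a)).
Proof.
move=> ab cf fM; apply: (le_trans (normc_cint_le_int cf)).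
rewrite ler_wpM2l//.
have -> : M * (b - a) = \int[mu]_(x in `[a, b]) M.
  rewrite Rintegral_cst//= lebesgue_measure_itv/= lte_fin.
  by move: ab; rewrite le_eqVlt => /predU1P[->|->]//; rewrite ltxx subrr mulr0.
apply: le_Rintegral => //.
- apply: continuous_seg_integrable => x /cf fx.
  by apply: (@continuous_comp R R[i] R f (@normc R)) => //; exact: continuous_normc.
- by apply: continuous_seg_integrable => x _; exact: cst_continuous.
Qed.

End complex_integral.

(** * Integrals along the boundary of a rectangle, and Goursat's theorem *)

Section rectangle_integral.
Context {R : realType}.
Implicit Types (a b c d m s p q M : R) (f g : R[i] -> R[i]) (k l z : R[i]).

(** The counterclockwise contour integral, with opposite sides paired into one real integral: bottom
    minus top, then i times right minus left. The pairing makes the explicit computations short. *)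
Definition rectint f a b c d : R[i] :=
  cint a b (fun x => f (x +i* c) - f (x +i* d)) +
  (0 +i* 1) * cint c d (fun y => f (b +i* y) - f (a +i* y)).

Definition rect a b c d : set R[i] :=
  [set z | a <= Re z <= b /\ c <= Im z <= d].

Definition continuous_boundary f a b c d :=
  [/\ continuous_seg a b (fun x => f (x +i* c)),
      continuous_seg a b (fun x => f (x +i* d)),
      continuous_seg c d (fun y => f (a +i* y)) &
      continuous_seg c d (fun y => f (b +i* y))].

Lemma continuous_hseg f a b y :
  (forall x, a <= x <= b -> {for x +i* y, continuous f}) ->
  continuous_seg a b (fun x => f (x +i* y)).
Proof.
move=> cf x /cf fx.
exact (@continuous_comp R R[i] R[i] (fun x => x +i* y) f x (@continuous_hline R y x) fx).
Qed.

Lemma continuous_vseg f c d x :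
  (forall y, c <= y <= d -> {for x +i* y, continuous f}) ->
  continuous_seg c d (fun y => f (x +i* y)).
Proof.
move=> cf y /cf fy.
exact (@continuous_comp R R[i] R[i] (fun y => x +i* y) f y (@continuous_vline R x y) fy).
Qed.

Lemma continuous_rect_boundary f a b c d : a <= b -> c <= d ->
  (forall z, rect a b c d z -> {for z, continuous f}) ->
  continuous_boundary f a b c d.
Proof.
move=> ab cd cf; split; [apply: continuous_hseg|apply: continuous_hseg|
  apply: continuous_vseg|apply: continuous_vseg] => ? ?; apply: cf;
  by split => //=; rewrite lexx ?ab ?cd.
Qed.

Lemma continuous_boundaryD f g a b c d :
  continuous_boundary f a b c d -> continuous_boundary g a b c d ->
  continuous_boundary (fun z => f z + g z) a b c d.
Proof. by move=> [? ? ? ?] [? ? ? ?]; split; apply: continuous_segD. Qed.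

Lemma continuous_boundaryM f g a b c d :
  continuous_boundary f a b c d -> continuous_boundary g a b c d ->
  continuous_boundary (fun z => f z * g z) a b c d.
Proof. by move=> [? ? ? ?] [? ? ? ?]; split; apply: continuous_segM. Qed.

Lemma continuous_boundary_cst k a b c d : continuous_boundary (fun=> k) a b c d.
Proof. by split; exact: continuous_seg_cst. Qed.

Lemma continuous_boundaryB f g a b c d :
  continuous_boundary f a b c d -> continuous_boundary g a b c d ->
  continuous_boundary (fun z => f z - g z) a b c d.
Proof.
move=> [f1 f2 f3 f4] [g1 g2 g3 g4]; split; [exact: continuous_segB f1 g1|
  exact: continuous_segB f2 g2|exact: continuous_segB f3 g3|
  exact: continuous_segB f4 g4].
Qed.

Lemma rectintE f a b c d : continuous_boundary f a b c d ->
  rectint f a b c d =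
  cint a b (fun x => f (x +i* c)) - cint a b (fun x => f (x +i* d)) +
  (0 +i* 1) * (cint c d (fun y => f (b +i* y)) - cint c d (fun y => f (a +i* y))).
Proof. by move=> [? ? ? ?]; rewrite /rectint !cintB. Qed.

Lemma rectintD f g a b c d :
  continuous_boundary f a b c d -> continuous_boundary g a b c d ->
  rectint (fun z => f z + g z) a b c d = rectint f a b c d + rectint g a b c d.
Proof.
move=> cf cg; rewrite (rectintE (continuous_boundaryD cf cg)) !rectintE//.
by case: cf cg => [? ? ? ?] [? ? ? ?]; rewrite !cintD//; ring.
Qed.

Lemma rectintZ f k a b c d : continuous_boundary f a b c d ->
  rectint (fun z => k * f z) a b c d = k * rectint f a b c d.
Proof.
move=> cf; have ck := continuous_boundary_cst k a b c d.
rewrite (rectintE (continuous_boundaryM ck cf)) !rectintE//.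
by case: cf => [? ? ? ?]; rewrite !cintZ//; ring.
Qed.

Lemma eq_rectint f g a b c d : a <= b -> c <= d ->
  (forall z, rect a b c d z ->
     Re z = a \/ Re z = b \/ Im z = c \/ Im z = d -> f z = g z) ->
  rectint f a b c d = rectint g a b c d.
Proof.
move=> ab cd fg; congr (_ + _ * _); apply: eq_cint => x xab.
  congr (_ - _); apply: fg; try (by split; rewrite //= lexx cd).
    by right; right; left.
  by right; right; right.
congr (_ - _); apply: fg; try (by split; rewrite //= lexx ab).
  by right; left.
by left.
Qed.

(** The side x = m is traversed twice in opposite directions and cancels. Continuity on the boundary
    of the right piece follows from the two hypotheses. *)
Lemma rectint_splith f a m b c d : a <= m <= b ->
  continuous_boundary f a m c d -> continuous_boundary f a b c d ->
  rectint f a b c d = rectint f a m c d + rectint f m b c d.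
Proof.
move=> amb cf cf'; have /andP[am mb] := amb.
have cf'' : continuous_boundary f m b c d.
  case: cf cf' => [? ? ? ?] [? ? ? ?].
  by split => //; apply: (continuous_segS am (lexx b)).
rewrite !rectintE//.
case: cf' => [fc fd _ _].
by rewrite (cint_split amb fc) (cint_split amb fd); ring.
Qed.

Lemma rectint_splitv f a b c m d : c <= m <= d ->
  continuous_boundary f a b c m -> continuous_boundary f a b c d ->
  rectint f a b c d = rectint f a b c m + rectint f a b m d.
Proof.
move=> cmd cf cf'; have /andP[cm md] := cmd.
have cf'' : continuous_boundary f a b m d.
  case: cf cf' => [? ? ? ?] [? ? ? ?].
  by split => //; apply: (continuous_segS cm (lexx d)).
rewrite !rectintE//.
case: cf' => [_ _ fa fb].
by rewrite (cint_split cmd fa) (cint_split cmd fb); ring.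
Qed.

Lemma normc_i : normc (0 +i* 1 : R[i]) = 1.
Proof. by rewrite /normc/= expr0n expr1n add0r sqrtr1. Qed.

(** The factor 4 is 2 from [normc_cint_le] times 2 for the two sides in each pair. *)
Lemma rectint_le f a b c d M : a <= b -> c <= d ->
  continuous_boundary f a b c d ->
  (forall z, rect a b c d z ->
     Re z = a \/ Re z = b \/ Im z = c \/ Im z = d -> normc (f z) <= M) ->
  normc (rectint f a b c d) <= 4 * (M * ((b - a) + (d - c))).
Proof.
move=> ab cd [fc fd fa fb] fM.
apply: (le_trans (le_normcD _ _)); rewrite normcM normc_i mul1r.
have -> : 4 * (M * ((b - a) + (d - c))) =
  2 * ((M + M) * (b - a)) + 2 * ((M + M) * (d - c)) by ring.
apply: lerD.
  apply: (normc_cint_le ab (continuous_segB fc fd)) => x xab.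
  apply: (le_trans (le_normcD _ _)); rewrite normcN.
  apply: lerD; apply: fM; try (by split; rewrite //= lexx cd).
    by right; right; left.
  by right; right; right.
apply: (normc_cint_le cd (continuous_segB fb fa)) => x xab.
apply: (le_trans (le_normcD _ _)); rewrite normcN.
apply: lerD; apply: fM; try (by split; rewrite //= lexx ab).
  by right; left.
by left.
Qed.

(** On opposite sides an affine function differs by a constant, so both paired integrands are
    constant and their contributions cancel. This permits subtracting the affine part of [f] at a
    point without changing [rectint]. *)
Lemma rectint_affine k l z a b c d : a <= b -> c <= d ->
  rectint (fun w => k + l * (w - z)) a b c d = 0.
Proof.
move=> ab cd; rewrite /rectint.
rewrite (@eq_cint _ a b _ (fun=> l * (0 +i* (c - d)))); last first.
  by move=> x _; case: k l z => [? ?] [? ?] [? ?]; simpc; congr (_ +i* _); ring.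
rewrite (@eq_cint _ c d _ (fun=> l * (b - a)%:C)); last first.
  by move=> x _; case: k l z => [? ?] [? ?] [? ?]; simpc; congr (_ +i* _); ring.
by rewrite !cint_cst//; case: l => [? ?]; simpc; apply/eqP; rewrite eq_complex /=; apply/andP; split; apply/eqP; ring.
Qed.

Lemma continuous_affine f k l z (w : R[i]) :
  (forall v, f v = k + l * (v - z)) -> {for w, continuous f}.
Proof.
move=> fE; apply/continuous_normcP => e e0; have l0 : 0 < normc l + 1.
  by rewrite ltr_wpDl ?normc_ge0.
exists (e / (normc l + 1)); first exact: divr_gt0.
move=> v; rewrite ltr_pdivlMr// => vw.
have -> : f v - f w = l * (v - w) by rewrite !fE; ring.
rewrite normcM; apply: le_lt_trans vw.
by rewrite mulrC ler_wpM2l ?normc_ge0// lerDl.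
Qed.

Lemma geometric_lt (u v : R) : 0 < v -> exists n : nat, u / 2 ^+ n < v.
Proof.
move=> v0; have u0 : 0 < `|u| + 1 by rewrite ltr_wpDl.
have [n _ /(_ n (leqnn n)) /=] :=
  near_infty_natSinv_expn_lt (PosNum (divr_gt0 v0 u0)).
rewrite /= div1r ltr_pdivlMr// => H; exists n; apply: le_lt_trans H.
rewrite mulrC ler_wpM2l ?invr_ge0 ?exprn_ge0//.
by rewrite (le_trans (ler_norm _))// lerDl.
Qed.

Lemma rectint_quarters f x y p q : 0 <= p -> 0 <= q ->
  (forall z, rect x (x + (p + p)) y (y + (q + q)) z -> {for z, continuous f}) ->
  normc (rectint f x (x + (p + p)) y (y + (q + q))) <=
  normc (rectint f x (x + p) y (y + q)) +
  normc (rectint f (x + p) (x + (p + p)) y (y + q)) +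
  (normc (rectint f x (x + p) (y + q) (y + (q + q))) +
   normc (rectint f (x + p) (x + (p + p)) (y + q) (y + (q + q)))).
Proof.
move=> p0 q0 cf.
have cb x1 x2 y1 y2 : x <= x1 -> x1 <= x2 -> x2 <= x + (p + p) -> y <= y1 ->
    y1 <= y2 -> y2 <= y + (q + q) -> continuous_boundary f x1 x2 y1 y2.
  move=> ? ? ? ? ? ?; apply: continuous_rect_boundary => // z.
  by move=> [/andP[? ?] /andP[? ?]]; apply: cf; split; lra.
rewrite (@rectint_splith f x (x + p)); last 3 first.
- by apply/andP; split; lra.
- by apply: cb; lra.
- by apply: cb; lra.
rewrite (@rectint_splitv f x (x + p) y (y + q)); last 3 first.
- by apply/andP; split; lra.
- by apply: cb; lra.
- by apply: cb; lra.
rewrite (@rectint_splitv f (x + p) (x + (p + p)) y (y + q)); last 3 first.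
- by apply/andP; split; lra.
- by apply: cb; lra.
- by apply: cb; lra.
apply: (le_trans (le_normcD _ _)); rewrite [leRHS]addrACA.
by apply: lerD; exact: le_normcD.
Qed.

(** After removal of the affine part at [z] the integrand is at most e times the half perimeter.
    Multiplying by the length of the contour gives the square, which scales like 4^-n under
    bisection. *)
Lemma rectint_local f z e : differentiable f z -> 0 < e ->
  exists2 r : R, 0 < r & forall a b c d, a <= b -> c <= d ->
    (forall w, rect a b c d w -> {for w, continuous f}) ->
    rect a b c d z -> (b - a) + (d - c) < r ->
    normc (rectint f a b c d) <= 4 * (e * ((b - a) + (d - c)) ^+ 2).
Proof.
move=> /differentiable_normcP[l fl] e0; have {fl} [r r0 fl] := fl e e0.
exists r => // a b c d ab cd cf abz abr.
pose g w := f w - (f z + l * (w - z)).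
have cbf := continuous_rect_boundary ab cd cf.
have caff : continuous_boundary (fun w => f z + l * (w - z)) a b c d.
  apply: continuous_rect_boundary ab cd _ => w _.
  exact: (@continuous_affine _ (f z) l z).
have -> : rectint f a b c d = rectint g a b c d.
  rewrite -[RHS]addr0 -(rectint_affine (f z) l z ab cd).
  rewrite -(rectintD (continuous_boundaryB cbf caff) caff).
  by apply: eq_rectint => // w _ _; rewrite subrK.
have gle w : rect a b c d w -> normc (g w) <= e * ((b - a) + (d - c)).
  move=> abw; have wz : normc (w - z) <= (b - a) + (d - c).
    apply: (le_trans (normc_le_ReIm _)).
    move: abw abz => [/andP[? ?] /andP[? ?]] [/andP[? ?] /andP[? ?]].
    have -> : Re (w - z) = Re w - Re z by case: (w) (z) => [? ?] [].
    have -> : Im (w - z) = Im w - Im z by case: (w) (z) => [? ?] [].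
    by apply: lerD; rewrite ler_norml; apply/andP; split; lra.
  have := fl (w - z) (le_lt_trans wz abr); rewrite [z + _]addrC subrK.
  rewrite /g opprD addrA => H; apply: (le_trans H).
  by rewrite ler_wpM2l// ltW.
have := rectint_le ab cd (continuous_boundaryB cbf caff)
  (fun w abw _ => gle w abw).
by rewrite -mulrA -expr2.
Qed.

Lemma Goursat f a b c d : a <= b -> c <= d ->
  (forall z, rect a b c d z -> differentiable f z) -> rectint f a b c d = 0.
Proof.
move=> ab cd df.
have cf z : rect a b c d z -> {for z, continuous f}.
  by move=> /df; exact: differentiable_continuous.
have ba : 0 <= b - a by lra.
have dc : 0 <= d - c by lra.
pose w n := (b - a) / 2 ^+ n.
pose h n := (d - c) / 2 ^+ n.
have w_ge0 n : 0 <= w n by rewrite divr_ge0// exprn_ge0.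
have h_ge0 n : 0 <= h n by rewrite divr_ge0// exprn_ge0.
have wS n : w n = w n.+1 + w n.+1.
  by rewrite /w exprS; field; rewrite expf_neq0.
have hS n : h n = h n.+1 + h n.+1.
  by rewrite /h exprS; field; rewrite expf_neq0.
(* [bisection] quantifies over all corners, whereas [f] is only controlled in the given rectangle.
   Cells that leave it get the value 0, for which subadditivity is trivial. *)
pose inside x y n :=
  [&& a <= x, x + w n <= a + (b - a), c <= y & y + h n <= c + (d - c)].
pose phi x y n := if inside x y n then
  normc (rectint f x (x + w n) y (y + h n)) else 0.
have phi_ge0 x y n : 0 <= phi x y n.
  by rewrite /phi; case: ifP => // _; exact: normc_ge0.
suff small e : 0 < e -> phi a c 0%N <= 4 * (e * ((b - a) + (d - c)) ^+ 2).
  have phi0 : phi a c 0%N = normc (rectint f a b c d).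
    rewrite /phi /inside /w /h expr0 !divr1 !lexx/=.
    by rewrite [a + _]addrC [c + _]addrC !subrK.
  apply: eq0_normc; apply/eqP; rewrite -phi0 eq_le phi_ge0 andbT.
  rewrite leNgt; apply/negP => phi_gt0.
  (* With e = phi / (L + 1) the bound reads phi <= phi L / (L + 1), impossible for a positive phi;
     adding 1 covers L = 0. *)
  pose L := 4 * ((b - a) + (d - c)) ^+ 2.
  have L0 : 0 <= L by rewrite mulr_ge0// exprn_ge0// addr_ge0.
  have := small (phi a c 0%N / (L + 1)) (divr_gt0 phi_gt0 (ltr_wpDl L0 ltr01)).
  have -> : 4 * (phi a c 0%N / (L + 1) * ((b - a) + (d - c)) ^+ 2) =
     phi a c 0%N * (L / (L + 1)) by rewrite /L; ring.
  rewrite -{1}[phi a c 0%N]mulr1 ler_pM2l// ler_pdivlMr ?ltr_wpDl//.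
  by rewrite mul1r; clear; lra.
move=> e0; apply: (bisection ba dc).
  move=> x y n; rewrite -/(w _) -/(h _).
  rewrite {1}/phi; case: ifP => [xyn|_]; last by rewrite !addr_ge0.
  have w1 := w_ge0 n.+1; have h1 := h_ge0 n.+1.
  have in2 u v : x <= u -> u + w n.+1 <= x + w n -> y <= v ->
      v + h n.+1 <= y + h n -> inside u v n.+1.
    move: xyn => /and4P[ax xb cy yd] xu uw yv vh; apply/and4P.
    by split; [exact: le_trans xu|exact: le_trans xb|
      exact: le_trans yv|exact: le_trans yd].
  have [wE hE] := (wS n, hS n).
  rewrite /phi !in2; [|clear -w1 h1 wE hE; lra..].
  rewrite -!addrA -wE -hE; move: xyn => /and4P[ax xb cy yd].
  rewrite wE hE addrA; apply: rectint_quarters => // z [/andP[z1 z2] /andP[z3 z4]].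
  apply: cf; clear -z1 z2 z3 z4 ax xb cy yd wE hE; split; lra.
move=> X Y X0 Y0.
have XY : rect a b c d (X +i* Y).
  by clear -X0 Y0; move: X0 Y0 => /andP[? ?] /andP[? ?]; split => /=; lra.
(* A cell of level n containing (X, Y) is covered by the local estimate once its half perimeter is
   below [r]. *)
have [r r0 fr] := rectint_local (df _ XY) e0.
have [n nr] := geometric_lt ((b - a) + (d - c)) r0.
exists n => x y ax xb cy yd xX yY.
rewrite -/(w n) -/(h n) in xb yd xX yY.
rewrite /phi /inside ax xb cy yd /=.
have wE : x + w n - x = w n by rewrite addrC addKr.
have hE : y + h n - y = h n by rewrite addrC addKr.
apply: (le_trans (fr _ _ _ _ _ _ _ _ _)).
- by rewrite lerDl.
- by rewrite lerDl.
- move=> z [/andP[z1 z2] /andP[z3 z4]]; apply: cf.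
  by clear -z1 z2 z3 z4 ax xb cy yd; split; lra.
- by split.
- by rewrite wE hE /w /h -mulrDl.
rewrite wE hE /w /h -mulrDl expr_div_n -exprM mulnC exprM.
have -> : (2 : R) ^+ 2 = 4 by ring.
by rewrite !mulrA.
Qed.

End rectangle_integral.

(** * Cauchy's formula and Taylor estimates *)

Section cauchy_formula.
Context {R : realType}.
Notation mu := (@lebesgue_measure R).
Implicit Types (a b c d m s p q M : R) (f g : R[i] -> R[i]) (k l z : R[i]).

Lemma continuous_poisson p s (x : R) : 0 < s ->
  {for x, continuous (fun y : R => s / ((y - p) ^+ 2 + s ^+ 2))}.
Proof.
move=> s0; have s20 : 0 < s ^+ 2 by rewrite exprn_gt0.
have ? := sqr_ge0 (x - p).
apply: continuousM; first exact: cst_continuous.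
apply: continuousV; first by apply/eqP; lra.
apply: cvgD; last exact: cvg_cst.
by apply: cvgM; (apply: cvgB; [exact: cvg_id|exact: cvg_cst]).
Qed.

Lemma Rintegral_atan p s : 0 < s ->
  \int[mu]_(x in `[p - s, p + s]) (s / ((x - p) ^+ 2 + s ^+ 2)) = pi / 2.
Proof.
move=> s0; have sn0 : s != 0 by rewrite gt_eqF.
pose F (x : R) := atan ((x - p) / s).
have dF (x : R) : is_derive x 1 F (s / ((x - p) ^+ 2 + s ^+ 2)).
  have dlin : is_derive x 1 (fun y : R => (y - p) / s) s^-1.
    have : is_derive x 1 (s^-1 *: (fun y : R => y - p)) (s^-1 *: (1 - 0)).
      exact: is_deriveZ.
    rewrite subr0 /GRing.scale/= mulr1; congr (is_derive _ _ _ _).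
    by apply/funext => y; rewrite mulrC.
  have := @is_derive1_comp R atan (fun y => (y - p) / s) x _ _ (is_derive1_atan _) dlin.
  rewrite /GRing.scale/=; have -> // : s / ((x - p) ^+ 2 + s ^+ 2) =
    (1 + ((x - p) / s) ^+ 2)^-1 * s^-1.
  have ? : 0 < s ^+ 2 by rewrite exprn_gt0.
  have ? := sqr_ge0 (x - p).
  by field; rewrite sn0/=; apply/eqP; nra.
have cF (x : R) : {for x, continuous F}.
  by apply: differentiable_continuous; apply/derivable1_diffP.
rewrite /Rintegral (@continuous_FTC2 _ _ F); first last.
- by move=> x _; rewrite derive1E; apply: derive_val.
- split; first by move=> x _; exact: ex_derive.
    exact/cvg_at_right_filter/cF.
  exact/cvg_at_left_filter/cF.
- apply: continuous_in_subspaceT => x _; exact: continuous_poisson.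
- by rewrite ltrD2l; lra.
rewrite /= /F addrAC subrr add0r addrAC subrr add0r mulNr divff// atanN atan1.
by rewrite opprK; field.
Qed.

Lemma cint_realC a b (u : R -> R) :
  cint a b (fun x => (u x)%:C) = (\int[mu]_(x in `[a, b]) u x)%:C.
Proof.
rewrite /cint /=; congr (_ +i* _).
by rewrite /Rintegral integral0.
Qed.

Lemma continuous_segC a b (u : R -> R) :
  (forall x, a <= x <= b -> {for x, continuous u}) ->
  continuous_seg a b (fun x => (u x)%:C).
Proof.
move=> cu x /cu ux.
exact (@continuous_comp R R R[i] u (fun x => x +i* 0) x ux (@continuous_hline R 0 (u x))).
Qed.

Lemma inv_complexE p q : (p +i* q)^-1 =
  (p / (p ^+ 2 + q ^+ 2)) +i* - (q / (p ^+ 2 + q ^+ 2)) :> R[i].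
Proof. by []. Qed.

(** On a square centered at the pole, each pair of opposite sides leaves only a Poisson kernel: 2 i
    s / ((x - p)^2 + s^2) horizontally and 2 s / ((y - q)^2 + s^2) vertically. By [Rintegral_atan]
    each pair contributes pi i. *)
Lemma rectint_inv l s : 0 < s ->
  rectint (fun z => (z - l)^-1) (Re l - s) (Re l + s) (Im l - s) (Im l + s) =
  0 +i* (2 * pi).
Proof.
case: l => p q /= s0; rewrite /rectint.
have s20 : 0 < s ^+ 2 by rewrite exprn_gt0.
have kernel_cont r : continuous_seg (r - s) (r + s)
    (fun x => (s / ((x - r) ^+ 2 + s ^+ 2))%:C).
  by apply: continuous_segC => x _; exact: continuous_poisson.
rewrite (@eq_cint _ (p - s) (p + s) _
   (fun x => (0 +i* 2) * (s / ((x - p) ^+ 2 + s ^+ 2))%:C)); last first.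
  move=> x _; have ? := sqr_ge0 (x - p).
  have n1 : (x - p) ^+ 2 + s ^+ 2 != 0 by apply/eqP; lra.
  have -> : x +i* (q - s) - p +i* q = (x - p) +i* (- s).
    by simpc; congr (_ +i* _); ring.
  have -> : x +i* (q + s) - p +i* q = (x - p) +i* s.
    by simpc; congr (_ +i* _); ring.
  rewrite !inv_complexE; simpc; rewrite sqrrN; congr (_ +i* _); first by ring.
  by field.
rewrite (@eq_cint _ (q - s) (q + s) _
   (fun y => 2%:C * (s / ((y - q) ^+ 2 + s ^+ 2))%:C)); last first.
  move=> y _; have ? := sqr_ge0 (y - q).
  have n1 : (y - q) ^+ 2 + s ^+ 2 != 0 by apply/eqP; lra.
  have n2 : s ^+ 2 + (y - q) ^+ 2 != 0 by apply/eqP; lra.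
  have -> : (p + s) +i* y - p +i* q = s +i* (y - q).
    by simpc; congr (_ +i* _); ring.
  have -> : (p - s) +i* y - p +i* q = (- s) +i* (y - q).
    by simpc; congr (_ +i* _); ring.
  rewrite !inv_complexE; simpc; rewrite sqrrN; congr (_ +i* _); last by ring.
  by rewrite [s ^+ 2 + _]addrC; field.
rewrite (cintZ _ (kernel_cont p)) (cintZ _ (kernel_cont q)) !cint_realC.
rewrite !Rintegral_atan//; apply/eqP; rewrite eq_complex /=.
by apply/andP; split; apply/eqP; [ring|field].
Qed.

(** The region between the rectangle and the square is cut into a strip on the left, one on the
    right, and the pieces below and above the square. None of them contains p + i q, so Goursat's
    theorem removes all four. *)
Lemma rectint_shrink g p q s a b c d : 0 < s ->
  a <= p - s -> p + s <= b -> c <= q - s -> q + s <= d ->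
  (forall z, rect a b c d z -> z != p +i* q -> differentiable g z) ->
  rectint g a b c d = rectint g (p - s) (p + s) (q - s) (q + s).
Proof.
move=> s0 ap pb cq qd dg.
have psp : p - s < p by rewrite ltrBlDr ltrDl.
have pps : p < p + s by rewrite ltrDl.
have qsq : q - s < q by rewrite ltrBlDr ltrDl.
have qqs : q < q + s by rewrite ltrDl.
have pp := ltW (lt_trans psp pps); have qq := ltW (lt_trans qsq qqs).
have ap' := le_trans ap pp; have pb' := le_trans pp pb.
have cq' := le_trans cq qq; have qd' := le_trans qq qd.
have ab := le_trans ap pb'; have cd := le_trans cq qd'.
have cg z : rect a b c d z -> z != p +i* q -> {for z, continuous g}.
  by move=> abz /(dg _ abz); exact: differentiable_continuous.
have neq x y : (x != p) || (y != q) -> x +i* y != p +i* q.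
  by rewrite eq_complex /= negb_and.
have cb x1 x2 y1 y2 : a <= x1 -> x1 <= x2 -> x2 <= b -> c <= y1 ->
    y1 <= y2 -> y2 <= d -> x1 != p -> x2 != p -> y1 != q -> y2 != q ->
    continuous_boundary g x1 x2 y1 y2.
  move=> ax x12 xb cy y12 yd n1 n2 n3 n4; split.
  - apply: continuous_hseg => x /andP[xx1 xx2]; apply: cg; last first.
      by apply: neq; rewrite n3 orbT.
    split => /=; first by rewrite (le_trans ax)// (le_trans xx2).
    by rewrite cy (le_trans y12).
  - apply: continuous_hseg => x /andP[xx1 xx2]; apply: cg; last first.
      by apply: neq; rewrite n4 orbT.
    split => /=; first by rewrite (le_trans ax)// (le_trans xx2).
    by rewrite yd (le_trans cy).
  - apply: continuous_vseg => y /andP[yy1 yy2]; apply: cg; last first.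
      by apply: neq; rewrite n1.
    split => /=; first by rewrite ax (le_trans x12).
    by rewrite (le_trans cy)// (le_trans yy2).
  - apply: continuous_vseg => y /andP[yy1 yy2]; apply: cg; last first.
      by apply: neq; rewrite n2.
    split => /=; first by rewrite xb (le_trans ax).
    by rewrite (le_trans cy)// (le_trans yy2).
have G0 x1 x2 y1 y2 : a <= x1 -> x1 <= x2 -> x2 <= b -> c <= y1 ->
    y1 <= y2 -> y2 <= d -> [|| x2 < p, p < x1, y2 < q | q < y1] ->
    rectint g x1 x2 y1 y2 = 0.
  move=> ax x12 xb cy y12 yd out; apply: Goursat => // z.
  move=> [/andP[z1 z2] /andP[z3 z4]]; apply: dg.
    by rewrite /rect/= (le_trans ax z1) (le_trans z2 xb) (le_trans cy z3)
      (le_trans z4 yd).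
  apply/eqP => zE; move: out z1 z2 z3 z4; rewrite zE /= => out z1 z2 z3 z4.
  by move: out; rewrite ltNge z2 ltNge z1 ltNge z4 ltNge z3.
have np : (p - s != p) && (p + s != p) by rewrite (lt_eqF psp) (gt_eqF pps).
have nq : (q - s != q) && (q + s != q) by rewrite (lt_eqF qsq) (gt_eqF qqs).
have [[np1 np2] [nq1 nq2]] := (andP np, andP nq).
have na : a != p by rewrite lt_eqF// (le_lt_trans ap).
have nb : b != p by rewrite gt_eqF// (lt_le_trans pps).
have nc : c != q by rewrite lt_eqF// (le_lt_trans cq).
have nd : d != q by rewrite gt_eqF// (lt_le_trans qqs).
have apb : a <= p - s <= b by rewrite ap pb'.
have ppb : p - s <= p + s <= b by rewrite pp pb.
have cqd : c <= q - s <= d by rewrite cq qd'.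
have qqd : q - s <= q + s <= d by rewrite qq qd.
have c1 : continuous_boundary g a b c d by apply: cb.
have c2 : continuous_boundary g a (p - s) c d by apply: cb.
have c3 : continuous_boundary g (p - s) b c d by apply: cb.
have c4 : continuous_boundary g (p - s) (p + s) c d by apply: cb.
have c5 : continuous_boundary g (p - s) (p + s) c (q - s) by apply: cb.
have c6 : continuous_boundary g (p - s) (p + s) (q - s) d by apply: cb.
have c7 : continuous_boundary g (p - s) (p + s) (q - s) (q + s) by apply: cb.
rewrite (rectint_splith apb c2 c1) (rectint_splith ppb c4 c3).
rewrite (rectint_splitv cqd c5 c4) (rectint_splitv qqd c7 c6).
rewrite (G0 a (p - s)) ?psp// (G0 (p + s) b) ?pps ?orbT//.
rewrite (G0 _ _ c (q - s)) ?qsq ?orbT// (G0 _ _ (q + s) d) ?qqs ?orbT//.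
by rewrite add0r add0r !addr0.
Qed.

Lemma differentiable_inv l z : z != l ->
  differentiable (fun w : R[i] => (w - l)^-1 : R[i]) z.
Proof.
move=> zl; apply: differentiableV; last by rewrite subr_eq0.
by apply: differentiableB.
Qed.

(** The contour is shrunk to a square of half side s around the pole. There f(l) / (z - l)
    integrates to 2 pi i f(l), while (f(z) - f(l)) / (z - l) is bounded by |f'(l)| + 1 and
    contributes O(s). *)
Lemma Cauchy_formula f p q a b c d : a < p < b -> c < q < d ->
  (forall z, rect a b c d z -> differentiable f z) ->
  (0 +i* (2 * pi)) * f (p +i* q) =
  rectint (fun z => f z * (z - p +i* q)^-1) a b c d.
Proof.
move=> /andP[ap pb] /andP[cq qd] df; set l := p +i* q.
pose K z := (z - l)^-1.
have dK z : z != l -> differentiable K z by exact: differentiable_inv.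
have dfK z : rect a b c d z -> z != l -> differentiable (fun z => f z * K z) z.
  by move=> /df fz /dK; exact: differentiableM.
pose m := Num.min (Num.min (p - a) (b - p)) (Num.min (q - c) (d - q)).
have m0 : 0 < m by rewrite !lt_min !subr_gt0 ap pb cq qd.
have rect_l : rect a b c d l by rewrite /rect/= !ltW.
have [D fD] := differentiable_normcP (df l rect_l).
have {fD} [r r0 fD] := fD 1 ltr01.
pose M := normc D + 1.
have M0 : 0 <= M by rewrite addr_ge0 ?normc_ge0.
set I := rectint _ a b c d.
suff small s : 0 < s -> s < m -> 2 * s < r ->
    normc (I - (0 +i* (2 * pi)) * f l) <= 16 * M * s.
  apply/eqP; rewrite eq_sym -subr_eq0; apply/eqP/eq0_normc/eqP.
  rewrite eq_le normc_ge0 andbT leNgt; apply/negP => n0.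
  set e := normc _ in small n0.
  (* The divisors 2 and 3 give the strict inequalities s < m and 2 s < r; the last entry makes 16 M
     s smaller than e. Here 16 s is 4 times the half perimeter 2 s + 2 s, as in [rectint_le]. *)
  pose s := Num.min (Num.min (m / 2) (r / 3)) (e / (16 * M + 1)).
  have L0 : 0 < 16 * M + 1 by rewrite ltr_wpDl// mulr_ge0.
  have s0 : 0 < s by rewrite !lt_min !divr_gt0.
  have sm : s < m.
    have : s <= m / 2 by rewrite !ge_min lexx.
    by move: m0; clear; lra.
  have sr : 2 * s < r.
    have : s <= r / 3 by rewrite !ge_min lexx orbT.
    by move: r0; clear; lra.
  have : s * (16 * M + 1) <= e by rewrite -ler_pdivlMr// !ge_min lexx orbT.
  have := small s s0 sm sr; move: s0; clear; lra.
move=> s0 sm sr.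
have [pa [bp [qc dq]]] : a <= p - s /\ p + s <= b /\ c <= q - s /\ q + s <= d.
  move: sm; rewrite !lt_min => /andP[/andP[s1 s2] /andP[s3 s4]].
  by clear -s1 s2 s3 s4; repeat split; lra.
have psp : p - s < p by rewrite ltrBlDr ltrDl.
have pps : p < p + s by rewrite ltrDl.
have qsq : q - s < q by rewrite ltrBlDr ltrDl.
have qqs : q < q + s by rewrite ltrDl.
have pp := ltW (lt_trans psp pps); have qq := ltW (lt_trans qsq qqs).
have IE : I = rectint (fun z => f z * K z) (p - s) (p + s) (q - s) (q + s).
  exact: rectint_shrink.
have cK : continuous_boundary K (p - s) (p + s) (q - s) (q + s).
  have cKz z : z != l -> {for z, continuous K}.
    by move=> /dK; exact: differentiable_continuous.
  split; [apply: continuous_hseg|apply: continuous_hseg|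
    apply: continuous_vseg|apply: continuous_vseg] => ? _; apply: cKz;
    by rewrite /l eq_complex /= negb_and ?(lt_eqF psp) ?(gt_eqF pps)
      ?(lt_eqF qsq) ?(gt_eqF qqs) ?orbT.
have sub z : rect (p - s) (p + s) (q - s) (q + s) z -> rect a b c d z.
  move=> [/andP[z1 z2] /andP[z3 z4]].
  by rewrite /rect/= (le_trans pa z1) (le_trans z2 bp) (le_trans qc z3)
    (le_trans z4 dq).
have cf : continuous_boundary f (p - s) (p + s) (q - s) (q + s).
  apply: continuous_rect_boundary => // z /sub/df.
  exact: differentiable_continuous.
pose h z := (f z - f l) * K z.
have ch := continuous_boundaryM
  (continuous_boundaryB cf (continuous_boundary_cst (f l) _ _ _ _)) cK.
have cfl := continuous_boundaryM (continuous_boundary_cst (f l) _ _ _ _) cK.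
have -> : I - (0 +i* (2 * pi)) * f l =
    rectint h (p - s) (p + s) (q - s) (q + s).
  rewrite IE mulrC -(rectint_inv l s0) -(rectintZ (f l) cK).
  apply/eqP; rewrite subr_eq; apply/eqP.
  rewrite -(rectintD ch cfl); apply: eq_rectint => // z _ _.
  by rewrite -mulrDl subrK.
have hM z : rect (p - s) (p + s) (q - s) (q + s) z -> normc (h z) <= M.
  move=> [/andP[z1 z2] /andP[z3 z4]].
  have [->|zl] := eqVneq z l; first by rewrite /h subrr mul0r normc0.
  have zln : 0 < normc (z - l).
    rewrite lt_def normc_ge0 andbT; apply/eqP => /eq0_normc/eqP.
    by rewrite subr_eq0 (negbTE zl).
  have : normc (z - l) < r.
    apply: le_lt_trans sr; apply: (le_trans (normc_le_ReIm _)).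
    have -> : Re (z - l) = Re z - p by case: (z) => [? ?].
    have -> : Im (z - l) = Im z - q by case: (z) => [? ?].
    rewrite mulrDl mul1r; clear -z1 z2 z3 z4 s0.
    by apply: lerD; rewrite ler_norml; apply/andP; split; lra.
  move=> /fD; rewrite [l + _]addrC subrK mul1r => H.
  rewrite /h normcM normcV ler_pdivrMr// /M mulrDl mul1r -normcM.
  have := le_normcD (f z - f l - D * (z - l)) (D * (z - l)).
  rewrite subrK; move: H; clear; lra.
apply: (le_trans (rectint_le pp qq ch (fun z zr _ => hM z zr))).
by rewrite le_eqVlt; apply/orP; left; apply/eqP; ring.
Qed.

End cauchy_formula.

(** * Second-order Taylor estimates in one variable *)

Section cauchy_estimates.
Context {R : realType}.
Notation mu := (@lebesgue_measure R).
Implicit Types (a b c d m s p q M : R) (f g : R[i] -> R[i]) (k l z : R[i]).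

Lemma ReB (z w : R[i]) : Re (z - w) = Re z - Re w.
Proof. by case: z w => [? ?] [? ?]. Qed.

Lemma ImB (z w : R[i]) : Im (z - w) = Im z - Im w.
Proof. by case: z w => [? ?] [? ?]. Qed.

Lemma normc_gt0 (z : R[i]) : (0 < normc z) = (z != 0).
Proof.
rewrite lt_def normc_ge0 andbT; congr negb; apply/eqP/eqP => [/eq0_normc//|->].
exact: normc0.
Qed.

Lemma normc_2pii : normc (0 +i* (2 * pi) : R[i]) = 2 * pi.
Proof.
by rewrite /normc/= expr0n/= add0r sqrtr_sqr ger0_norm// mulr_ge0// pi_ge0.
Qed.

Lemma differentiable_continuous_rect f a b c d : a <= b -> c <= d ->
  (forall z, rect a b c d z -> differentiable f z) ->
  continuous_boundary f a b c d.
Proof.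
move=> ab cd df; apply: continuous_rect_boundary => // z /df.
exact: differentiable_continuous.
Qed.

Lemma boundary_dist s (z l : R[i]) : 0 < s -> normc l <= s / 2 ->
  Re z = - s \/ Re z = s \/ Im z = - s \/ Im z = s -> s / 2 <= normc (z - l).
Proof.
move=> s0 ls; have := abs_Re_le l; have := abs_Im_le l.
have := abs_Re_le (z - l); have := abs_Im_le (z - l).
rewrite ReB ImB !ler_norml => /andP[? ?] /andP[? ?] /andP[? ?] /andP[? ?].
by case=> [zE|[zE|[zE|zE]]]; lra.
Qed.

(** Cauchy's formula is expanded with 1 / (z - l) = 1 / z + l / z^2 + l^2 / (z^2 (z - l)); on the
    contour |z| >= s and |z - l| >= s / 2. The factor 1 / (2 pi) is simply bounded by 1, so that 16
    = 4 * 4 and 32 = 4 * 2 * 4 come from [rectint_le] on a square of half perimeter 4 s. *)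
Lemma taylor_remainder f s M : 0 < s ->
  (forall z, rect (- s) s (- s) s z -> differentiable f z) ->
  (forall z, rect (- s) s (- s) s z -> normc (f z) <= M) ->
  exists2 D : R[i], normc D <= 16 * M / s &
  forall l, normc l <= s / 2 ->
    normc (f l - f 0 - D * l) <= 32 * M / s ^+ 2 * normc l ^+ 2.
Proof.
move=> s0 df fM; pose S := rect (- s) s (- s) s.
pose B z := Re z = - s \/ Re z = s \/ Im z = - s \/ Im z = s.
have ss : - s <= s by lra.
have S0 : S 0 by rewrite /S /rect/=; split; lra.
have M0 : 0 <= M := le_trans (normc_ge0 _) (fM _ S0).
pose u : R[i] := 0 +i* (2 * pi).
have u1 : 1 <= normc u by rewrite normc_2pii; have := pi_ge2 R; lra.
have un0 : u != 0 by rewrite -normc_gt0 (lt_le_trans ltr01).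
have inv_le z : normc (u^-1 * z) <= normc z.
  rewrite normcM normcV ler_piMl ?normc_ge0// invf_le1// ?(lt_le_trans ltr01)//.
have cf := differentiable_continuous_rect ss ss df.
pose K (l z : R[i]) : R[i] := (z - l)^-1.
have cK l : normc l <= s / 2 -> continuous_boundary (K l) (- s) s (- s) s.
  move=> ls; have cz z : B z -> {for z, continuous (K l)}.
    move=> Bz; apply: differentiable_continuous; apply: differentiable_inv.
    rewrite -subr_eq0 -normc_gt0 (lt_le_trans _ (boundary_dist s0 ls Bz))//.
    by rewrite divr_gt0.
  split; [apply: continuous_hseg|apply: continuous_hseg|
    apply: continuous_vseg|apply: continuous_vseg] => x _; apply: cz.
  - by right; right; left.
  - by right; right; right.
  - by left.
  - by right; left.
have n0 : normc (0 : R[i]) <= s / 2 by rewrite normc0 divr_ge0// ltW.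
have cK0 := cK 0 n0.
pose g z := f z * (K 0 z * K 0 z).
have cg := continuous_boundaryM cf (continuous_boundaryM cK0 cK0).
have cauchy l : normc l <= s / 2 ->
    u * f l = rectint (fun z => f z * (z - l)^-1) (- s) s (- s) s.
  move=> ls; have := abs_Re_le l; have := abs_Im_le l.
  case: l ls => p q ls; rewrite !ler_norml /= => /andP[? ?] /andP[? ?].
  by apply: Cauchy_formula => //; apply/andP; split; lra.
have invB l z : normc l <= s / 2 -> B z -> normc ((z - l)^-1) <= 2 / s.
  move=> ls Bz; have := boundary_dist s0 ls Bz => H; rewrite normcV.
  rewrite -[2 / s]invrK invf_div lef_pV2// ?posrE ?divr_gt0//.
  by rewrite (lt_le_trans _ H)// divr_gt0.
exists (u^-1 * rectint g (- s) s (- s) s).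
  apply: (le_trans (inv_le _)).
  have -> : 16 * M / s = 4 * (M / s ^+ 2 * (s - - s + (s - - s))).
    by field; rewrite gt_eqF.
  apply: (rectint_le ss ss cg) => z Sz Bz.
  rewrite normcM; apply: ler_pM => //; try exact: normc_ge0; first exact: fM.
  rewrite /K subr0 normcM normcV -invfM lef_pV2//.
  - rewrite -expr2 ler_pXn2r// ?nnegrE ?normc_ge0// ?(ltW s0)//.
    have := abs_Re_le z; have := abs_Im_le z; rewrite !ler_norml.
    by move=> /andP[? ?] /andP[? ?]; case: Bz => [?|[?|[?|?]]]; lra.
  - rewrite posrE mulr_gt0//; (apply: lt_le_trans (_ : 0 < s / 2) _;
      [by rewrite divr_gt0|by have := boundary_dist s0 n0 Bz; rewrite subr0]).
  - by rewrite posrE exprn_gt0.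
move=> l ls; pose h z := f z * (K 0 z * K 0 z * K l z).
have ch := continuous_boundaryM cf
  (continuous_boundaryM (continuous_boundaryM cK0 cK0) (cK l ls)).
have zB z w : normc w <= s / 2 -> B z -> z - w != 0.
  move=> ws Bz; rewrite -normc_gt0 (lt_le_trans _ (boundary_dist s0 ws Bz))//.
  by rewrite divr_gt0.
have cauchy0 := cauchy 0 n0.
have E : u * f l = u * f 0 + l * rectint g (- s) s (- s) s +
    l ^+ 2 * rectint h (- s) s (- s) s.
  rewrite (cauchy l ls) cauchy0.
  have cfK := continuous_boundaryM cf cK0.
  have clg := continuous_boundaryM (continuous_boundary_cst l _ _ _ _) cg.
  have clh := continuous_boundaryM (continuous_boundary_cst (l ^+ 2) _ _ _ _) ch.
  rewrite -(rectintZ l cg) -(rectintZ (l ^+ 2) ch).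
  rewrite -(rectintD cfK clg) -(rectintD (continuous_boundaryD cfK clg) clh).
  apply: eq_rectint => // z _ Bz.
  have z1 := zB z l ls Bz; have := zB z 0 n0 Bz; rewrite subr0 => z2.
  by rewrite /g /h /K subr0; field; rewrite z1 z2.
have -> : f l - f 0 - u^-1 * rectint g (- s) s (- s) s * l =
   u^-1 * (l ^+ 2 * rectint h (- s) s (- s) s).
  apply: (mulfI un0); rewrite [RHS]mulVKf// !mulrBr E mulrA mulVKf//.
  by ring.
apply: (le_trans (inv_le _)); rewrite normcM expr2 normcM mulrC -expr2.
rewrite ler_wpM2r ?sqr_ge0//.
have -> : 32 * M / s ^+ 2 = 4 * (M * (s^-1 * s^-1 * (2 / s)) * (s - - s + (s - - s))).
  by field; rewrite gt_eqF.
apply: (rectint_le ss ss ch) => z Sz Bz.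
rewrite normcM; apply: ler_pM => //; try exact: normc_ge0; first exact: fM.
have zs : s <= normc z.
  have := abs_Re_le z; have := abs_Im_le z; rewrite !ler_norml.
  by move=> /andP[? ?] /andP[? ?]; case: Bz => [?|[?|[?|?]]]; lra.
have iz : normc (K 0 z) <= s^-1.
  by rewrite /K subr0 normcV lef_pV2// posrE (lt_le_trans s0).
rewrite !normcM; apply: ler_pM; rewrite ?mulr_ge0 ?normc_ge0//; last exact: invB.
by apply: ler_pM; rewrite ?normc_ge0.
Qed.

(** Identifies the coefficient produced by Cauchy's formula with a derivative [D] known beforehand.
    In several variables [D] will be the gradient applied to a direction, which is how gradients get
    bounded. *)
Lemma taylor_bound f s M D : 0 < s ->
  (forall z, rect (- s) s (- s) s z -> differentiable f z) ->
  (forall z, rect (- s) s (- s) s z -> normc (f z) <= M) ->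
  (forall e : R, 0 < e -> exists2 r : R, 0 < r & forall h, normc h < r ->
     normc (f h - f 0 - D * h) <= e * normc h) ->
  normc D <= 16 * M / s /\
  forall l, normc l <= s / 2 ->
    normc (f l - f 0 - D * l) <= 32 * M / s ^+ 2 * normc l ^+ 2.
Proof.
move=> s0 df fM dfD; have [D' D'M fD'] := taylor_remainder s0 df fM.
suff -> : D = D' by [].
apply/eqP; rewrite -subr_eq0; apply/negPn; rewrite -normc_gt0; apply/negP => n0.
set n := normc _ in n0.
have n30 : 0 < n / 3 by rewrite divr_gt0.
have [r r0 fr] := dfD _ n30.
have M0 : 0 <= M.
  by apply: (le_trans (normc_ge0 (f 0))); apply: fM; rewrite /rect/=; lra.
pose L := 32 * M / s ^+ 2 + 1.
have L0 : 0 < L by rewrite ltr_wpDl// divr_ge0 ?sqr_ge0//; exact: mulr_ge0.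
(* At the real point t both expansions are valid, and comparing them gives n <= (t L - t) + n / 3 <=
   2 n / 3 - t, a contradiction. *)
pose t := Num.min (Num.min (r / 2) (s / 2)) (n / 3 / L).
have t0 : 0 < t by rewrite !lt_min !divr_gt0.
have tr : t <= r / 2 by rewrite !ge_min lexx.
have ts : t <= s / 2 by rewrite !ge_min lexx !orbT.
have tL : t * L <= n / 3 by rewrite -ler_pdivlMr// !ge_min lexx orbT.
have nt : normc t%:C = t by rewrite normc_real gtr0_norm.
have tr' : normc t%:C < r by rewrite nt; move: r0 tr; clear; lra.
have ts' : normc t%:C <= s / 2 by rewrite nt.
have := fr _ tr'; have := fD' _ ts'; rewrite nt => H1 H2.
have : n * t <= 32 * M / s ^+ 2 * t ^+ 2 + n / 3 * t.
  have -> : n * t = normc ((f t%:C - f 0 - D' * t%:C) - (f t%:C - f 0 - D * t%:C)).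
    rewrite -{1}nt -normcM; congr normc; ring.
  by apply: (le_trans (le_normcD _ _)); rewrite normcN; apply: lerD.
rewrite expr2 mulrA -mulrDl ler_pM2r//.
have : 32 * M / s ^+ 2 * t = t * L - t by rewrite /L; ring.
by move: tL n0 t0; clear; lra.
Qed.

End cauchy_estimates.

(** * The sub-mean value inequality *)

Section sub_mean_value.
Context {R : realType}.
Notation mu := (@lebesgue_measure R).
Let RT : measurableType _ := measurableTypeR R.
Implicit Types (a b c d m s p q M : R) (f g : R[i] -> R[i]).

Lemma integral_normc_le f (gamma : R -> R[i]) a b (h : RT -> \bar R) :
  continuous_seg a b (fun x => f (gamma x)) ->
  measurable_fun [set: RT] h -> (forall x, (0 <= h x)%E) ->
  (forall x, a <= x <= b -> h x = (normc (f (gamma x)))%:E) ->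
  ((\int[mu]_(x in `[a, b]) normc (f (gamma x)))%:E <= \int[mu]_x h x)%E.
Proof.
move=> cf mh h0 hE.
have ci : mu.-integrable `[a, b] (EFin \o (fun x => normc (f (gamma x)))).
  apply: continuous_seg_integrable => x /cf fx.
  by apply: (@continuous_comp R R[i] R (fun x => f (gamma x)) (@normc R)) => //;
    exact: continuous_normc.
rewrite /Rintegral fineK; last exact: integrable_fin_num.
rewrite (@eq_integral _ _ _ mu `[a, b]%classic h); last first.
  by move=> x; rewrite inE /= in_itv/= => /hE ->.
by apply: ge0_subset_integral.
Qed.

Lemma cint_mul_le (f K : R -> R[i]) a b M :
  continuous_seg a b f -> continuous_seg a b K ->
  (forall x, a <= x <= b -> normc (K x) <= M) ->
  normc (cint a b (fun x => f x * K x)) <=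
    2 * M * \int[mu]_(x in `[a, b]) normc (f x).
Proof.
move=> cf cK KM; apply: (le_trans (normc_cint_le_int (continuous_segM cf cK))).
have ci (g : R -> R[i]) : continuous_seg a b g ->
    mu.-integrable `[a, b] (EFin \o (fun x => normc (g x))).
  move=> cg; apply: continuous_seg_integrable => x /cg gx.
  by apply: (@continuous_comp R R[i] R g (@normc R)) => //;
    exact: continuous_normc.
rewrite -mulrA ler_wpM2l// -RintegralZl//; last exact: ci.
apply: le_Rintegral => //; first exact: ci (continuous_segM cf cK).
  exact: (integrableZl _ M (ci _ cf)).
move=> x; rewrite /= in_itv/= => /KM KxM.
by rewrite normcM mulrC ler_wpM2r ?normc_ge0.
Qed.

Lemma exists_small_or_large (A : set R) (T : R) (H : RT -> \bar R) :
  (exists2 x, A x & (H x < T%:E)%E) \/ (forall x, A x -> (T%:E <= H x)%E).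
Proof.
have [|noH] := pselect (exists2 x, A x & (H x < T%:E)%E); first by left.
by right=> x Ax; rewrite leNgt; apply/negP => HxT; apply: noH; exists x.
Qed.

Lemma integral_ge_cst (T a b : R) (H : RT -> \bar R) : a <= b -> 0 <= T ->
  measurable_fun [set: RT] H -> (forall x, (0 <= H x)%E) ->
  (forall x, a <= x <= b -> (T%:E <= H x)%E) ->
  ((T * (b - a))%:E <= \int[mu]_x H x)%E.
Proof.
move=> ab T0 mH H0 HT.
apply: (@le_trans _ _ (\int[mu]_(x in `[a, b]) H x)%E); last first.
  exact: ge0_subset_integral.
have -> : (T * (b - a))%:E = (\int[mu]_(x in `[a, b]) (cst T%:E) x)%E.
  rewrite (_ : integral _ _ _ = T%:E * mu `[a, b])%E; last exact: integral_cst.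
  rewrite lebesgue_measure_itv/= lte_fin EFinM.
  by move: ab; rewrite le_eqVlt => /predU1P[->|->]//; rewrite ltxx subrr.
by apply: ge0_le_integral => //; exact: measurable_funTS.
Qed.

(* In one of the four strips between distance r / 2 and r from the center, the
   integral of |f| over every line is at least r |f(center)| / 4: otherwise
   Cauchy's formula on a rectangle with its sides on four bad lines is violated.
   Hence the constant 8 / r^2 = (4 / r) * (2 / r). *)
Lemma sub_mean_value f p q r (h : RT * RT -> \bar R) : 0 < r ->
  (forall z, rect (p - r) (p + r) (q - r) (q + r) z -> differentiable f z) ->
  measurable_fun [set: RT * RT] h ->
  (forall xy, (0 <= h xy)%E) ->
  (forall x y, p - r <= x <= p + r -> q - r <= y <= q + r ->
     h (x, y) = (normc (f (x +i* y)))%:E) ->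
  ((normc (f (p +i* q)))%:E <=
   (8 / r ^+ 2)%:E * \int[lebesgue_plane]_xy h xy)%E.
Proof.
move=> r0 df mh h0 hE; set X := normc (f (p +i* q)).
have X0 : 0 <= X by exact: normc_ge0.
have r20 : 0 < r / 2 by rewrite divr_gt0.
pose V (x : RT) := (\int[mu]_y h (x, y))%E.
pose H (y : RT) := (\int[mu]_x h (x, y))%E.
have mV : measurable_fun [set: RT] V by exact: measurable_fun_fubini_tonelli_F.
have mH : measurable_fun [set: RT] H by exact: measurable_fun_fubini_tonelli_G.
have V0 x : (0 <= V x)%E by exact: integral_ge0.
have H0 y : (0 <= H y)%E by exact: integral_ge0.
set I := (\int[lebesgue_plane]_xy h xy)%E.
have IV : I = (\int[mu]_x V x)%E by exact: fubini_tonelli1.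
have IH : I = (\int[mu]_y H y)%E by exact: fubini_tonelli2.
pose T := r * X / 4.
have T0 : 0 <= T by rewrite divr_ge0// mulr_ge0// ltW.
suff : ((T * (r / 2))%:E <= I)%E.
  move=> TI; have -> : X%:E = ((8 / r ^+ 2)%:E * (T * (r / 2))%:E)%E.
    by rewrite -EFinM /T; congr EFin; field; rewrite gt_eqF.
  by rewrite lee_pmul2l// lte_fin divr_gt0// exprn_gt0.
have half (u v : R) (G : RT -> \bar R) : v - u = r / 2 -> measurable_fun [set: RT] G ->
    (forall x, (0 <= G x)%E) -> I = (\int[mu]_x G x)%E ->
    ((T * (r / 2))%:E <= I)%E \/ exists2 x, u <= x <= v & (G x < T%:E)%E.
  move=> uv mG G0 ->; have uv' : u <= v by rewrite -subr_ge0 uv ltW.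
  have [[x]|GT] := exists_small_or_large [set x | u <= x <= v] T G.
    by move=> xuv Gx; right; exists x.
  by left; rewrite -uv; apply: integral_ge_cst.
have [//|[a /andP[a1 a2] Va]] := half (p - r) (p - r / 2) V ltac:(by field) mV V0 IV.
have [//|[b /andP[b1 b2] Vb]] := half (p + r / 2) (p + r) V ltac:(by field) mV V0 IV.
have [//|[c /andP[c1 c2] Hc]] := half (q - r) (q - r / 2) H ltac:(by field) mH H0 IH.
have [//|[d /andP[d1 d2] Hd]] := half (q + r / 2) (q + r) H ltac:(by field) mH H0 IH.
have ap : a < p by move: a2 r20; clear; lra.
have pb : p < b by move: b1 r20; clear; lra.
have cq : c < q by move: c2 r20; clear; lra.
have qd : q < d by move: d1 r20; clear; lra.
have ab := ltW (lt_trans ap pb); have cd := ltW (lt_trans cq qd).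
have sub z : rect a b c d z -> rect (p - r) (p + r) (q - r) (q + r) z.
  move=> [/andP[z1 z2] /andP[z3 z4]].
  by rewrite /rect/= (le_trans a1 z1) (le_trans z2 b2) (le_trans c1 z3)
    (le_trans z4 d2).
have := Cauchy_formula (introT andP (conj ap pb)) (introT andP (conj cq qd))
  (fun z zr => df z (sub z zr)).
move=> /(congr1 (@normc R)); rewrite normcM normc_2pii -/X => E.
pose K (z : R[i]) : R[i] := (z - p +i* q)^-1.
pose B z := Re z = a \/ Re z = b \/ Im z = c \/ Im z = d.
have zB z : B z -> r / 2 <= normc (z - p +i* q).
  have := abs_Re_le (z - p +i* q); have := abs_Im_le (z - p +i* q).
  rewrite ReB ImB !ler_norml /= => /andP[z1 z2] /andP[z3 z4].
  by case=> [zE|[zE|[zE|zE]]]; move: z1 z2 z3 z4; rewrite zE;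
    clear -a2 b1 c2 d1; lra.
have KB z : B z -> normc (K z) <= 2 / r.
  move=> /zB Bz; rewrite /K normcV -[2 / r]invrK invf_div lef_pV2// ?posrE//.
  exact: lt_le_trans Bz.
have cf := differentiable_continuous_rect ab cd (fun z zr => df z (sub z zr)).
have cK : continuous_boundary K a b c d.
  have cz z : B z -> {for z, continuous K}.
    move=> Bz; apply: differentiable_continuous; apply: differentiable_inv.
    by rewrite -subr_eq0 -normc_gt0 (lt_le_trans _ (zB _ Bz)).
  split; [apply: continuous_hseg|apply: continuous_hseg|
    apply: continuous_vseg|apply: continuous_vseg] => x _; apply: cz.
  - by right; right; left.
  - by right; right; right.
  - by left.
  - by right; left.
have mHy (y : R) : measurable_fun [set: RT] (fun x : RT => h (x, y)).
  exact: measurableT_comp mh (pair2_measurable y).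
have mVx (x : R) : measurable_fun [set: RT] (fun y : RT => h (x, y)).
  exact: measurableT_comp mh (pair1_measurable x).
case: (cf) => fc fd fa fb; case: (cK) => Kc Kd Ka Kb.
have [apr bpr] : a <= p + r /\ p - r <= b by move: ap pb r0; clear; lra.
have [cqr dqr] : c <= q + r /\ q - r <= d by move: cq qd r0; clear; lra.
have ic : \int[mu]_(x in `[a, b]) normc (f (x +i* c)) < T.
  rewrite -lte_fin (le_lt_trans _ Hc)//.
  apply: (integral_normc_le fc) => // x /andP[xa xb]; apply: hE.
    by rewrite (le_trans a1 xa) (le_trans xb b2).
  by rewrite c1 cqr.
have id' : \int[mu]_(x in `[a, b]) normc (f (x +i* d)) < T.
  rewrite -lte_fin (le_lt_trans _ Hd)//.
  apply: (integral_normc_le fd) => // x /andP[xa xb]; apply: hE.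
    by rewrite (le_trans a1 xa) (le_trans xb b2).
  by rewrite d2 dqr.
have ia : \int[mu]_(y in `[c, d]) normc (f (a +i* y)) < T.
  rewrite -lte_fin (le_lt_trans _ Va)//.
  apply: (integral_normc_le fa) => // y /andP[yc yd]; apply: hE.
    by rewrite a1 apr.
  by rewrite (le_trans c1 yc) (le_trans yd d2).
have ib : \int[mu]_(y in `[c, d]) normc (f (b +i* y)) < T.
  rewrite -lte_fin (le_lt_trans _ Vb)//.
  apply: (integral_normc_le fb) => // y /andP[yc yd]; apply: hE.
    by rewrite b2 bpr.
  by rewrite (le_trans c1 yc) (le_trans yd d2).
have bc := cint_mul_le fc Kc (fun x _ => KB (x +i* c) (or_intror (or_intror (or_introl erefl)))).
have bd := cint_mul_le fd Kd (fun x _ => KB (x +i* d) (or_intror (or_intror (or_intror erefl)))).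
have ba := cint_mul_le fa Ka (fun y _ => KB (a +i* y) (or_introl erefl)).
have bb := cint_mul_le fb Kb (fun y _ => KB (b +i* y) (or_intror (or_introl erefl))).
move: E; rewrite (rectintE (continuous_boundaryM cf cK)) => E.
(* The kernel is at most 2 / r on the contour, so by the choice of [T] each of the four sides
   contributes less than X. Thus 2 pi X < 4 X, against pi >= 2. *)
exfalso; have TX : 2 * (2 / r) * T = X by rewrite /T; field; rewrite gt_eqF.
have r4 : 0 < 2 * (2 / r) by rewrite mulr_gt0// divr_gt0.
rewrite -(ltr_pM2l r4) TX in ic; rewrite -(ltr_pM2l r4) TX in id'.
rewrite -(ltr_pM2l r4) TX in ia; rewrite -(ltr_pM2l r4) TX in ib.
have {bc ic} := le_lt_trans bc ic; have {bd id'} := le_lt_trans bd id'.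
have {ba ia} := le_lt_trans ba ia; have {bb ib} := le_lt_trans bb ib.
move: E; set Ia := cint c d _; set Ib := cint c d (fun y => f (a +i* y) * _).
set Ic := cint a b _; set Id := cint a b (fun x => f (x +i* d) * _) => E.
have := le_normcD (Ic - Id) ((0 +i* 1) * (Ia - Ib)).
rewrite -E normcM normc_i mul1r.
have := le_normcD Ic (- Id); have := le_normcD Ia (- Ib); rewrite !normcN.
have := ler_wpM2r X0 (pi_ge2 R); rewrite -[2 * pi * X]mulrA.
by clear; lra.
Qed.

End sub_mean_value.

(** * From one variable to several, by Tonelli's theorem *)

Section tuple_sub_mean.
Context {R : realType}.
Let RT : measurableType _ := measurableTypeR R.
Let P : measurableType _ := (RT * RT)%type.

Definition tuple_upd n (t : n.-tuple P) (i : 'I_n) (x : P) : n.-tuple P :=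
  [tuple if j == i then x else tnth t j | j < n].

Lemma tnth_upd n (t : n.-tuple P) i x j :
  tnth (tuple_upd t i x) j = if j == i then x else tnth t j.
Proof. by rewrite tnth_mktuple. Qed.

Lemma measurable_tuple_upd n (t : n.-tuple P) i :
  measurable_fun [set: P] (tuple_upd t i).
Proof.
apply/measurable_fun_tnthP => j.
rewrite (_ : _ \o _ = if j == i then id else cst (tnth t j)).
  by case: ifP => _; [exact: measurable_id|exact: measurable_cst].
by apply/funext => x; rewrite /= tnth_upd; case: ifP.
Qed.

Lemma measurable_cons_tuple n (x : P) :
  measurable_fun [set: n.-tuple P] (fun t => tuple_cons (x, t)).
Proof.
exact: (measurableT_comp (@measurable_tuple_cons _ P n) (pair1_measurable x)).
Qed.

Lemma measurable_consr_tuple n (t : n.-tuple P) :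
  measurable_fun [set: P] (fun x => tuple_cons (x, t)).
Proof.
exact: (measurableT_comp (@measurable_tuple_cons _ P n) (pair2_measurable t)).
Qed.

(** Coordinates are released from the center one at a time, in increasing order. When coordinate i
    is averaged, those from i on still sit at the center and the earlier ones are arbitrary, so the
    one-variable inequality is assumed at such points. Each averaging costs a factor K. *)
Lemma tuple_sub_mean n (c : n.-tuple P) (h : n.-tuple P -> \bar R) (K : R) :
  0 <= K -> measurable_fun [set: n.-tuple P] h -> (forall t, (0 <= h t)%E) ->
  (forall (i : 'I_n) (t : n.-tuple P),
     (forall j : 'I_n, (i <= j)%N -> tnth t j = tnth c j) ->
     (h t <= K%:E * \int[@lebesgue_plane R]_x h (tuple_upd t i x))%E) ->
  (h c <= (K ^+ n)%:E * \int[power_measure (@lebesgue_plane R) n]_t h t)%E.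
Proof.
move=> K0; elim: n => [|n IH] in c h *; move=> mh h0 hK.
  rewrite expr0 mul1e /= integral_dirac// diracT mul1e.
  by rewrite (tuple0 c).
rewrite [power_measure _ _]/= ge0_integral_pushforward//=; last exact: measurable_tuple_cons.
rewrite preimage_setT.
pose hc (z : P * n.-tuple P) := h (tuple_cons z).
have mhc : measurable_fun [set: P * n.-tuple P] hc.
  exact: (measurableT_comp mh (@measurable_tuple_cons _ P n)).
have fub := fubini_tonelli1 (m1 := @lebesgue_plane R)
  (m2 := power_measure (@lebesgue_plane R) n) hc mhc (fun z => h0 _).
rewrite [integral _ _ _]fub.
pose c' := [tuple of behead c].
have cE : c = tuple_cons (thead c, c') by rewrite [LHS]tuple_eta; exact/val_inj.
have step1 : (h c <= K%:E * \int[@lebesgue_plane R]_x h (tuple_cons (x, c')))%E.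
  apply: (le_trans (hK ord0 c _)) => //.
  rewrite le_eqVlt; apply/orP; left; apply/eqP; congr (_ * _)%E.
  apply: eq_integral => x _; congr h; apply: eq_from_tnth => j.
  rewrite tnth_upd cE; case: (unliftP ord0 j) => [k|] -> //.
  by rewrite !tnthS.
apply: (le_trans step1).
have F0 x : (0 <= fubini_F (power_measure (@lebesgue_plane R) n) hc x)%E.
  by apply: integral_ge0 => t _; exact: h0.
have mF := measurable_fun_fubini_tonelli_F (m2 := power_measure (@lebesgue_plane R) n)
  hc mhc (fun z => h0 _).
rewrite exprS EFinM -muleA lee_wpmul2l ?lee_fin//.
rewrite -ge0_integralZl//; last by rewrite lee_fin exprn_ge0.
apply: ge0_le_integral => //.
- exact: (measurableT_comp mh (measurable_consr_tuple c')).
- by apply: measurable_funeM; exact mF.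
move=> x _; apply: (IH c' (fun t => h (tuple_cons (x, t)))) => //.
  exact: (measurableT_comp mh (measurable_cons_tuple x)).
(* Index i of the tail is index i + 1 of the whole tuple, so the already released head [x] is not
   among the coordinates that must agree with [c]. *)
move=> i t tc; apply: (le_trans (hK (lift ord0 i) (tuple_cons (x, t)) _)).
  move=> j; case: (unliftP ord0 j) => [k|] -> //= ik.
  rewrite tnthS cE [RHS]tnthS; apply: tc.
  by move: ik; rewrite /bump !leq0n !add1n ltnS.
rewrite le_eqVlt; apply/orP; left; apply/eqP; congr (_ * _)%E.
apply: eq_integral => y _; congr h; apply: eq_from_tnth => j.
rewrite tnth_upd; case: (unliftP ord0 j) => [k|] -> //.
by rewrite (inj_eq lift_inj) !tnthS tnth_upd.
Qed.

End tuple_sub_mean.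

(** * Several variables *)

Lemma differentiable_littleo (K : numFieldType) (V W : normedModType K)
    (g : V -> W) (z : V) : g z = 0 ->
  (forall e : K, 0 < e -> \forall h \near 0, `|g (h + z)| <= e * `|h|) ->
  differentiable g z.
Proof.
move=> gz gE.
have lin0 : continuous (\0 : {linear V -> W}) by exact: cst_continuous.
have ge : g \o shift z = cst (g z) + (\0 : {linear V -> W}) +o_ 0 id.
  apply/eqaddoP => e e0; near=> h.
  by rewrite /= !fctE /= gz add0r subr0; near: h; exact: gE.
by apply/diff_locallyP; rewrite (diff_unique lin0 ge).
Unshelve. all: by end_near. Qed.

Section complex_space.
Context {R : realType} (n : nat).
Local Notation V := 'rV[R[i]]_n.
Implicit Types (z w h v : V) (f g : V -> R[i]).

Lemma nbhs_rVP z (A : set V) :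
  nbhs z A <-> exists2 e : R, 0 < e &
    forall w, (forall j, normc (w 0 j - z 0 j) < e) -> A w.
Proof.
split.
  move=> /nbhs_ballP[e /= e0 eA].
  have ereal : e = (Re e)%:C by rewrite RRe_real// gtr0_real.
  exists (Re e); first by rewrite -ltcR -ereal.
  move=> w wz; apply: eA; split=> // i j; rewrite ord1 -ball_normE /= distrC.
  by rewrite ereal norm_normcE ltcR.
move=> [e e0 eA]; apply/nbhs_ballP; exists e%:C => /=; first by rewrite ltcR.
move=> w [_ wz]; apply: eA => j; have := wz 0 j.
by rewrite -ball_normE /= distrC norm_normcE ltcR.
Qed.

Lemma continuous_rVP f z : {for z, continuous f} <->
  forall e : R, 0 < e -> exists2 d : R, 0 < d & forall w,
    (forall j, normc (w 0 j - z 0 j) < d) -> normc (f w - f z) < e.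
Proof.
have FF := nbhs_filter z; split=> [fz e e0|fe].
  by have /cvg_normcP/(_ e e0) := fz; move=> /nbhs_rVP.
have : f w @[w --> z] --> f z by apply/cvg_normcP => e /fe; rewrite -nbhs_rVP.
exact.
Qed.

Lemma differentiable_along f z h (l0 : R[i]) : differentiable f (z + l0 *: h) ->
  differentiable (fun l : R[i] => f (z + l *: h)) l0.
Proof.
move=> df.
have dl : differentiable (fun l : R[i] => z + l *: h) l0.
  apply: differentiableD; first exact: differentiable_cst.
  exact: differentiableZl.
exact: (differentiable_comp dl df).
Qed.

(** One vector [a] serves all directions, while the radius [d] may depend on [h]: this is what the
    one-variable estimates on a complex line consume. *)
Lemma differentiable_gradient f z : differentiable f z ->
  exists a : 'I_n -> R[i], forall h e, 0 < e ->
    exists2 d : R, 0 < d & forall l : R[i], normc l < d ->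
      normc (f (z + l *: h) - f z - (\sum_j a j * h 0 j) * l) <= e * normc l.
Proof.
move=> df; exists (fun j => 'd f z (delta_mx 0 j)) => h e e0.
have dfh : 'd f z h = \sum_j 'd f z (delta_mx 0 j) * h 0 j.
  rewrite {1}(row_sum_delta h) linear_sum; apply: eq_bigr => j _.
  by rewrite linearZ/= mulrC.
have : derivable f z h by exact: diff_derivable.
rewrite /derivable => /cvg_ex[/= l fl].
have lE : l = 'd f z h.
  by rewrite -deriveE//; apply/esym/cvg_lim.
rewrite -dfh -lE; move/cvg_normcP : fl => /(_ e e0).
rewrite near_withinE /= => /nbhs_normcP[d d0 dP].
exists d => // k kd.
have [->|k0] := eqVneq k 0.
  by rewrite scale0r addr0 subrr mulr0 subr0 normc0 mulr0.
have := dP k; rewrite subr0 => /(_ kd k0) /ltW H.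
have -> : f (z + k *: h) - f z - l * k =
    (k^-1 *: (f (k *: h + z) - f z) - l) * k.
  rewrite mulrBl; congr (_ - _).
  by rewrite [_ *: (_ - _)]mulrC mulfVK// [_ + z]addrC.
by rewrite normcM ler_wpM2r// normc_ge0.
Qed.

Lemma normc_coord_le h j : normc (h 0 j) <= Re `|h|.
Proof.
have hE : `|h| = (Re `|h|)%:C by rewrite RRe_real// normr_real.
rewrite -lecR -hE -norm_normcE [leRHS]/Num.norm/= mx_normE -[leLHS]nngE num_le.
exact: (le_bigmax _ (fun i : 'I_1 * 'I_n => `|h i.1 i.2|%:nng) (0, j)).
Qed.

Lemma differentiable_flat g z (C d : R) : 0 < d ->
  (forall h (r : R), r < d -> (forall j, normc (h 0 j) <= r) ->
     normc (g (z + h)) <= C * r ^+ 2) ->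
  g z = 0 -> differentiable g z.
Proof.
move=> d0 gC gz.
apply: differentiable_littleo => // e egt0.
have eE : e = (Re e)%:C by rewrite RRe_real// gtr0_real.
set e1 := Re e in eE.
have e0 : 0 < e1 by rewrite -ltcR -eE.
pose C1 := `|C| + 1; have C0 : 0 < C1 by rewrite ltr_wpDl.
apply/nbhs_rVP; exists (Num.min d (e1 / C1)).
  by rewrite lt_min d0 divr_gt0.
move=> h hd.
have hE : `|h| = (Re `|h|)%:C by rewrite RRe_real// normr_real.
set r := Re `|h| in hE.
have rd : r < Num.min d (e1 / C1).
  have [h0|h0] := eqVneq `|h| 0.
    have -> : r = 0 by rewrite /r h0.
    by rewrite lt_min d0 divr_gt0.
  have [[i j] /= hij] := mx_norm_neq0 h0; rewrite ord1 in hij.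
  have -> : r = normc (h 0 j).
    by apply: (@complexI R); rewrite -hE -norm_normcE -hij.
  by have := hd j; rewrite mxE subr0.
have r0 : 0 <= r by rewrite -ler0c -hE normr_ge0.
rewrite hE eE norm_normcE -[_ * _]rmorphM/= lecR addrC.
apply: (le_trans (gC h r _ _)).
- by move: rd; rewrite lt_min => /andP[].
- by move=> j; exact: normc_coord_le.
- rewrite expr2 mulrA ler_wpM2r//.
  have : r * C1 <= e1.
    by rewrite -ler_pdivlMr// ltW//; move: rd; rewrite lt_min => /andP[].
  apply: le_trans; rewrite mulrC ler_wpM2l// /C1.
  by rewrite (le_trans (ler_norm _))// lerDl.
Qed.

(** The criterion by which limits are shown to be differentiable: for fixed [C] and [d], the
    hypothesis is a family of inequalities closed under pointwise limits of [f] and [a]. *)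
Lemma differentiable_quadratic f z (a : 'I_n -> R[i]) (C d : R) : 0 < d ->
  (forall h (r : R), r < d -> (forall j, normc (h 0 j) <= r) ->
     normc (f (z + h) - f z - \sum_j a j * h 0 j) <= C * r ^+ 2) ->
  differentiable f z.
Proof.
move=> d0 fC.
pose L w := \sum_j a j * (w 0 j - z 0 j).
have dL : differentiable L z.
  have -> : L = \sum_j (fun w : V => a j * (w 0 j - z 0 j)).
    by apply/funext => w; rewrite fct_sumE.
  apply: differentiable_sum => j; apply: differentiableM.
    exact: differentiable_cst.
  apply: differentiableB; last exact: differentiable_cst.
  exact: differentiable_coord.
pose g w := f w - f z - L w.
have dg : differentiable g z.
  apply: (differentiable_flat (C := C) d0) => [h r rd hr|].
    rewrite /g /L; have -> : \sum_j a j * ((z + h) 0 j - z 0 j) = \sum_j a j * h 0 j.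
      by apply: eq_bigr => j _; rewrite mxE addrC addKr.
    exact: fC.
  rewrite /g /L big1 => [|j _]; first by rewrite !subrr.
  by rewrite subrr mulr0.
have -> : f = g + cst (f z) + L.
  by apply/funext => w; rewrite /g !fctE /=; ring.
exact: (differentiableD (differentiableD dg (differentiable_cst _ _)) dL).
Qed.

End complex_space.

(** * Measurability of open sets and of continuous functions through [toCn] *)

Section measurability.
Context {R : realType} (n : nat).
Local Notation V := 'rV[R[i]]_n.
Let RT : measurableType _ := measurableTypeR R.
Let P : measurableType _ := (RT * RT)%type.
Implicit Types (z w : V) (t : n.-tuple P).

Definition ofCn z : n.-tuple P := [tuple (Re (z 0 j), Im (z 0 j)) | j < n].

Lemma ofCnK : cancel ofCn (@toCn R n).
Proof.
move=> z; apply/rowP => j; rewrite mxE tnth_mktuple /=.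
by case: (z 0 j).
Qed.

Lemma toCnE t j : (toCn t) 0 j = (tnth t j).1 +i* (tnth t j).2.
Proof. by rewrite mxE. Qed.

(** A countable base: boxes with rational centers and radius 1 / (k + 1). The measurable structure
    on tuples is the product one, so open sets have to be written as countable unions of boxes. *)
Definition rat_box (q : n.-tuple (rat * rat) * nat) : set (n.-tuple P) :=
  [set t | forall j : 'I_n,
     `|(tnth t j).1 - ratr (tnth q.1 j).1| < q.2.+1%:R^-1 /\
     `|(tnth t j).2 - ratr (tnth q.1 j).2| < q.2.+1%:R^-1].

Lemma measurable_rat_box q : measurable (rat_box q).
Proof.
rewrite (_ : rat_box q = \bigcap_(j in [set: 'I_n])
    ((fun t => tnth t j) @^-1`
      ([set x : RT | `|x - ratr (tnth q.1 j).1| < q.2.+1%:R^-1] `*`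
       [set x : RT | `|x - ratr (tnth q.1 j).2| < q.2.+1%:R^-1]))); last first.
  by apply/seteqP; split => t /= tq j; [move=> _|]; exact: tq.
apply: fin_bigcap_measurable => // j _.
rewrite -[X in measurable X]setTI; apply: measurable_tnth => //.
have mball (c e : R) : measurable [set x : RT | `|x - c| < e].
  rewrite (_ : [set _ | _] = `]c - e, c + e[%classic).
    exact: measurable_itv.
  by apply/seteqP; split => x /=; rewrite in_itv/= ltr_distl.
by apply: measurableX; exact: mball.
Qed.

Lemma measurable_toCn_open (U : set V) : open U -> measurable (@toCn R n @^-1` U).
Proof.
move=> oU.
have -> : @toCn R n @^-1` U =
    \bigcup_(q in [set: n.-tuple (rat * rat) * nat])
      (if `[< rat_box q `<=` @toCn R n @^-1` U >] then rat_box q else set0).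
  apply/seteqP; split => [t Ut|t [q _]]; last first.
    by case: asboolP => // sub /sub.
  have : nbhs (toCn t) U by rewrite nbhsE/=; exists U.
  move=> /nbhs_rVP[e e0 eU].
  (* Two points of one box differ by less than 2 / (k + 1) in each real coordinate, hence by less
     than 4 / (k + 1) in each complex one. *)
  have [k _ /(_ k (leqnn k)) /= ke] := near_infty_natSinv_lt (PosNum (divr_gt0 e0 (ltr0n R 4))).
  have k0 : 0 < k.+1%:R^-1 :> R by rewrite invr_gt0.
  have near_rat (x : R) : exists q : rat, `|x - ratr q| < k.+1%:R^-1.
    have [q] : exists q : rat, ratr q \in `]x - k.+1%:R^-1, x + k.+1%:R^-1[.
      apply: rat_in_itvoo.
      by rewrite ltrD2l (lt_trans _ k0)// oppr_lt0.
    by rewrite in_itv/= => qx; exists q; rewrite ltr_distlC.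
  pose q1 x := xchoose (near_rat x).
  have q1P x : `|x - ratr (q1 x)| < k.+1%:R^-1 by exact: (xchooseP (near_rat x)).
  pose q := ([tuple (q1 (tnth t j).1, q1 (tnth t j).2) | j < n], k).
  have tq : rat_box q t by move=> j; rewrite /q /= tnth_mktuple /=; split.
  exists q => //; case: asboolP => // -[]; move=> s sq; apply: eU => j.
  rewrite !toCnE; apply: (le_lt_trans (normc_le_ReIm _)) => /=.
  have [s1 s2] := sq j; have [t1 t2] := tq j.
  have := ler_distD (ratr (tnth q.1 j).1) (tnth s j).1 (tnth t j).1.
  have := ler_distD (ratr (tnth q.1 j).2) (tnth s j).2 (tnth t j).2.
  rewrite (distrC (ratr (tnth q.1 j).1)) (distrC (ratr (tnth q.1 j).2)).
  move: s1 s2 t1 t2 ke; rewrite -[q.2]/k; move: (k.+1%:R^-1) => u; clear; lra.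
apply: countable_bigcupT_measurable; first exact: countableP.
by move=> q; case: ifP => // _; exact: measurable_rat_box.
Qed.

Definition restrict_norm (Omega : set V) (f : V -> R[i]) : n.-tuple P -> R :=
  (fun t => normc (f (toCn t))) \_ (@toCn R n @^-1` Omega).

Lemma open_superlevel (Omega : set V) f (r : R) : open Omega ->
  (forall z, Omega z -> {for z, continuous f}) ->
  open (Omega `&` [set z | r < normc (f z)]).
Proof.
move=> oO cf; rewrite openE => z [Oz rz].
have nO : nbhs z Omega by rewrite nbhsE/=; exists Omega.
have /continuous_rVP/(_ (normc (f z) - r)) [|d d0 df] := cf z Oz.
  by rewrite subr_gt0.
have nd : nbhs z [set w | r < normc (f w)].
  apply/nbhs_rVP; exists d => // w /df.
  have := le_normcD (f z - f w) (f w); rewrite subrK -(normcN (f z - f w)) opprB.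
  by rewrite /=; lra.
exact: filterI.
Qed.

Lemma measurable_restrict_norm (Omega : set V) f : open Omega ->
  (forall z, Omega z -> {for z, continuous f}) ->
  measurable_fun [set: n.-tuple P] (restrict_norm Omega f).
Proof.
move=> oO cf; have mO := measurable_toCn_open oO.
apply/(measurable_restrictT _ mO).
apply: (measurability _ (RGenOInfty.measurableE R)).
move=> /= _ [_ [r ->]] <-.
rewrite (_ : _ `&` _ = @toCn R n @^-1` (Omega `&` [set z | r < normc (f z)])).
  by apply: measurable_toCn_open; exact: open_superlevel.
by apply/seteqP; split => t /=; rewrite in_itv/= andbT.
Qed.

End measurability.

(** * Norms and integrals of p-th powers *)

Section Lp_general.
Context d (T : measurableType d) (R : realType).
Variable mu : {measure set T -> \bar R}.
Variable p : R.
Hypothesis p1 : 1 <= p.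
Implicit Types (f g : T -> R) (N : R).

Let p0 : 0 < p. Proof. exact: lt_le_trans p1. Qed.

Lemma ge0_poweR_Lnorm f : (forall t, 0 <= f t) ->
  ('N[mu]_(p%:E)[EFin \o f] `^ p = \int[mu]_t (f t `^ p)%:E)%E.
Proof.
move=> f0; rewrite poweR_Lnorm; last by rewrite gt_eqF.
apply: eq_integral => t _.
by rewrite /= ger0_norm.
Qed.

(** Turns a norm bound into a bound on an integral, where pointwise inequalities can be integrated;
    the norm may a priori be infinite. *)
Lemma ge0_Lnorm_leP f N : (forall t, 0 <= f t) -> 0 <= N ->
  ('N[mu]_(p%:E)[EFin \o f] <= N%:E)%E <->
  (\int[mu]_t (f t `^ p)%:E <= (N `^ p)%:E)%E.
Proof.
move=> f0 N0; rewrite -ge0_poweR_Lnorm// -poweR_EFin.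
set L := Lnorm _ _ _.
have L0 : (0 <= L)%E by rewrite Lnorm_ge0.
split => [|H].
  by apply: gt0_ler_poweR; rewrite ?in_itv/= ?leey ?andbT// ltW.
have pV0 : 0 <= p^-1 by rewrite invr_ge0 ltW.
have := gt0_ler_poweR pV0; move=> /(_ (L `^ p)%E (N%:E `^ p)%E).
rewrite !in_itv/= !leey !andbT poweR_ge0 lee_fin powR_ge0 => /(_ isT isT H).
by rewrite -poweRrM -powRrM mulfV ?gt_eqF// poweRe1// powRr1.
Qed.

Lemma ge1_powR_ge (x : R) : 1 <= x -> x <= x `^ p.
Proof.
move=> x1; have x0 : 0 < x by exact: lt_le_trans x1.
by have := ler_powR x1 p1; rewrite powRr1// ltW.
Qed.

(* Replaces Hoelder's inequality on [B]: f <= N + N (f / N)^p. *)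
Lemma integral_le_Lp f (B : set T) N : measurable B ->
  measurable_fun [set: T] f -> (forall t, 0 <= f t) -> 0 < N ->
  (\int[mu]_t (f t `^ p)%:E <= (N `^ p)%:E)%E ->
  (\int[mu]_t ((f \_ B) t)%:E <= N%:E * mu B + N%:E)%E.
Proof.
move=> mB mf f0 N0 fN.
have mfp : measurable_fun [set: T] (fun t => (f t `^ p)%:E).
  by apply/measurable_EFinP; exact: (measurableT_comp (measurable_powR p) mf).
pose c := N / N `^ p.
have c0 : 0 <= c by rewrite divr_ge0 ?powR_ge0// ltW.
have mi : measurable_fun [set: T] (fun t => (N * \1_B t)%:E).
  by apply/measurable_EFinP; exact: measurable_funM.
have mcf : measurable_fun [set: T] (fun t => (c%:E * (f t `^ p)%:E)%E).
  exact: measurable_funeM.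
apply: (@le_trans _ _ (\int[mu]_t
   ((N * \1_B t)%:E + c%:E * (f t `^ p)%:E))%E).
  apply: ge0_le_integral => //.
  - by move=> t _; rewrite lee_fin patchE; case: ifP.
  - by apply/measurable_EFinP/(measurable_restrictT _ mB); exact: measurable_funTS.
  - exact: emeasurable_funD.
  move=> t _; rewrite -EFinM -EFinD lee_fin patchE indicE.
  have [tB|tB] := boolP (t \in B); last first.
    by rewrite mulr0 add0r mulr_ge0// powR_ge0.
  rewrite mulr1; have [aN|Na] := leP (f t) N.
    by rewrite (le_trans aN)// lerDl mulr_ge0// powR_ge0.
  have H : f t / N <= (f t / N) `^ p.
    by apply: ge1_powR_ge; rewrite ler_pdivlMr// mul1r ltW.
  have aE : f t <= c * f t `^ p.
    have -> : c * f t `^ p = N * (f t / N) `^ p.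
      rewrite powRM ?invr_ge0// ?ltW// /c.
      have -> : N^-1 `^ p = (N `^ p)^-1.
        by rewrite -powR_inv1 ?ltW// -powRrM mulN1r powRN.
      by rewrite -mulrA [_^-1 * _]mulrC.
    by rewrite -ler_pdivrMl// mulrC.
  by rewrite (le_trans aE)// lerDr ltW.
rewrite ge0_integralD//; last 2 first.
- by move=> t _; rewrite lee_fin mulr_ge0// ?ltW// indicE.
- by move=> t _; rewrite -EFinM lee_fin mulr_ge0// powR_ge0.
apply: leeD.
  under eq_integral do rewrite EFinM.
  rewrite ge0_integralZl//.
  - by rewrite integral_indic// setIT.
  - by apply/measurable_EFinP.
  - by rewrite lee_fin ltW.
rewrite ge0_integralZl//; last by move=> t _; rewrite lee_fin powR_ge0.
apply: (@le_trans _ _ (c%:E * (N `^ p)%:E)%E); first by rewrite lee_wpmul2l// lee_fin.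
by rewrite -EFinM /c mulfVK// gt_eqF// powR_gt0.
Qed.

End Lp_general.

(** * Point evaluations are bounded *)

Section evaluation.
Context {R : realType} (n : nat).
Local Notation V := 'rV[R[i]]_n.
Let RT : measurableType _ := measurableTypeR R.
Let P : measurableType _ := (RT * RT)%type.
Implicit Types (z w : V) (t : n.-tuple P) (f : V -> R[i]) (Omega : set V).

(** A product of closed squares in place of a polydisc: its slices are the rectangles of Cauchy's
    formula. *)
Definition cbox z (r : R) : set V :=
  [set w | forall j, `|Re (w 0 j) - Re (z 0 j)| <= r /\
                     `|Im (w 0 j) - Im (z 0 j)| <= r].

Lemma cbox_center z r : 0 <= r -> cbox z r z.
Proof. by move=> r0 j; rewrite !subrr normr0. Qed.

Lemma cbox_triangle z w v r s : cbox z r w -> cbox w s v -> cbox z (r + s) v.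
Proof.
move=> zw wv j; have [? ?] := zw j; have [? ?] := wv j.
have := ler_distD (Re (w 0 j)) (Re (v 0 j)) (Re (z 0 j)).
have := ler_distD (Im (w 0 j)) (Im (v 0 j)) (Im (z 0 j)).
by split; lra.
Qed.

Lemma nbhs_cbox z (A : set V) : nbhs z A -> exists2 r : R, 0 < r & cbox z r `<=` A.
Proof.
move=> /nbhs_rVP[e e0 eA]; exists (e / 3); first by rewrite divr_gt0.
move=> w wz; apply: eA => j; apply: (le_lt_trans (normc_le_ReIm _)).
rewrite ReB ImB; have [] := wz j; move: e0; lra.
Qed.

Let square (p q r : R) : set P := `[p - r, p + r] `*` `[q - r, q + r].

Lemma preimage_cbox z r : @toCn R n @^-1` cbox z r =
  [set t : n.-tuple P | forall j, square (Re (z 0 j)) (Im (z 0 j)) r (tnth t j)].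
Proof.
by apply/seteqP; split => t /= zt j; have := zt j;
  rewrite toCnE /square/= !in_itv/= !ler_distl.
Qed.

Lemma measurable_square p q r : measurable (square p q r).
Proof. by apply: measurableX; exact: measurable_itv. Qed.

Lemma measurable_cbox z r : measurable (@toCn R n @^-1` cbox z r).
Proof.
rewrite preimage_cbox (_ : [set t | _] = \bigcap_(j in [set: 'I_n])
  ((fun t => tnth t j) @^-1` square (Re (z 0 j)) (Im (z 0 j)) r)); last first.
  by apply/seteqP; split => t /= zt j; [move=> _|]; exact: zt.
apply: fin_bigcap_measurable => // j _.
rewrite -[X in measurable X]setTI; apply: measurable_tnth => //.
exact: measurable_square.
Qed.

Lemma lebesgueCn_cbox z r : 0 <= r ->
  lebesgueCn n (@toCn R n @^-1` cbox z r) = ((4 * r ^+ 2) ^+ n)%:E.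
Proof.
move=> r0; rewrite preimage_cbox /lebesgueCn.
rewrite (power_measure_box _ (fun j => measurable_square (Re (z 0 j)) (Im (z 0 j)) r)).
rewrite (eq_bigr (fun=> (4 * r ^+ 2)%:E)) => [|j _].
  by rewrite -(big_morph _ EFinM (erefl 1%E)) prodr_const card_ord.
have side (c : R) : @lebesgue_measure R `[c - r, c + r] = (2 * r)%:E.
  rewrite lebesgue_measure_itv/= lte_fin.
  move: r0; rewrite le_eqVlt => /predU1P[<-|r0].
    by rewrite subr0 addr0 ltxx mulr0.
  have -> : c - r < c + r by rewrite ltrD2l (lt_trans _ r0)// oppr_lt0.
  by rewrite -EFinB; congr EFin; ring.
rewrite /= /lebesgue_plane product_measure1E//=.
by rewrite !side -EFinM; congr EFin; ring.
Qed.

Lemma restrict_norm_ge0 Omega f t : 0 <= restrict_norm Omega f t.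
Proof. by rewrite /restrict_norm patchE; case: ifP => // _; exact: normc_ge0. Qed.

Lemma restrict_norm_in Omega f t : Omega (toCn t) ->
  restrict_norm Omega f t = normc (f (toCn t)).
Proof. by move=> Ot; rewrite /restrict_norm patchE mem_set. Qed.

Lemma restrict_norm_out Omega f t : ~ Omega (toCn t) -> restrict_norm Omega f t = 0.
Proof. by move=> Ot; rewrite /restrict_norm patchE memNset. Qed.

Lemma holomorphic_continuous Omega f : holomorphic Omega f ->
  forall z, Omega z -> {for z, continuous f}.
Proof. by move=> hf z /hf; exact: differentiable_continuous. Qed.

Lemma measurable_restrict_cbox Omega f w r : open Omega -> holomorphic Omega f ->
  cbox w r `<=` Omega ->
  measurable_fun [set: n.-tuple P] (restrict_norm (cbox w r) f).
Proof.
move=> oO hf wO; have mB := measurable_cbox w r.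
apply/(measurable_restrictT _ mB).
have mf := measurable_restrict_norm oO (holomorphic_continuous hf).
apply: (eq_measurable_fun (restrict_norm Omega f)).
  by move=> t; rewrite inE => /wO tO; rewrite restrict_norm_in.
exact: measurable_funTS.
Qed.

Lemma toCn_upd t i (x : P) :
  toCn (tuple_upd t i x) = toCn t + (x.1 +i* x.2 - toCn t 0 i) *: delta_mx 0 i.
Proof.
apply/rowP => j; rewrite !mxE tnth_upd eqxx/=.
have [->|ji] := eqVneq j i; first by rewrite mulr1 addrC subrK.
by rewrite mulr0 addr0.
Qed.

(** [tuple_sub_mean] is applied to |f| cut off to the box, and [sub_mean_value] to [f] along each
    coordinate line. *)
Lemma cbox_sub_mean Omega f w r : open Omega -> holomorphic Omega f -> 0 < r ->
  cbox w r `<=` Omega ->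
  ((normc (f w))%:E <= ((8 / r ^+ 2) ^+ n)%:E *
     \int[lebesgueCn n]_t (restrict_norm (cbox w r) f t)%:E)%E.
Proof.
move=> oO hf r0 wO.
pose h t := (restrict_norm (cbox w r) f t)%:E.
have h0 t : (0 <= h t)%E by rewrite lee_fin restrict_norm_ge0.
have mh : measurable_fun [set: n.-tuple P] h.
  by apply/measurable_EFinP; exact: (measurable_restrict_cbox oO hf wO).
have K0 : 0 <= 8 / r ^+ 2 by rewrite divr_ge0// exprn_ge0// ltW.
have -> : (normc (f w))%:E = h (ofCn w).
  by rewrite /h restrict_norm_in ofCnK//; exact/cbox_center/ltW.
apply: (tuple_sub_mean (c := ofCn w) K0 mh h0) => i t tw.
(* Outside the box the cut-off function vanishes and the inequality is trivial; inside it, the whole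
   slice through [t] stays in the box. *)
have [tB|tB] := pselect (cbox w r (toCn t)); last first.
  rewrite {1}/h restrict_norm_out// mule_ge0 ?lee_fin//.
  exact: integral_ge0.
(* Coordinate i is erased, so that the parameter [l] of the slice is that coordinate itself. Its
   value at [t] is the center w_i, where the sub-mean value is wanted. *)
pose z0 := toCn t - toCn t 0 i *: delta_mx 0 i.
pose g (l : R[i]) := f (z0 + l *: delta_mx 0 i).
have ti : toCn t 0 i = w 0 i.
  by rewrite toCnE (tw i (leqnn i)) -[in RHS](ofCnK w) toCnE.
have z0E (l : R[i]) j : (z0 + l *: delta_mx 0 i) 0 j =
    if j == i then l else toCn t 0 j.
  rewrite /z0 !mxE eqxx/=; have [->|ji] := eqVneq j i.
    by rewrite !mulr1 subrr add0r.
  by rewrite !mulr0 subr0 addr0.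
have inB (l : R[i]) : rect (Re (w 0 i) - r) (Re (w 0 i) + r) (Im (w 0 i) - r)
    (Im (w 0 i) + r) l -> cbox w r (z0 + l *: delta_mx 0 i).
  move=> [l1 l2] j; rewrite z0E; case: eqP => [->|_]; last exact: tB.
  by rewrite !ler_distl.
have htE : h t = (normc (g (Re (w 0 i) +i* Im (w 0 i))))%:E.
  rewrite /h restrict_norm_in// /g; congr (normc (f _))%:E.
  apply/rowP => j; rewrite z0E; case: eqP => // ->.
  by rewrite ti; case: (w 0 i).
rewrite htE.
apply: (sub_mean_value (h := fun x => h (tuple_upd t i x)) r0).
- move=> l /inB/wO/hf fl; exact: differentiable_along.
- exact: (measurableT_comp mh (measurable_tuple_upd t i)).
- by move=> x; exact: h0.
- move=> x y xr yr; have xyB := inB (x +i* y) (conj xr yr).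
  have E : toCn (tuple_upd t i (x, y)) = z0 + (x +i* y) *: delta_mx 0 i.
    by rewrite toCn_upd /= scalerBl /z0 addrA addrAC.
  by rewrite /h restrict_norm_in E.
Qed.

Variable p : R.
Hypothesis p1 : 1 <= p.

Lemma restrict_norm_EFin Omega f :
  (fun t => (normc (f (toCn t)))%:E) \_ (@toCn R n @^-1` Omega) =
  EFin \o restrict_norm Omega f.
Proof.
by apply/funext => t /=; rewrite /restrict_norm !patchE; case: ifP.
Qed.

Lemma LpnormE Omega f :
  Lpnorm Omega p f = 'N[lebesgueCn n]_(p%:E)[EFin \o restrict_norm Omega f]%E.
Proof. by rewrite /Lpnorm restrict_norm_EFin. Qed.

Lemma poweR_Lpnorm Omega f : (Lpnorm Omega p f `^ p =
  \int[lebesgueCn n]_t (restrict_norm Omega f t `^ p)%:E)%E.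
Proof. by rewrite LpnormE ge0_poweR_Lnorm//; exact: restrict_norm_ge0. Qed.

Lemma Lpnorm_leP Omega f (N : R) : 0 <= N ->
  (Lpnorm Omega p f <= N%:E)%E <->
  (\int[lebesgueCn n]_t (restrict_norm Omega f t `^ p)%:E <= (N `^ p)%:E)%E.
Proof. by rewrite LpnormE; apply: ge0_Lnorm_leP => //; exact: restrict_norm_ge0. Qed.

(** The constant is the sub-mean value constant times (volume of the box + 1), the latter from
    [integral_le_Lp]. *)
Lemma eval_bound Omega f w r (N : R) : open Omega -> holomorphic Omega f ->
  0 < r -> cbox w r `<=` Omega -> 0 < N -> (Lpnorm Omega p f <= N%:E)%E ->
  normc (f w) <= (8 / r ^+ 2) ^+ n * ((4 * r ^+ 2) ^+ n + 1) * N.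
Proof.
move=> oO hf r0 wO N0 /(Lpnorm_leP _ _ (ltW N0)) fN.
have K0 : 0 <= (8 / r ^+ 2) ^+ n by rewrite exprn_ge0// divr_ge0// exprn_ge0// ltW.
rewrite -lee_fin; apply: (le_trans (cbox_sub_mean oO hf r0 wO)).
rewrite -mulrA EFinM lee_wpmul2l ?lee_fin//.
have mf := measurable_restrict_norm oO (holomorphic_continuous hf).
have := integral_le_Lp p1 (measurable_cbox w r) mf
  (restrict_norm_ge0 Omega f) N0 fN.
rewrite [X in (_ * X)%E](lebesgueCn_cbox w (ltW r0)).
set W := (_ ^+ n : R); have -> : (W + 1) * N = N * W + N by ring.
rewrite -EFinM -EFinD; apply: le_trans.
rewrite le_eqVlt; apply/orP; left; apply/eqP.
congr integral; apply/funext => t; congr EFin; rewrite [RHS]patchE.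
have [tB|tB] := pselect (cbox w r (toCn t)); last first.
  by rewrite restrict_norm_out// memNset.
by rewrite mem_set// !restrict_norm_in//; exact: wO.
Qed.

End evaluation.

(** * Completeness of the Bergman space *)

Lemma ge0_le_integral_powR d (T : measurableType d) (R : realType)
    (mu : {measure set T -> \bar R}) (p : R) (u v : T -> R) : 1 <= p ->
  measurable_fun [set: T] u -> measurable_fun [set: T] v ->
  (forall t, 0 <= u t) -> (forall t, u t <= v t) ->
  (\int[mu]_t (u t `^ p)%:E <= \int[mu]_t (v t `^ p)%:E)%E.
Proof.
move=> p1 mu_ mv u0 uv.
have mp (h : T -> R) : measurable_fun [set: T] h ->
    measurable_fun [set: T] (fun t => (h t `^ p)%:E).
  by move=> mh; apply/measurable_EFinP; exact: (measurableT_comp (measurable_powR p) mh).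
apply: ge0_le_integral => //.
- by move=> t _; rewrite lee_fin powR_ge0.
- exact: mp.
- exact: mp.
move=> t _; rewrite lee_fin; apply: ge0_ler_powR; rewrite ?nnegrE.
- by rewrite (le_trans _ p1).
- exact: u0.
- exact: le_trans (u0 t) (uv t).
- exact: uv.
Qed.

(** At a > 0 the power function is differentiable; at 0, where p < 1 would break this, u < e^(1/p)
    is used directly. *)
Lemma cvg_powR (R : realType) (p : R) (u : nat -> R) (a : R) : 0 < p ->
  (forall k, 0 <= u k) -> u k @[k --> \oo] --> a ->
  u k `^ p @[k --> \oo] --> a `^ p.
Proof.
move=> p0 u0 ua; have a0 : 0 <= a.
  rewrite -(cvg_lim _ ua)//; apply: limr_ge; first by apply/cvg_ex; exists a.
  by near=> k.
move: a0; rewrite le_eqVlt => /predU1P[a0|a0]; last first.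
  have ca : {for a, continuous (fun x : R => x `^ p)}.
    apply: differentiable_continuous; apply/derivable1_diffP.
    by apply: derivable_powR; rewrite in_itv/= a0.
  exact: (cvg_comp _ _ ua ca).
subst a; rewrite powR0 ?gt_eqF//; apply/cvgrPdist_lt => e e0.
have d0 : 0 < e `^ p^-1 by rewrite powR_gt0.
move/cvgrPdist_lt : ua => /(_ _ d0); apply: filterS => k.
rewrite !sub0r !normrN !ger0_norm ?powR_ge0// => uk.
have -> : e = (e `^ p^-1) `^ p by rewrite -powRrM mulVf ?gt_eqF// powRr1// ltW.
by apply: gt0_ltr_powR; rewrite ?nnegrE ?powR_ge0.
Unshelve. all: by end_near. Qed.

Lemma cvg_normc (R : realType) (u : nat -> R[i]) (a : R[i]) :
  u k @[k --> \oo] --> a -> normc (u k) @[k --> \oo] --> normc a.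
Proof.
move=> /cvg_normcP ua; apply/cvgrPdist_lt => e e0; have := ua _ e0.
apply: filterS => k; apply: le_lt_trans.
rewrite ler_norml; apply/andP; split.
  by rewrite lerNl opprB lerBlDr; have := le_normcD (u k - a) a; rewrite subrK.
rewrite lerBlDr; have := le_normcD (a - u k) (u k).
by rewrite subrK -(normcN (a - u k)) opprB.
Qed.

Lemma limn_einf_EFin (R : realType) (u : nat -> R) (a : R) :
  u k @[k --> \oo] --> a -> limn_einf (fun k => (u k)%:E) = a%:E.
Proof.
move=> ua; have cu : ((EFin \o u) @ \oo --> a%:E)%E by apply: cvg_EFin ua; near=> k.
rewrite -(cvg_lim _ cu)// is_cvg_limn_einfE//.
by apply/cvg_ex; exists a%:E.
Unshelve. all: by end_near. Qed.

(** * The normed structure of the Bergman space *)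

Section bergman_space.
Context {R : realType} (n : nat).
Local Notation V := 'rV[R[i]]_n.
Let RT : measurableType _ := measurableTypeR R.
Let P : measurableType _ := (RT * RT)%type.
Variables (Omega : set V) (p : R).
Hypotheses (oO : open Omega) (p1 : 1 <= p).
Implicit Types (z w : V) (f g : V -> R[i]).

Let p0 : 0 < p. Proof. exact: lt_le_trans p1. Qed.

Lemma holomorphicD f g : holomorphic Omega f -> holomorphic Omega g ->
  holomorphic Omega (fun z => f z + g z).
Proof. by move=> hf hg z Oz; exact: differentiableD (hf z Oz) (hg z Oz). Qed.

Lemma holomorphic_cst (k : R[i]) : holomorphic Omega (fun=> k).
Proof. by move=> z Oz; exact: differentiable_cst. Qed.

Lemma holomorphicM f g : holomorphic Omega f -> holomorphic Omega g ->
  holomorphic Omega (fun z => f z * g z).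
Proof. by move=> hf hg z Oz; exact: differentiableM (hf z Oz) (hg z Oz). Qed.

Lemma measurable_restrict f : holomorphic Omega f ->
  measurable_fun [set: n.-tuple P] (restrict_norm Omega f).
Proof. by move=> /holomorphic_continuous; exact: measurable_restrict_norm. Qed.

Lemma Lpnorm_ge0 f : (0 <= Lpnorm Omega p f)%E.
Proof. by rewrite LpnormE Lnorm_ge0. Qed.

Lemma pnorm_ge0 f : 0 <= pnorm Omega p f.
Proof. by rewrite fine_ge0// Lpnorm_ge0. Qed.

Lemma Bergman_pnorm f : Bergman Omega p f ->
  Lpnorm Omega p f = (pnorm Omega p f)%:E.
Proof. by move=> [_ foo]; rewrite fineK// ge0_fin_numE// Lpnorm_ge0. Qed.

Lemma Bergman_le f (N : R) : holomorphic Omega f -> 0 <= N ->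
  (\int[lebesgueCn n]_t (restrict_norm Omega f t `^ p)%:E <= (N `^ p)%:E)%E ->
  Bergman Omega p f /\ pnorm Omega p f <= N.
Proof.
move=> hf N0 /(Lpnorm_leP p1 _ _ N0) fN.
have bf : Bergman Omega p f by split => //; exact: le_lt_trans fN (ltry _).
by split => //; rewrite -lee_fin -Bergman_pnorm.
Qed.

Lemma Bergman_integral f : Bergman Omega p f ->
  (\int[lebesgueCn n]_t (restrict_norm Omega f t `^ p)%:E =
   (pnorm Omega p f `^ p)%:E)%E.
Proof. by move=> bf; rewrite -poweR_Lpnorm// Bergman_pnorm. Qed.

Lemma restrict_norm_le f g (k : R) t : 0 <= k ->
  (forall z, Omega z -> normc (f z) <= k * normc (g z)) ->
  restrict_norm Omega f t <= k * restrict_norm Omega g t.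
Proof.
move=> k0 fg; have [tO|tO] := pselect (Omega (toCn t)).
  by rewrite !restrict_norm_in//; exact: fg.
by rewrite !restrict_norm_out// mulr0.
Qed.

Lemma Bergman_scale_le f g (k : R) : holomorphic Omega f -> Bergman Omega p g ->
  0 <= k -> (forall z, Omega z -> normc (f z) <= k * normc (g z)) ->
  Bergman Omega p f /\ pnorm Omega p f <= k * pnorm Omega p g.
Proof.
move=> hf bg k0 fg; have mf := measurable_restrict hf.
have mg := measurable_restrict bg.1.
have mp (h : n.-tuple P -> R) : measurable_fun [set: n.-tuple P] h ->
    measurable_fun [set: n.-tuple P] (fun t => (h t `^ p)%:E).
  by move=> mh; apply/measurable_EFinP; exact: (measurableT_comp (measurable_powR p) mh).
apply: Bergman_le => //; first by rewrite mulr_ge0// pnorm_ge0.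
rewrite powRM ?pnorm_ge0// EFinM -(Bergman_integral bg).
rewrite -ge0_integralZl//; last 3 first.
- exact: mp.
- by move=> t _; rewrite lee_fin powR_ge0.
- by rewrite lee_fin powR_ge0.
apply: ge0_le_integral => //.
- by move=> t _; rewrite lee_fin powR_ge0.
- exact: mp.
- by apply: measurable_funeM; exact: mp.
move=> t _; rewrite -EFinM lee_fin -powRM ?restrict_norm_ge0//.
apply: ge0_ler_powR; rewrite ?nnegrE ?mulr_ge0 ?restrict_norm_ge0//; first exact: ltW.
exact: restrict_norm_le.
Qed.

Lemma BergmanZ f (c : R[i]) : Bergman Omega p f ->
  Bergman Omega p (fun z => c * f z) /\
  pnorm Omega p (fun z => c * f z) <= normc c * pnorm Omega p f.
Proof.
move=> bf; have hcf := holomorphicM (holomorphic_cst c) bf.1.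
apply: (Bergman_scale_le hcf bf (normc_ge0 c)) => z _.
by rewrite normcM.
Qed.

Lemma BergmanD f g : Bergman Omega p f -> Bergman Omega p g ->
  Bergman Omega p (fun z => f z + g z) /\
  pnorm Omega p (fun z => f z + g z) <= pnorm Omega p f + pnorm Omega p g.
Proof.
move=> bf bg; have hfg := holomorphicD bf.1 bg.1.
have mf := measurable_restrict bf.1; have mg := measurable_restrict bg.1.
have mfg := measurable_restrict hfg.
have ab0 : 0 <= pnorm Omega p f + pnorm Omega p g by rewrite addr_ge0 ?pnorm_ge0.
pose u t := restrict_norm Omega f t + restrict_norm Omega g t.
have u0 t : 0 <= u t by rewrite addr_ge0 ?restrict_norm_ge0.
have := minkowski_EFin (lebesgueCn n) mf mg p1.
rewrite -!LpnormE !Bergman_pnorm// -EFinD => /(ge0_Lnorm_leP _ p1 u0 ab0) H.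
apply: (Bergman_le hfg ab0 (le_trans _ H)).
have mu_ : measurable_fun [set: n.-tuple P] u by exact: measurable_funD.
apply: (ge0_le_integral_powR (lebesgueCn n) p1 mfg mu_).
  by move=> t; exact: restrict_norm_ge0.
move=> t; rewrite /u; have [tO|tO] := pselect (Omega (toCn t)).
  by rewrite !restrict_norm_in//; exact: le_normcD.
by rewrite restrict_norm_out// addr_ge0 ?restrict_norm_ge0.
Qed.

Lemma BergmanB f g : Bergman Omega p f -> Bergman Omega p g ->
  Bergman Omega p (fun z => f z - g z) /\
  pnorm Omega p (fun z => f z - g z) <= pnorm Omega p f + pnorm Omega p g.
Proof.
move=> bf bg; have [bNg gN] := BergmanZ (-1) bg.
have -> : (fun z => f z - g z) = (fun z => f z + -1 * g z).
  by apply/funext => z; rewrite mulN1r.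
have [b fg] := BergmanD bf bNg; split => //; apply: (le_trans fg).
by rewrite lerD2l (le_trans gN)// normcN normc1 mul1r.
Qed.

Lemma pnorm_distC f g : pnorm Omega p (fun z => f z - g z) =
  pnorm Omega p (fun z => g z - f z).
Proof.
rewrite /pnorm /Lpnorm; congr (fine (Lnorm _ _ _)); apply/funext => t.
by rewrite !patchE; case: ifP => // _; rewrite -normcN opprB.
Qed.

Lemma pnorm_dist_triangle f g h : Bergman Omega p f -> Bergman Omega p g ->
  Bergman Omega p h ->
  pnorm Omega p (fun z => f z - h z) <=
  pnorm Omega p (fun z => f z - g z) + pnorm Omega p (fun z => g z - h z).
Proof.
move=> bf bg bh.
have [_] := BergmanD (BergmanB bf bg).1 (BergmanB bg bh).1.
by congr (pnorm _ _ _ <= _); apply/funext => z; rewrite addrA subrK.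
Qed.

Lemma pnorm_eval f w r : Bergman Omega p f -> 0 < r -> cbox w r `<=` Omega ->
  normc (f w) <= (8 / r ^+ 2) ^+ n * ((4 * r ^+ 2) ^+ n + 1) * pnorm Omega p f.
Proof.
move=> bf r0 wO; pose C := (8 / r ^+ 2) ^+ n * ((4 * r ^+ 2) ^+ n + 1); rewrite -/C.
have H N : pnorm Omega p f <= N -> 0 < N -> normc (f w) <= C * N.
  move=> fN N0; apply: (eval_bound p1 oO bf.1 r0 wO N0).
  by rewrite Bergman_pnorm// lee_fin.
have C0 : 0 <= C.
  rewrite mulr_ge0// ?addr_ge0 ?exprn_ge0 ?divr_ge0 ?mulr_ge0 ?sqr_ge0//; exact: ltW.
(* [eval_bound] asks for a positive N, whereas the norm may vanish; it is enlarged by e / (C +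
   1). *)
apply/ler_addgt0Pr => e e0; have C1 : 0 < C + 1 by rewrite ltr_wpDl.
have e1 : 0 < e / (C + 1) by rewrite divr_gt0.
apply: (le_trans (H (pnorm Omega p f + e / (C + 1)) _ _)).
- by rewrite lerDl ltW.
- by rewrite ltr_wpDl// pnorm_ge0.
by rewrite mulrDr lerD2l mulrCA ler_piMr ?ltW// ltr_pdivrMr// mul1r ltrDl.
Qed.

Lemma cvg_restrict_norm (u : nat -> V -> R[i]) f t :
  (forall z, Omega z -> u k z @[k --> \oo] --> f z) ->
  restrict_norm Omega (u k) t @[k --> \oo] --> restrict_norm Omega f t.
Proof.
move=> uf; have [tO|tO] := pselect (Omega (toCn t)).
  rewrite restrict_norm_in// (_ : (fun k => _) = (fun k => normc (u k (toCn t)))).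
    exact: cvg_normc (uf _ tO).
  by apply/funext => k; rewrite restrict_norm_in.
rewrite restrict_norm_out// (_ : (fun k => _) = cst 0); first exact: cvg_cst.
by apply/funext => k; rewrite restrict_norm_out.
Qed.

(** Lower semicontinuity of the norm under pointwise convergence. It will yield both membership of a
    limit in the Bergman space and convergence in norm. *)
Lemma pnorm_fatou (u : nat -> V -> R[i]) f (N : R) : holomorphic Omega f ->
  (forall k, Bergman Omega p (u k)) -> 0 <= N ->
  (forall k, pnorm Omega p (u k) <= N) ->
  (forall z, Omega z -> u k z @[k --> \oo] --> f z) ->
  Bergman Omega p f /\ pnorm Omega p f <= N.
Proof.
move=> hf bu N0 uN uf; apply: Bergman_le => //.
have mp (h : V -> R[i]) : holomorphic Omega h ->
    measurable_fun [set: n.-tuple P] (fun t => (restrict_norm Omega h t `^ p)%:E).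
  move=> mh; apply/measurable_EFinP.
  exact: (measurableT_comp (measurable_powR p) (measurable_restrict mh)).
have := fatou (lebesgueCn n) measurableT (fun k => mp _ (bu k).1)
  (fun k t _ => powR_ge0 _ _ : (0 <= (restrict_norm Omega (u k) t `^ p)%:E)%E).
have -> : (fun t => limn_einf (fun k => (restrict_norm Omega (u k) t `^ p)%:E)) =
    (fun t => (restrict_norm Omega f t `^ p)%:E).
  apply/funext => t; apply: limn_einf_EFin.
  apply: (cvg_powR p0 (fun k => restrict_norm_ge0 _ _ _)).
  exact: cvg_restrict_norm.
move=> /le_trans; apply; rewrite limn_einf_lim; apply: lime_le.
  exact: is_cvg_einfs.
near=> k; apply: (@le_trans _ _ (\int[lebesgueCn n]_t
    (restrict_norm Omega (u k) t `^ p)%:E)%E).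
  by apply: ereal_inf_lbound; exists k => /=.
rewrite Bergman_integral// lee_fin ge0_ler_powR// ?nnegrE ?pnorm_ge0//.
exact: ltW.
Unshelve. all: by end_near. Qed.

End bergman_space.

Section complex_sequences.
Context {R : realType}.
Implicit Types (u v : nat -> R[i]) (a b : R[i]).

Lemma cauchy_cvgn (u : nat -> R) :
  (forall e, 0 < e -> exists N, forall j k, (N <= j)%N -> (N <= k)%N ->
    `|u j - u k| < e) -> exists a : R, u k @[k --> \oo] --> a.
Proof.
move=> cu; apply/cvg_ex; apply: (@cauchy_cvg _ (u @ \oo)).
apply/cauchy_exP => e e0.
have [N uN] := cu _ e0; exists (u N); exists N => // k /= Nk.
by rewrite /ball/=; exact: uN.
Qed.

Lemma normc_cauchy_cvg u :
  (forall e, 0 < e -> exists N, forall j k, (N <= j)%N -> (N <= k)%N ->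
    normc (u j - u k) < e) -> exists a : R[i], u k @[k --> \oo] --> a.
Proof.
move=> cu.
have [x ux] : exists x : R, Re (u k) @[k --> \oo] --> x.
  apply: cauchy_cvgn => e /cu[N uN]; exists N => j k Nj Nk.
  by rewrite -ReB; exact: le_lt_trans (abs_Re_le _) (uN _ _ Nj Nk).
have [y uy] : exists y : R, Im (u k) @[k --> \oo] --> y.
  apply: cauchy_cvgn => e /cu[N uN]; exists N => j k Nj Nk.
  by rewrite -ImB; exact: le_lt_trans (abs_Im_le _) (uN _ _ Nj Nk).
exists (x +i* y); apply/cvg_normcP => e e0.
have e20 : 0 < e / 2 by rewrite divr_gt0.
move/cvgrPdist_lt : ux => /(_ _ e20) ux; move/cvgrPdist_lt : uy => /(_ _ e20) uy.
near=> k; apply: (le_lt_trans (normc_le_ReIm _)); rewrite ReB ImB/=.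
rewrite distrC [X in _ + X]distrC (splitr e) ltrD//; first by near: k.
by near: k.
Unshelve. all: by end_near. Qed.

Lemma normc_lim_le u a (M : R) : u k @[k --> \oo] --> a ->
  (\forall k \near \oo, normc (u k) <= M) -> normc a <= M.
Proof.
move=> /cvg_normc ua uM; rewrite -(cvg_lim _ ua)//; apply: limr_le => //.
by apply/cvg_ex; exists (normc a).
Qed.

Lemma cvg_normc_sum n (u : nat -> 'I_n -> R[i]) (a : 'I_n -> R[i]) :
  (forall j, u k j @[k --> \oo] --> a j) ->
  \sum_j u k j @[k --> \oo] --> \sum_j a j.
Proof.
move=> ua; elim: (index_enum _) => [|j s IH].
  rewrite big_nil (_ : (fun k => _) = cst 0); first exact: cvg_cst.
  by apply/funext => k; rewrite big_nil.
rewrite big_cons (_ : (fun k => _) = (fun k => u k j + \sum_(i <- s) u k i)).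
  exact: (cvgD (ua j) IH).
by apply/funext => k; rewrite big_cons.
Qed.

End complex_sequences.

(** * Limits of Cauchy sequences in the Bergman space *)

Section bergman_complete.
Context {R : realType} (n : nat).
Local Notation V := 'rV[R[i]]_n.
Implicit Types (z w h : V) (f g : V -> R[i]) (Omega : set V).

Definition gradient_at f z (a : 'I_n -> R[i]) := forall h (e : R), 0 < e ->
  exists2 d : R, 0 < d & forall l : R[i], normc l < d ->
    normc (f (z + l *: h) - f z - (\sum_j a j * h 0 j) * l) <= e * normc l.

Lemma gradient_atB f g z a b : gradient_at f z a -> gradient_at g z b ->
  gradient_at (fun w => f w - g w) z (fun j => a j - b j).
Proof.
move=> fa gb h e e0; have e20 : 0 < e / 2 by rewrite divr_gt0.
have [d d0 fd] := fa h _ e20; have [d' d'0 gd] := gb h _ e20.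
exists (Num.min d d') => [|l]; first by rewrite lt_min d0.
rewrite lt_min => /andP[/fd fl /gd gl].
have -> : \sum_j (a j - b j) * h 0 j =
    (\sum_j a j * h 0 j) - (\sum_j b j * h 0 j).
  by rewrite -sumrB; apply: eq_bigr => j _; rewrite mulrBl.
move: fl gl; set A := \sum_j a j * _; set B := \sum_j b j * _ => fl gl.
have -> : f (z + l *: h) - g (z + l *: h) - (f z - g z) - (A - B) * l =
    (f (z + l *: h) - f z - A * l) + - (g (z + l *: h) - g z - B * l) by ring.
apply: (le_trans (le_normcD _ _)); rewrite normcN (splitr e) mulrDl.
exact: lerD.
Qed.

(** [taylor_bound] on the slice l -> f(z + l h), evaluated at l = 1. The bounds are uniform in [f]
    for a given M, which makes them usable along a sequence. *)
Lemma gradient_bound Omega f z a (r M rho : R) h : holomorphic Omega f ->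
  cbox z r `<=` Omega -> (forall w, cbox z r w -> normc (f w) <= M) ->
  gradient_at f z a -> 0 < r -> 0 < rho -> (forall j, normc (h 0 j) <= rho) ->
  normc (\sum_j a j * h 0 j) <= 32 * M / r * rho /\
  (rho <= r / 4 -> normc (f (z + h) - f z - \sum_j a j * h 0 j) <=
    128 * M / r ^+ 2 * rho ^+ 2).
Proof.
move=> hf zO fM fa r0 rho0 hrho.
(* For l in the square |l| <= 2 s, hence |l h_j| <= 2 s rho = r. The constants become 16 M / s = 32
   M rho / r and 32 M / s^2 = 128 M rho^2 / r^2, and l = 1 satisfies |l| <= s / 2 exactly when rho
   <= r / 4. *)
pose s := r / (2 * rho); have s0 : 0 < s by rewrite divr_gt0// mulr_gt0.
have inB l : rect (- s) s (- s) s l -> cbox z r (z + l *: h).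
  move=> [/andP[l1 l2] /andP[l3 l4]] j; rewrite !mxE -ReB -ImB addrAC subrr add0r.
  have lh : normc (l * h 0 j) <= r.
    have -> : r = 2 * s * rho by rewrite /s; field; rewrite gt_eqF.
    rewrite normcM ler_pM ?normc_ge0//.
    have Rl : `|Re l| <= s by rewrite ler_norml l1.
    have Il : `|Im l| <= s by rewrite ler_norml l3.
    by apply: (le_trans (normc_le_ReIm _)); move: Rl Il; clear; lra.
  split; first exact: le_trans (abs_Re_le _) lh.
  exact: le_trans (abs_Im_le _) lh.
pose g (l : R[i]) := f (z + l *: h).
have g0 : g 0 = f z by rewrite /g scale0r addr0.
have := @taylor_bound R g s M (\sum_j a j * h 0 j) s0.
case.
- move=> l /inB/zO/hf fl; exact: differentiable_along.
- by move=> l /inB/fM.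
- by move=> e e0; rewrite g0; exact: fa.
move=> H1 H2; split.
  apply: (le_trans H1); rewrite le_eqVlt; apply/orP; left; apply/eqP.
  by rewrite /s; field; rewrite !gt_eqF.
move=> rhor; have n1 : normc (1 : R[i]) <= s / 2.
  rewrite normc1 /s -mulrA -invfM ler_pdivlMr ?mulr_gt0// mul1r.
  by move: rhor; clear; lra.
have := H2 _ n1; rewrite g0 /g scale1r mulr1 normc1 expr1n mulr1 => /le_trans; apply.
rewrite le_eqVlt; apply/orP; left; apply/eqP.
by rewrite /s; field; rewrite !gt_eqF.
Qed.

Variables (Omega : set V) (p : R).
Hypotheses (oO : open Omega) (p1 : 1 <= p).

Definition Bergman_cauchy (f : nat -> V -> R[i]) := forall e, 0 < e ->
  exists N, forall j k, (N <= j)%N -> (N <= k)%N ->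
    pnorm Omega p (fun z => f j z - f k z) < e.

(** Doubling the radius leaves a box of radius [r] around every point of [cbox z r], so one constant
    serves them all. *)
Lemma pnorm_eval_cbox z r : 0 < r -> cbox z (r + r) `<=` Omega ->
  exists2 C : R, 0 < C & forall f w, Bergman Omega p f -> cbox z r w ->
    normc (f w) <= C * pnorm Omega p f.
Proof.
move=> r0 zO; exists ((8 / r ^+ 2) ^+ n * ((4 * r ^+ 2) ^+ n + 1)).
  by rewrite mulr_gt0 ?exprn_gt0 ?divr_gt0 ?exprn_gt0 ?ltr_wpDl ?exprn_ge0 ?mulr_ge0 ?sqr_ge0 ?ltW.
move=> f w bf wB; apply: (pnorm_eval oO p1 bf r0).
by move=> v /(cbox_triangle wB)/zO.
Qed.

Lemma open_cbox2 z : Omega z -> exists2 r : R, 0 < r & cbox z (r + r) `<=` Omega.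
Proof.
move=> Oz; have [r r0 rO] := nbhs_cbox (open_nbhs_nbhs (conj oO Oz)).
by exists (r / 2); rewrite ?divr_gt0// -splitr.
Qed.

Lemma cbox_sub z (r s : R) : r <= s -> cbox z r `<=` cbox z s.
Proof. by move=> rs w wz j; have [? ?] := wz j; split; exact: le_trans rs. Qed.

Lemma Bergman_cauchy_cvg (f : nat -> V -> R[i]) z : (forall k, Bergman Omega p (f k)) ->
  Bergman_cauchy f -> Omega z -> exists a : R[i], f k z @[k --> \oo] --> a.
Proof.
move=> bf cf Oz; have [r r0 zO] := open_cbox2 Oz.
have [C C0 fC] := pnorm_eval_cbox r0 zO.
apply: normc_cauchy_cvg => e e0.
have eC0 : 0 < e / C by rewrite divr_gt0.
have [N fN] := cf _ eC0; exists N => j k Nj Nk.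
apply: (le_lt_trans (fC _ z (BergmanB oO p1 (bf j) (bf k)).1 (cbox_center z (ltW r0)))).
by rewrite mulrC -ltr_pdivlMr//; exact: fN.
Qed.

Lemma Bergman_cauchy_bounded (f : nat -> V -> R[i]) : (forall k, Bergman Omega p (f k)) ->
  Bergman_cauchy f -> exists2 B, 0 <= B & \forall k \near \oo, pnorm Omega p (f k) <= B.
Proof.
move=> bf /(_ 1 ltr01)[N fN]; exists (1 + pnorm Omega p (f N)).
  by rewrite addr_ge0// pnorm_ge0.
exists N => // k /= Nk.
have [_] := BergmanD oO p1 (BergmanB oO p1 (bf k) (bf N)).1 (bf N).
rewrite (_ : (fun _ => _) = f k); last by apply/funext => z; rewrite subrK.
by move=> /le_trans; apply; rewrite lerD2r ltW//; exact: fN.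
Qed.

(** The gradients of the f_k converge, and their quadratic remainders have a common constant because
    the norms are bounded. Letting k tend to infinity at each fixed increment gives the hypothesis
    of [differentiable_quadratic] for F. *)
Lemma Bergman_limit_holomorphic (f : nat -> V -> R[i]) F : (forall k, Bergman Omega p (f k)) ->
  Bergman_cauchy f -> (forall z, Omega z -> f k z @[k --> \oo] --> F z) ->
  holomorphic Omega F.
Proof.
move=> bf cf fF z Oz; have [r r0 zO2] := open_cbox2 Oz.
have [C C0 fC] := pnorm_eval_cbox r0 zO2.
have zO : cbox z r `<=` Omega.
  by apply: subset_trans zO2; apply: cbox_sub; rewrite lerDl ltW.
have /choice[a fa] : forall k, exists a, gradient_at (f k) z a.
  by move=> k; exact: differentiable_gradient ((bf k).1 z Oz).
have [B B0 fB] := Bergman_cauchy_bounded bf cf.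
have /choice[A aA] : forall j, exists l : R[i], a k j @[k --> \oo] --> l.
  move=> j; apply: normc_cauchy_cvg => e e0.
  have e1 : 0 < e / (32 * C / r) by rewrite !divr_gt0// mulr_gt0.
  have [N fN] := cf _ e1; exists N => k m Nk Nm.
  have bkm := (BergmanB oO p1 (bf k) (bf m)).1.
  have hdelta i : normc ((delta_mx 0 j : V) 0 i) <= 1.
    by rewrite !mxE eqxx/=; case: (i == j); rewrite ?normc1// normc0.
  (* The gradient bound for f_k - f_m in the coordinate direction j, with rho = 1, shows that the
     j-th partial derivatives form a Cauchy sequence. *)
  have [+ _] := gradient_bound bkm.1 zO (fun w => fC _ w bkm)
    (gradient_atB (fa k) (fa m)) r0 ltr01 hdelta.
  rewrite (bigD1 j)//= big1 => [|i ij]; last by rewrite !mxE (negbTE ij) mulr0.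
  rewrite !mxE !eqxx addr0 !mulr1 => /le_lt_trans; apply.
  by rewrite mulrA mulrAC mulrC -ltr_pdivlMr ?divr_gt0 ?mulr_gt0//; exact: fN.
have r40 : 0 < r / 4 by rewrite divr_gt0.
apply: (differentiable_quadratic (a := A) (C := 128 * (C * B) / r ^+ 2) r40).
(* [gradient_bound] needs rho > 0; otherwise h = 0 and the remainder vanishes. *)
move=> h rho rhor hrho; have [rho0|rho0] := leP rho 0.
  have -> : h = 0.
    apply/rowP => j; rewrite mxE; apply/eqP/eqP/eq0_normc/eqP.
    by rewrite eq_le normc_ge0 (le_trans (hrho j)).
  rewrite addr0 subrr sub0r normcN big1 => [|j _]; last by rewrite mxE mulr0.
  by rewrite normc0 mulr_ge0 ?sqr_ge0// divr_ge0 ?sqr_ge0// !mulr_ge0// ltW.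
have zh : Omega (z + h).
  apply: zO => j; rewrite !mxE -ReB -ImB addrAC subrr add0r.
  have hr : normc (h 0 j) <= r by apply: (le_trans (hrho j)); clear -r0 rhor; lra.
  split; first exact: le_trans (abs_Re_le _) hr.
  exact: le_trans (abs_Im_le _) hr.
have cs : \sum_j a k j * h 0 j @[k --> \oo] --> \sum_j A j * h 0 j.
  by apply: cvg_normc_sum => j; exact: (cvgM (aA j) (cvg_cst (h 0 j))).
apply: (normc_lim_le (cvgB (cvgB (fF _ zh) (fF _ Oz)) cs)).
near=> k.
have fM w : cbox z r w -> normc (f k w) <= C * B.
  move=> zw; apply: (le_trans (fC _ _ (bf k) zw)); rewrite ler_pM2l//.
  by near: k.
have [_] := gradient_bound (bf k).1 zO fM (fa k) r0 rho0 hrho.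
by apply; exact: ltW.
Unshelve. all: by end_near. Qed.

Lemma Bergman_complete (f : nat -> V -> R[i]) : (forall k, Bergman Omega p (f k)) ->
  Bergman_cauchy f -> exists F, [/\ Bergman Omega p F,
    forall z, Omega z -> f k z @[k --> \oo] --> F z &
    forall e, 0 < e -> \forall k \near \oo,
      pnorm Omega p (fun z => f k z - F z) <= e].
Proof.
move=> bf cf.
have /choice[F fF] : forall z, exists a : R[i], Omega z -> f k z @[k --> \oo] --> a.
  move=> z; have [/(Bergman_cauchy_cvg bf cf)[a fa]|nO] := pselect (Omega z).
    by exists a.
  by exists 0.
have hF := Bergman_limit_holomorphic bf cf fF.
(* For fixed k the functions f_k - f_m have norm below e and converge pointwise to f_k - F, so
   [pnorm_fatou] applies. Shifting m by N makes the bound hold for every term. *)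
have key e : 0 < e -> \forall k \near \oo,
    Bergman Omega p (fun z => f k z - F z) /\
    pnorm Omega p (fun z => f k z - F z) <= e.
  move=> e0; have [N fN] := cf _ e0; exists N => // k /= Nk.
  have hkF : holomorphic Omega (fun z => f k z - F z).
    have := holomorphicD (bf k).1 (holomorphicM (@holomorphic_cst _ _ Omega (-1)) hF).
    by congr holomorphic; apply/funext => z; rewrite mulN1r.
  have bN m := (BergmanB oO p1 (bf k) (bf (m + N)%N)).1.
  have leN m : pnorm Omega p (fun z => f k z - f (m + N)%N z) <= e.
    by rewrite ltW// fN// leq_addl.
  apply: (pnorm_fatou oO p1 hkF bN (ltW e0) leN) => z Oz.
  have fFN : f (m + N)%N z @[m --> \oo] --> F z.
    by have := fF z Oz; rewrite -(cvg_shiftn N).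
  exact: (cvgB (cvg_cst (f k z)) fFN).
exists F; split => //.
  (* F is recovered as f_N - (f_N - F), a difference of two elements of the space. *)
  have [N _ /(_ N (leqnn N))[bNF _]] := key 1 ltr01.
  have := (BergmanB oO p1 (bf N) bNF).1.
  by congr (Bergman _ _ _); apply/funext => z; rewrite subKr.
by move=> e /key; apply: filterS => k [].
Qed.

End bergman_complete.

(** * Clarkson's inequality and minimizers *)

Section clarkson.
Context {R : realType}.
Implicit Types (s t q p : R) (a b : R[i]).

(** The ratios s / (s + t) and t / (s + t) lie in [0, 1] and sum to 1; raising them to a power q >=
    1 only decreases them. *)
Lemma powR_superadd s t q : 1 <= q -> 0 <= s -> 0 <= t ->
  s `^ q + t `^ q <= (s + t) `^ q.
Proof.
move=> q1 s0 t0.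
have [st0|st0] := leP (s + t) 0.
  have -> : s = 0 by clear -s0 t0 st0; lra.
  have -> : t = 0 by clear -s0 t0 st0; lra.
  have q0 : q != 0 by rewrite gt_eqF// (lt_le_trans _ q1).
  by rewrite addr0 !powR0// addr0.
have key u : 0 <= u -> u <= s + t -> u `^ q <= (u / (s + t)) * (s + t) `^ q.
  move=> u0 ust; have [->|u1] := eqVneq u 0.
    by rewrite powR0 ?mul0r// gt_eqF// (lt_le_trans _ q1).
  have {}u0 : 0 < u by rewrite lt_neqAle eq_sym u1.
  have -> : u `^ q = (u / (s + t)) `^ q * (s + t) `^ q.
    rewrite -powRM ?divr_ge0 ?ltW//; congr (_ `^ _).
    by rewrite divfK// gt_eqF.
  apply: ler_wpM2r; first exact: powR_ge0.
  by apply: ge1r_powR => //; rewrite divr_gt0//= ler_pdivrMr// mul1r.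
have -> : (s + t) `^ q = (s / (s + t)) * (s + t) `^ q + (t / (s + t)) * (s + t) `^ q.
  by rewrite -mulrDl -mulrDl divff ?mul1r// gt_eqF.
by apply: lerD; apply: key; rewrite ?lerDl ?lerDr.
Qed.

Lemma powR_midpoint s t q : 1 <= q -> 0 <= s -> 0 <= t ->
  (s + t) `^ q <= 2 `^ (q - 1) * (s `^ q + t `^ q).
Proof.
move=> q1 s0 t0.
have half : 2^-1 = 1 - 2^-1 :> R by clear; lra.
have : (2^-1 * (2 * s) + 2^-1 * (2 * t)) `^ q <=
    2^-1 * (2 * s) `^ q + 2^-1 * (2 * t) `^ q.
  rewrite {2 4}half.
  by apply: (convex_powR q1 (Itv01 _ _)) => //=;
    rewrite ?inE/= ?in_itv/= ?mulr_ge0// ?invr_ge0// invf_le1 ?ler1n.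
rewrite !mulrA mulVf// !mul1r => /le_trans; apply.
rewrite !powRM// !mulrA -powR_inv1// -powRD ?pnatr_eq0 ?implybT//.
by rewrite (addrC _ q) -mulrDr.
Qed.

Lemma normc_parallelogram a b :
  normc (a + b) ^+ 2 + normc (a - b) ^+ 2 = 2 * (normc a ^+ 2 + normc b ^+ 2).
Proof.
have sq (c : R[i]) : normc c ^+ 2 = Re c ^+ 2 + Im c ^+ 2.
  by case: c => x y; rewrite /normc/= sqr_sqrtr// addr_ge0 ?sqr_ge0.
by rewrite !sq; case: a => a1 a2; case: b => b1 b2 /=; ring.
Qed.

(** With q = p / 2 >= 1: superadditivity of x^q on the squared moduli, then the parallelogram
    identity, then convexity of x^q. The constant is 2^q 2^(q - 1) = 2^(p - 1). *)
Lemma clarkson_normc a b p : 2 <= p ->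
  normc (a + b) `^ p + normc (a - b) `^ p <=
  2 `^ (p - 1) * (normc a `^ p + normc b `^ p).
Proof.
move=> p2; pose q := p / 2; have q1 : 1 <= q by rewrite ler_pdivlMr// mul1r.
have sq (c : R[i]) : normc c `^ p = (normc c ^+ 2) `^ q.
  rewrite -powR_mulrn ?normc_ge0// -powRrM; congr (_ `^ _).
  by rewrite mulrC divfK.
rewrite !sq; apply: (le_trans (powR_superadd q1 (sqr_ge0 _) (sqr_ge0 _))).
rewrite normc_parallelogram powRM ?addr_ge0 ?sqr_ge0//.
have -> : 2 `^ (p - 1) = 2 `^ q * 2 `^ (q - 1).
  by rewrite -powRD ?pnatr_eq0 ?implybT//; congr (_ `^ _); rewrite /q; clear; lra.
by rewrite -mulrA ler_pM2l ?powR_gt0//; exact: powR_midpoint (sqr_ge0 _) (sqr_ge0 _).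
Qed.

End clarkson.

(** * The extremal problem: existence and uniqueness of its solution *)

Section extremal_functions.
Context {R : realType} (n : nat).
Local Notation V := 'rV[R[i]]_n.
Let RT : measurableType _ := measurableTypeR R.
Let P : measurableType _ := (RT * RT)%type.
Variables (Omega : set V) (p : R).
Hypotheses (oO : open Omega) (bO : bounded_set Omega) (p2 : 2 <= p).
Implicit Types (z w : V) (f g : V -> R[i]).

Let p1 : 1 <= p. Proof. by rewrite (le_trans _ p2)// ler1n. Qed.

Let p0 : 0 < p. Proof. exact: lt_le_trans p1. Qed.

Lemma bounded_cbox : exists2 M : R, 0 <= M & Omega `<=` cbox 0 M.
Proof.
have [M [Mreal OM]] := bO.
(* The first 1 provides a bound strictly beyond M, as [bounded_set] requires; the second gives
   strict membership in a ball. *)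
pose x := M + 1 + 1; have xreal : x \is Num.real by rewrite !rpredD ?rpred1.
have xE : x = (Re x)%:C by rewrite RRe_real.
exists `|Re x| => // w wO j; rewrite mxE !subr0.
have : ball (0 : V) x w.
  rewrite -ball_normE /= sub0r normrN (@le_lt_trans _ _ (M + 1)) ?ltrDl//.
  by apply: OM => //; rewrite ltrDl.
move=> [_ /(_ 0 j)]; rewrite -ball_normE /= mxE sub0r normrN xE norm_normcE ltcR => /ltW.
move=> /le_trans/(_ (ler_norm _)) wx; split.
  exact: le_trans (abs_Re_le _) wx.
exact: le_trans (abs_Im_le _) wx.
Qed.

(** Boundedness of [Omega] enters here. The constant 1 is a competitor at every point, so [min_norm]
    is the infimum of a nonempty set. *)
Lemma Bergman_one : Bergman Omega p (fun=> 1).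
Proof.
have [M M0 OM] := bounded_cbox.
pose W := (4 * M ^+ 2) ^+ n : R.
have W0 : 0 <= W by rewrite exprn_ge0// mulr_ge0 ?sqr_ge0.
have hc := @holomorphic_cst _ _ Omega (1 : R[i]).
have N0 : 0 <= W `^ p^-1 by exact: powR_ge0.
suff H : (\int[lebesgueCn n]_t (restrict_norm Omega (fun=> 1) t `^ p)%:E <=
    ((W `^ p^-1) `^ p)%:E)%E by exact: (Bergman_le p1 hc N0 H).1.
have -> : (W `^ p^-1) `^ p = W by rewrite -powRrM mulVf ?gt_eqF// powRr1.
rewrite -(lebesgueCn_cbox (0 : V) M0).
have mB := measurable_cbox (0 : V) M.
have := integral_indic (lebesgueCn n) measurableT mB; rewrite setIT => <-.
apply: ge0_le_integral => //.
- by move=> t _; rewrite lee_fin powR_ge0.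
- apply/measurable_EFinP.
  exact: (measurableT_comp (measurable_powR p) (measurable_restrict oO hc)).
- exact/measurable_EFinP.
move=> t _; rewrite lee_fin indicE.
have [tO|tO] := pselect (Omega (toCn t)).
  by rewrite restrict_norm_in// normc1 powR1 mem_set//; exact: OM.
by rewrite restrict_norm_out// powR0 ?gt_eqF.
Qed.

Lemma clarkson_Bergman f g : Bergman Omega p f -> Bergman Omega p g ->
  pnorm Omega p (fun z => f z + g z) `^ p + pnorm Omega p (fun z => f z - g z) `^ p
  <= 2 `^ (p - 1) * (pnorm Omega p f `^ p + pnorm Omega p g `^ p).
Proof.
move=> bf bg; have bD := (BergmanD oO p1 bf bg).1.
have bB := (BergmanB oO p1 bf bg).1.
pose I h t := (restrict_norm Omega h t `^ p)%:E.
have I0 h t : (0 <= I h t)%E by rewrite lee_fin powR_ge0.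
have mI h : holomorphic Omega h -> measurable_fun [set: n.-tuple P] (I h).
  move=> hh; apply/measurable_EFinP.
  exact: (measurableT_comp (measurable_powR p) (measurable_restrict oO hh)).
have c0 : (0 <= (2 `^ (p - 1))%:E :> \bar R)%E by rewrite lee_fin powR_ge0.
rewrite -lee_fin EFinM !EFinD -!Bergman_integral//.
have mfg : measurable_fun [set: n.-tuple P] (fun t => I f t + I g t)%E.
  exact: emeasurable_funD (mI _ bf.1) (mI _ bg.1).
have J0 h t : [set: n.-tuple P] t -> (0 <= I h t)%E by [].
rewrite -(ge0_integralD _ measurableT (J0 _) (mI _ bD.1) (J0 _) (mI _ bB.1)).
rewrite -(ge0_integralD _ measurableT (J0 _) (mI _ bf.1) (J0 _) (mI _ bg.1)).
have J1 t : [set: n.-tuple P] t -> (0 <= I f t + I g t)%E by move=> _; exact: adde_ge0.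
rewrite -(ge0_integralZl _ measurableT mfg J1 c0).
apply: (ge0_le_integral _ measurableT).
- by move=> t _; exact: adde_ge0.
- exact: emeasurable_funD (mI _ bD.1) (mI _ bB.1).
- exact: measurable_funeM.
move=> t _; rewrite -!EFinD -EFinM lee_fin.
have [tO|tO] := pselect (Omega (toCn t)).
  by rewrite !restrict_norm_in//; exact: clarkson_normc.
by rewrite !restrict_norm_out// powR0 ?gt_eqF// addr0 mulr0.
Qed.

(** Quantitative uniform convexity: if the midpoint of [f] and [g] has norm at least m, Clarkson's
    inequality leaves at most 2^p (N^p - m^p) for the difference. *)
Lemma pnorm_sub_midpoint f g (m N : R) : Bergman Omega p f -> Bergman Omega p g ->
  0 <= m -> pnorm Omega p f <= N -> pnorm Omega p g <= N ->
  2 * m <= pnorm Omega p (fun z => f z + g z) ->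
  pnorm Omega p (fun z => f z - g z) `^ p <= 2 `^ p * (N `^ p - m `^ p).
Proof.
move=> bf bg m0 fN gN mfg; have := clarkson_Bergman bf bg.
have mono x y : 0 <= x -> x <= y -> x `^ p <= y `^ p.
  move=> x0 xy; apply: ge0_ler_powR; rewrite ?nnegrE//; first exact: ltW.
  exact: le_trans xy.
have fN' := mono _ _ (pnorm_ge0 _ _ _) fN.
have gN' := mono _ _ (pnorm_ge0 _ _ _) gN.
have := mono _ _ (mulr_ge0 (ler0n R 2) m0) mfg; rewrite powRM//.
have -> : 2 `^ p = 2 * 2 `^ (p - 1) :> R.
  by rewrite -[X in X * _]powRr1// -powRD ?pnatr_eq0 ?implybT// subrKC.
set A := _ `^ p; set B := _ `^ p; set c := 2 `^ (p - 1) => mA.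
have c0 : 0 < c by exact: powR_gt0.
have : c * (pnorm Omega p f `^ p + pnorm Omega p g `^ p) <= c * (N `^ p + N `^ p).
  by rewrite ler_pM2l// lerD.
by move=> fgN cl; clear -mA fgN cl c0; nra.
Qed.

Let Sz z := [set pnorm Omega p f | f in [set f | Bergman Omega p f /\ f z = 1]].

Let Sz_lb z : has_lbound (Sz z).
Proof. by exists 0 => _ [f _ <-]; exact: pnorm_ge0. Qed.

Let Sz_inf z : has_inf (Sz z).
Proof.
split; last exact: Sz_lb.
by exists (pnorm Omega p (fun=> 1)), (fun=> 1) => //; split => //; exact: Bergman_one.
Qed.

Lemma min_norm_le f z : Bergman Omega p f -> f z = 1 ->
  min_norm Omega p z <= pnorm Omega p f.
Proof. by move=> bf fz; apply: (ge_inf (Sz_lb z)); exists f. Qed.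

(** Bounded evaluation gives 1 = |f(z)| <= C ||f|| for every competitor. *)
Lemma min_norm_gt0 z : Omega z -> 0 < min_norm Omega p z.
Proof.
move=> Oz; have [r r0 zO] := open_cbox2 oO Oz.
have [C C0 fC] := pnorm_eval_cbox oO p1 r0 zO.
apply: (@lt_le_trans _ _ C^-1); first by rewrite invr_gt0.
apply: lb_le_inf; first exact: (Sz_inf z).1.
move=> _ [f [bf fz] <-]; have := fC _ _ bf (cbox_center z (ltW r0)).
by rewrite fz normc1 mulrC -ler_pdivrMr// div1r.
Qed.

Lemma min_norm_eval f z : Bergman Omega p f -> Omega z ->
  normc (f z) * min_norm Omega p z <= pnorm Omega p f.
Proof.
move=> bf Oz; have [fz0|fz0] := eqVneq (f z) 0.
  by rewrite fz0 normc0 mul0r pnorm_ge0.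
have [bc cf] := BergmanZ oO p1 (f z)^-1 bf.
have fz : 0 < normc (f z) by rewrite normc_gt0.
rewrite -ler_pdivlMl// -normcV.
by apply: le_trans cf; apply: min_norm_le; rewrite // mulVf.
Qed.

Lemma double_min_norm f g z : Bergman Omega p f -> Bergman Omega p g ->
  Omega z -> f z = 1 -> g z = 1 ->
  2 * min_norm Omega p z <= pnorm Omega p (fun w => f w + g w).
Proof.
move=> bf bg Oz fz gz.
have := min_norm_eval (BergmanD oO p1 bf bg).1 Oz; rewrite fz gz.
by rewrite -[1 + 1]/(2 : R[i]) -(rmorph_nat (real_complex R)) normc_real ger0_norm.
Qed.

(** Midpoints of competitors are competitors, hence of norm at least m, while the norms of a
    minimizing sequence tend to m. [pnorm_sub_midpoint] then makes the sequence Cauchy. *)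
Lemma exists_minimizer z : Omega z -> exists f, [/\ Bergman Omega p f, f z = 1 &
  pnorm Omega p f = min_norm Omega p z].
Proof.
move=> Oz; pose m := min_norm Omega p z.
have m0 : 0 < m := min_norm_gt0 Oz.
have /choice[f fP] : forall k : nat, exists f, [/\ Bergman Omega p f, f z = 1 &
    pnorm Omega p f <= m + k.+1%:R^-1].
  move=> k; have k0 : 0 < k.+1%:R^-1 :> R by [].
  have [_ [f [bf fz] <-] fm] := inf_adherent k0 (Sz_inf z).
  by exists f; split => //; exact: ltW.
have bf k : Bergman Omega p (f k) by have [] := fP k.
have fz k : f k z = 1 by have [] := fP k.
have fm k : pnorm Omega p (f k) <= m + k.+1%:R^-1 by have [] := fP k.
have mcvg : (m + k.+1%:R^-1) `^ p @[k --> \oo] --> m `^ p.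
  apply: (cvg_powR p0) => [k|]; first by rewrite addr_ge0// ltW.
  rewrite -[X in _ --> X]addr0; apply: cvgD; first exact: cvg_cst.
  exact: cvg_harmonic.
have cf : Bergman_cauchy Omega p f.
  move=> e e0; have d0 : 0 < e `^ p / 2 `^ p by rewrite divr_gt0 ?powR_gt0.
  move/cvgrPdist_lt : mcvg => /(_ _ d0)[N _ mN].
  exists N => j k Nj Nk.
  have le_N i : (N <= i)%N -> pnorm Omega p (f i) <= m + N.+1%:R^-1.
    move=> Ni; apply: (le_trans (fm i)).
    by rewrite lerD2l lef_pV2 ?posrE// ler_nat.
  have := pnorm_sub_midpoint (bf j) (bf k) (ltW m0) (le_N _ Nj) (le_N _ Nk)
    (double_min_norm (bf j) (bf k) Oz (fz j) (fz k)).
  have /= := mN N (leqnn N); rewrite distrC => /(le_lt_trans (ler_norm _)) H1 H2.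
  have : pnorm Omega p (fun z => f j z - f k z) `^ p < e `^ p.
    apply: (le_lt_trans H2).
    by rewrite mulrC -ltr_pdivlMr// powR_gt0.
  rewrite !ltNge; apply: contraNN => H.
  by apply: ge0_ler_powR; rewrite ?nnegrE ?pnorm_ge0// ltW.
have [F [bF fF FN]] := Bergman_complete oO p1 bf cf.
have Fz : F z = 1.
  have := fF z Oz; rewrite (_ : (fun k => f k z) = cst 1); last first.
    by apply/funext => k; exact: fz.
  by move=> /(cvg_lim (@norm_hausdorff _ _)); rewrite lim_cst.
exists F; split => //; apply/eqP; rewrite eq_le min_norm_le// andbT.
apply/ler_addgt0Pr => e e0.
have e20 : 0 < e / 2 by rewrite divr_gt0.
near \oo => k.
have [_] := BergmanB oO p1 (bf k) (BergmanB oO p1 (bf k) bF).1.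
rewrite (_ : (fun _ => _) = F); last by apply/funext => w; rewrite subKr.
move=> /le_trans; apply.
have H1 : pnorm Omega p (f k) <= m + e / 2.
  apply: (le_trans (fm k)); rewrite lerD2l ltW//; near: k.
  exact: near_infty_natSinv_lt (PosNum e20).
have H2 : pnorm Omega p (fun w => f k w - F w) <= e / 2.
  by near: k; exact: FN.
rewrite -/m (splitr e) addrA; exact: lerD.
Unshelve. all: by end_near. Qed.

Lemma minimizerP z : Omega z -> [/\ Bergman Omega p (minimizer Omega p z),
  minimizer Omega p z z = 1 &
  pnorm Omega p (minimizer Omega p z) = min_norm Omega p z].
Proof. by move=> Oz; exact: xgetPex (exists_minimizer Oz). Qed.

(** [pnorm_sub_midpoint] with N = m. The conclusion is a vanishing norm because values outside
    [Omega] are arbitrary. *)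
Lemma minimizer_unique f z : Omega z -> Bergman Omega p f -> f z = 1 ->
  pnorm Omega p f <= min_norm Omega p z ->
  pnorm Omega p (fun w => f w - minimizer Omega p z w) = 0.
Proof.
move=> Oz bf fz fm; have [bm mz mm] := minimizerP Oz.
have mle : pnorm Omega p (minimizer Omega p z) <= min_norm Omega p z by rewrite mm.
have := pnorm_sub_midpoint bf bm (ltW (min_norm_gt0 Oz)) fm mle
  (double_min_norm bf bm Oz fz mz).
rewrite subrr mulr0 => H; apply/eqP; rewrite eq_le pnorm_ge0 andbT leNgt.
by apply/negP => /(powR_gt0 p); rewrite ltNge H.
Qed.

End extremal_functions.

(** * The Skwarczyński distance *)

Lemma le_of_perturbed (R : realType) (a b N : R) : 0 <= a -> 0 <= N ->
  (forall e, 0 < e -> e < 1 -> (a - e) * (1 - e) <= (b + e) * N) -> a <= b * N.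
Proof.
move=> a0 N0 key; apply/ler_addgt0Pr => e e0.
(* Expanding the hypothesis at t gives a <= b N + t (N + a + 1) - t^2. With t = e / K the error is
   at most e, and t < 1. *)
pose K := N + a + 1 + e; have K0 : 0 < K by rewrite /K; lra.
have eK : e / K * K = e by rewrite divfK// gt_eqF.
have eK0 : 0 < e / K by rewrite divr_gt0.
have eK1 : e / K < 1 by rewrite ltr_pdivrMr// mul1r /K; lra.
have := key _ eK0 eK1; move: eK eK0; set t := e / K; rewrite /K => H1 t0.
nra.
Qed.

(** Lets the angles of [rho] be handled as unimodular numbers, which can be multiplied and inverted
    without reduction modulo 2 pi. *)
Lemma unimodular_cos_sin (R : realType) (u : R[i]) : normc u = 1 ->
  exists2 t : R, t \in `[0, 2 * pi] & u = cos t +i* sin t.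
Proof.
case: u => x y; rewrite /normc/= => /(congr1 (fun r => r ^+ 2)).
rewrite sqr_sqrtr ?addr_ge0 ?sqr_ge0// expr1n => xy.
have x1 : - 1 <= x <= 1 by have y2 := sqr_ge0 y; apply/andP; split; nra.
have ysqrt : Num.sqrt (1 - x ^+ 2) = `|y| by rewrite -xy addrAC subrr add0r sqrtr_sqr.
have a0 := acos_ge0 x1; have api := acos_lepi x1.
have [y0|y0] := leP 0 y.
  exists (acos x); first by rewrite in_itv/= a0; clear -a0 api; lra.
  by rewrite acosK ?in_itv// sin_acos// ysqrt ger0_norm.
exists (2 * pi - acos x); first by rewrite in_itv/=; clear -a0 api; lra.
have -> : 2 * pi - acos x = - acos x + pi *+ 2 by ring.
rewrite cosD2pi sinD2pi cosN sinN acosK ?in_itv// sin_acos// ysqrt.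
by rewrite ltr0_norm// opprK.
Qed.

Section skwarczynski.
Context {R : realType} (n : nat).
Local Notation V := 'rV[R[i]]_n.
Variables (Omega : set V) (p : R).
Hypotheses (oO : open Omega) (bO : bounded_set Omega) (p2 : 2 <= p).
Implicit Types (x z w : V) (f g : V -> R[i]).

Let p1 : 1 <= p. Proof. by rewrite (le_trans _ p2)// ler1n. Qed.

Let p0 : 0 < p. Proof. exact: lt_le_trans p1. Qed.

Definition extremal z : V -> R[i] :=
  fun x => minimizer Omega p z x / (min_norm Omega p z)%:C.

Lemma extremal_Bergman z : Omega z -> Bergman Omega p (extremal z) /\
  pnorm Omega p (extremal z) <= 1.
Proof.
move=> Oz; have [bm _ mm] := minimizerP oO bO p2 Oz.
have m0 := min_norm_gt0 oO bO p2 Oz.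
have -> : extremal z = fun x => ((min_norm Omega p z)%:C)^-1 * minimizer Omega p z x.
  by apply/funext => x; rewrite mulrC.
have [bc cm] := BergmanZ oO p1 ((min_norm Omega p z)%:C)^-1 bm; split => //.
by move: cm; rewrite mm normcV normc_real gtr0_norm// mulVf// gt_eqF.
Qed.

Lemma extremal_diag z : Omega z -> normc (extremal z z) * min_norm Omega p z = 1.
Proof.
move=> Oz; have [_ mz _] := minimizerP oO bO p2 Oz.
have m0 := min_norm_gt0 oO bO p2 Oz.
by rewrite /extremal mz div1r normcV normc_real gtr0_norm// mulVf// gt_eqF.
Qed.

Lemma Bergman_phase (u : R[i]) f : normc u = 1 -> Bergman Omega p f ->
  Bergman Omega p (fun x => u * f x) /\
  pnorm Omega p (fun x => u * f x) <= pnorm Omega p f.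
Proof. by move=> u1 /(BergmanZ oO p1 u); rewrite u1 mul1r. Qed.

Let phase_dists z w := [set pnorm Omega p (fun x =>
  (cos t +i* sin t) * extremal z x - extremal w x) | t in `[0, 2 * pi]].

Let phase_dists_lb z w : lbound (phase_dists z w) 0.
Proof. by move=> _ [t _ <-]; exact: pnorm_ge0. Qed.

Let phase_dists_neq0 z w : phase_dists z w !=set0.
Proof.
by eexists; exists 0 => //; rewrite /= in_itv/= lexx mulr_ge0// pi_ge0.
Qed.

Lemma rhoE z w : rho Omega p z w = inf (phase_dists z w).
Proof. by rewrite /rho /phase_dists /extremal; under eq_imagel do under eq_fun do rewrite mulrA. Qed.

Lemma rho_ge0 z w : 0 <= rho Omega p z w.
Proof. by rewrite rhoE; exact: lb_le_inf. Qed.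

Lemma rho_le (u : R[i]) z w : normc u = 1 ->
  rho Omega p z w <= pnorm Omega p (fun x => u * extremal z x - extremal w x).
Proof.
move=> /unimodular_cos_sin[t t02 ->]; rewrite rhoE; apply: ge_inf.
  by exists 0; exact: phase_dists_lb.
by exists t.
Qed.

Lemma rho_lt z w (e : R) : rho Omega p z w < e -> exists2 u : R[i], normc u = 1 &
  pnorm Omega p (fun x => u * extremal z x - extremal w x) < e.
Proof.
rewrite rhoE => /(inf_lt (phase_dists_neq0 z w))[_ [t _ <-] te].
by exists (cos t +i* sin t) => //; rewrite /normc/= cos2Dsin2 sqrtr1.
Qed.

(** If u nearly aligns x with y and v nearly aligns y with z, then v u aligns x with z,
    multiplication by v being norm nonincreasing. *)
Lemma rho_triangle x y z : Omega x -> Omega y -> Omega z ->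
  rho Omega p x z <= rho Omega p x y + rho Omega p y z.
Proof.
move=> Ox Oy Oz; apply/ler_addgt0Pr => e e0.
have e20 : 0 < e / 2 by rewrite divr_gt0.
have [u u1 xy] : exists2 u : R[i], normc u = 1 & pnorm Omega p
    (fun t => u * extremal x t - extremal y t) < rho Omega p x y + e / 2.
  by apply: rho_lt; rewrite ltrDl.
have [v v1 yz] : exists2 u : R[i], normc u = 1 & pnorm Omega p
    (fun t => u * extremal y t - extremal z t) < rho Omega p y z + e / 2.
  by apply: rho_lt; rewrite ltrDl.
have vu1 : normc (v * u) = 1 by rewrite normcM u1 v1 mulr1.
have bx := (extremal_Bergman Ox).1; have by_ := (extremal_Bergman Oy).1.
have bz := (extremal_Bergman Oz).1.
have [bxy xy'] := Bergman_phase v1 (BergmanB oO p1 (Bergman_phase u1 bx).1 by_).1.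
have := (BergmanD oO p1 bxy (BergmanB oO p1 (Bergman_phase v1 by_).1 bz).1).2.
rewrite (_ : (fun _ => _) = (fun t => v * u * extremal x t - extremal z t)); last first.
  by apply/funext => t; ring.
move=> H; apply: (le_trans (rho_le _ _ vu1)); apply: (le_trans H).
apply: (@le_trans _ _ ((rho Omega p x y + e / 2) + (rho Omega p y z + e / 2))).
  by apply: lerD; [exact: le_trans xy' (ltW xy)|exact: ltW].
by rewrite addrACA -splitr.
Qed.

Lemma cluster_sequence (v : nat -> V) z (P : set nat) (A : set V) :
  cluster (v k @[k --> \oo]) z -> (\forall k \near \oo, P k) -> nbhs z A ->
  exists2 k, P k & A (v k).
Proof.
move=> vz vP zA; have : (v k @[k --> \oo]) (v @` P).
  by move: vP; apply: filterS => k Pk; exists k.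
by move=> /vz/(_ zA)[_ [[k Pk <-] Ak]]; exists k.
Qed.

Lemma phased_subsequence (w : nat -> V) : (forall k, Omega (w k)) ->
  rho_cauchy Omega p w -> exists (k : nat -> nat) (c : nat -> R[i]),
  [/\ forall N, \forall j \near \oo, (N <= k j)%N, forall j, normc (c j) = 1 &
      Bergman_cauchy Omega p (fun j x => c j * extremal (w (k j)) x)].
Proof.
move=> wO cw.
have /choice[N wN] : forall i : nat, exists N, forall j k, (N <= j)%N -> (N <= k)%N ->
    rho Omega p (w j) (w k) < 2^-1 ^+ i.
  by move=> i; apply: cw; rewrite exprn_gt0.
(* The maximum puts both k j and k (j + 1) beyond N j, so consecutive terms are within 2^-j; the
   summand j makes k tend to infinity. *)
pose k j := (j + \max_(i < j.+1) N i)%N.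
have kN i j : (i <= j)%N -> (N i <= k j)%N.
  move=> ij; apply: (@leq_trans (\max_(i < j.+1) N i)); last exact: leq_addl.
  have ij1 : (i < j.+1)%N by [].
  exact: (@leq_bigmax _ (fun i : 'I_j.+1 => N i) (Ordinal ij1)).
have /choice[u uP] : forall j, exists u : R[i], normc u = 1 /\ pnorm Omega p
    (fun x => u * extremal (w (k j.+1)) x - extremal (w (k j)) x) < 2^-1 ^+ j.
  move=> j; have [u u1 uj] := rho_lt (wN j _ _ (kN j j.+1 (leqnSn j)) (kN j j (leqnn j))).
  by exists u.
(* u_j aligns the term j + 1 with the term j. For the accumulated phases, G_(j+1) - G_j is c_j times
   the aligned difference, hence still below 2^-j in norm. *)
pose c j := \prod_(i < j) u i.
have c1 j : normc (c j) = 1.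
  rewrite /c; elim: j => [|j IH]; first by rewrite big_ord0 normc1.
  by rewrite big_ord_recr/= normcM IH mul1r (uP j).1.
pose G j x := c j * extremal (w (k j)) x.
have bE j : Bergman Omega p (extremal (w (k j))) := (extremal_Bergman (wO _)).1.
have bG j : Bergman Omega p (G j) := (Bergman_phase (c1 j) (bE j)).1.
have Gstep j : pnorm Omega p (fun x => G j.+1 x - G j x) <= 2^-1 ^+ j.
  have bu := (BergmanB oO p1 (Bergman_phase (uP j).1 (bE j.+1)).1 (bE j)).1.
  have := (Bergman_phase (c1 j) bu).2.
  rewrite (_ : (fun _ => _) = (fun x => G j.+1 x - G j x)); last first.
    by apply/funext => x; rewrite /G /c big_ord_recr/= mulrBr mulrA.
  by move=> /le_trans; apply; exact/ltW/(uP j).2.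
(* The right side is the exact geometric sum of the steps from j to j + m - 1, a form that
   telescopes in the induction. *)
have Gdist j m : pnorm Omega p (fun x => G (j + m)%N x - G j x) <=
    2 * 2^-1 ^+ j - 2 * 2^-1 ^+ (j + m).
  elim: m => [|m IH].
    rewrite addn0 subrr (_ : (fun _ => _) = (fun x => 0 * G j x)); last first.
      by apply/funext => x; rewrite subrr mul0r.
    by have := (BergmanZ oO p1 0 (bG j)).2; rewrite normc0 mul0r.
  apply: (le_trans (pnorm_dist_triangle oO p1 (bG _) (bG (j + m)%N) (bG _))).
  rewrite addnS; apply: (le_trans (lerD (Gstep _) IH)).
  rewrite exprS; set a := 2^-1 ^+ (j + m).
  by rewrite mulrA mulfV// mul1r le_eqVlt; apply/orP; left; apply/eqP; ring.
exists k, c; split => //.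
  move=> M; exists M => // j /= Mj; exact: leq_trans Mj (leq_addr _ _).
move=> e e0; have [M Me] : exists M : nat, 2 * 2^-1 ^+ M < e / 2 :> R.
  have /cvgrPdist_lt/(_ (e / 4)) : (2^-1 : R) ^+ k @[k --> \oo] --> (0 : R).
    by apply: cvg_expr; rewrite ger0_norm// invf_lt1// ltr1n.
  rewrite divr_gt0// => /(_ isT)[M _ /(_ M (leqnn M))]; rewrite /= sub0r normrN.
  rewrite ger0_norm ?exprn_ge0// => H; exists M.
  have -> : e / 2 = 2 * (e / 4) by field.
  by rewrite ltr_pM2l.
have GM j : (M <= j)%N -> pnorm Omega p (fun x => G j x - G M x) < e / 2.
  move=> /subnKC <-; apply: (le_lt_trans (Gdist _ _)); apply: le_lt_trans Me.
  by rewrite gerBl mulr_ge0// exprn_ge0.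
exists M => i j Mi Mj.
apply: (le_lt_trans (pnorm_dist_triangle oO p1 (bG _) (bG M) (bG _))).
by rewrite [X in _ + X]pnorm_distC (splitr e) ltrD ?GM.
Qed.

(** * The limit of an aligned sequence of extremal functions *)

Section cauchy_limit.
Variables (v : nat -> V) (c : nat -> R[i]) (F : V -> R[i]).
Let G j x := c j * extremal (v j) x.
Hypotheses (vO : forall j, Omega (v j)) (c1 : forall j, normc (c j) = 1).
Hypotheses (bF : Bergman Omega p F) (GF : forall e, 0 < e ->
  \forall j \near \oo, pnorm Omega p (fun x => G j x - F x) <= e).

Let bE j : Bergman Omega p (extremal (v j)) := (extremal_Bergman (vO j)).1.
Let bG j : Bergman Omega p (G j) := (Bergman_phase (c1 j) (bE j)).1.

Lemma limit_pnorm_le1 : pnorm Omega p F <= 1.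
Proof.
apply/ler_addgt0Pr => e e0; near \oo => j.
have [_] := BergmanB oO p1 (bG j) (BergmanB oO p1 (bG j) bF).1.
rewrite (_ : (fun _ => _) = F); last by apply/funext => x; rewrite subKr.
move=> /le_trans; apply; apply: lerD; last by near: j; exact: GF.
exact: le_trans (Bergman_phase (c1 j) (bE j)).2 (extremal_Bergman (vO j)).2.
Unshelve. all: by end_near. Qed.

(** [min_norm_eval] at v_j applied to G_j - F: evaluation at the moving point, weighted by
    [min_norm], has norm at most 1, so convergence in norm controls it uniformly in j. *)
Lemma limit_eval (e : R) : 0 < e -> \forall j \near \oo,
  1 - e <= normc (F (v j)) * min_norm Omega p (v j).
Proof.
move=> e0; have := GF e0; apply: filterS => j Ge.
have m0 := min_norm_gt0 oO bO p2 (vO j).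
have := min_norm_eval oO p2 (BergmanB oO p1 (bG j) bF).1 (vO j).
move=> /le_trans/(_ Ge) H.
have : normc (G j (v j)) * min_norm Omega p (v j) = 1.
  by rewrite normcM c1 mul1r extremal_diag.
have : normc (G j (v j)) * min_norm Omega p (v j) <=
    normc (G j (v j) - F (v j)) * min_norm Omega p (v j) +
    normc (F (v j)) * min_norm Omega p (v j).
  by rewrite -mulrDl ler_pM2r//; have := le_normcD (G j (v j) - F (v j)) (F (v j)); rewrite subrK.
by move=> H1 H2; rewrite lerBlDr -H2 addrC (le_trans H1)// lerD2r.
Qed.

Variable z : V.
Hypotheses (Oz : Omega z) (vz : cluster (v j @[j --> \oo]) z).

(* |f(v_j)| m(v_j) <= ||f|| while |F(v_j)| m(v_j) tends to 1. *)
Lemma limit_eval_le f : Bergman Omega p f ->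
  normc (f z) <= normc (F z) * pnorm Omega p f.
Proof.
move=> bf; set a := normc (f z); set b := normc (F z); set N := pnorm Omega p f.
have a0 : 0 <= a by exact: normc_ge0.
have N0 : 0 <= N by exact: pnorm_ge0.
have key e : 0 < e -> e < 1 -> (a - e) * (1 - e) <= (b + e) * N.
  move=> e0 e1.
  have nf g : Bergman Omega p g -> nbhs z [set w | `|normc (g z) - normc (g w)| < e].
    move=> bg.
    have cg : normc (g w) @[w --> z] --> normc (g z).
      exact: (cvg_comp _ _ (holomorphic_continuous bg.1 Oz) (@continuous_normc R (g z))).
    by move/cvgrPdist_lt : cg; apply.
  have nn := @filterI _ _ (nbhs_filter z) _ _ (nf _ bf) (nf _ bF).
  (* As [z] is only a cluster point, a single index j is selected at which the lower bound for F and
     the closeness of both f and F to their values at z hold together. *)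
  have [j /= Fj [/= fj1 fj2]] := cluster_sequence vz (limit_eval e0) nn.
  have m0 := min_norm_gt0 oO bO p2 (vO j).
  have fm := min_norm_eval oO p2 bf (vO j).
  have f1 : a - e <= normc (f (v j)).
    by move: fj1 => /(le_lt_trans (ler_norm _)); rewrite -/a => /ltW; rewrite lerBlDr lerBlDl addrC.
  have F1 : normc (F (v j)) <= b + e.
    by move: fj2; rewrite distrC => /(le_lt_trans (ler_norm _)); rewrite -/b => /ltW; rewrite lerBlDl.
  apply: (@le_trans _ _ (normc (f (v j)) * (1 - e))).
    by apply: ler_wpM2r => //; rewrite subr_ge0 ltW.
  apply: (@le_trans _ _ (normc (f (v j)) * (normc (F (v j)) * min_norm Omega p (v j)))).
    by apply: ler_wpM2l => //; exact: normc_ge0.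
  rewrite mulrCA; apply: ler_pM => //; first exact: normc_ge0.
  by rewrite mulr_ge0 ?normc_ge0// ltW.
exact: le_of_perturbed key.
Qed.

(** The upper bound is [min_norm_eval] with ||F|| <= 1; the lower bound tests [limit_eval_le] on the
    minimizer at z. *)
Lemma limit_diag : normc (F z) * min_norm Omega p z = 1.
Proof.
have [bm mz mm] := minimizerP oO bO p2 Oz.
have m0 := min_norm_gt0 oO bO p2 Oz.
apply/eqP; rewrite eq_le; apply/andP; split.
  exact: le_trans (min_norm_eval oO p2 bF Oz) limit_pnorm_le1.
by have := limit_eval_le bm; rewrite mz mm normc1.
Qed.

Lemma limit_extremal : exists2 u : R[i], normc u = 1 &
  pnorm Omega p (fun x => F x - u * extremal z x) <= 0.
Proof.
have m0 := min_norm_gt0 oO bO p2 Oz.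
have Fz0 : 0 < normc (F z).
  rewrite lt_neqAle normc_ge0 andbT eq_sym; apply/eqP => F0.
  by have := limit_diag; rewrite F0 mul0r => /eqP; rewrite eq_sym oner_eq0.
have Fz : F z != 0 by rewrite -normc_gt0.
have Fm : normc (F z)^-1 = min_norm Omega p z.
  by rewrite normcV; apply: (mulfI (lt0r_neq0 Fz0)); rewrite divff ?gt_eqF// limit_diag.
(* F = F(z) m_p(., z) up to norm zero, and the minimizer is [min_norm] times [extremal z]; this is
   the resulting phase, unimodular by [limit_diag]. *)
exists (F z * (min_norm Omega p z)%:C).
  by rewrite normcM normc_real gtr0_norm// limit_diag.
have [bH Hm] := BergmanZ oO p1 (F z)^-1 bF.
have Hle : pnorm Omega p (fun x => (F z)^-1 * F x) <= min_norm Omega p z.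
  apply: (le_trans Hm); rewrite Fm -[leRHS]mulr1 ler_pM2l//.
  exact: limit_pnorm_le1.
have H0 := minimizer_unique oO bO p2 Oz bH (mulVf Fz) Hle.
have [bm _ _] := minimizerP oO bO p2 Oz.
have [_] := BergmanZ oO p1 (F z) (BergmanB oO p1 bH bm).1.
rewrite H0 mulr0; congr (pnorm _ _ _ <= 0); apply/funext => x.
rewrite mulrBr mulrA divff// mul1r /extremal; congr (_ - _).
rewrite -mulrA; congr (_ * _); rewrite mulrC divfK//.
by rewrite (inj_eq (fmorph_inj (real_complex R)) _ 0) gt_eqF.
Qed.

Lemma limit_rho (e : R) : 0 < e -> \forall j \near \oo, rho Omega p (v j) z <= e.
Proof.
move=> e0; have [u u1 Fu] := limit_extremal.
have := GF e0; apply: filterS => j Ge.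
have V1 : normc u^-1 = 1 by rewrite normcV u1 invr1.
have u0 : u != 0 by rewrite -normc_gt0 u1.
(* The phase that aligns v_j with z: up to the factor 1 / u, the difference to estimate is (G_j - F)
   + (F - u F_z). *)
have uc1 : normc (u^-1 * c j) = 1 by rewrite normcM V1 c1 mulr1.
apply: (le_trans (rho_le _ _ uc1)).
have bz := (extremal_Bergman Oz).1.
have bu := (Bergman_phase u1 bz).1.
have := (Bergman_phase V1 (BergmanB oO p1 (bG j) bu).1).2.
rewrite (_ : (fun _ => _) =
    (fun x => u^-1 * c j * extremal (v j) x - extremal z x)); last first.
  by apply/funext => x; rewrite mulrBr !mulrA mulVf// mul1r.
move=> /le_trans; apply.
apply: (le_trans (pnorm_dist_triangle oO p1 (bG j) bF bu)).
by rewrite -[leRHS]addr0 lerD.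
Qed.

End cauchy_limit.

End skwarczynski.

Theorem theorem4p7 (R : realType) (n : nat) (hn : (0 < n)%N)
    (Omega : set 'rV[R[i]]_n)
    (hdom : domain Omega) (hbnd : bounded_set Omega)
    (p : R) (hp : 2 < p)
    (hlim : forall w : nat -> 'rV[R[i]]_n,
      (forall k, Omega (w k)) ->
      (forall z, Omega z -> ~ cluster (w k @[k --> \oo]) z) ->
      forall f, Bergman Omega p f ->
        normc (f (w k)) `^ p / Bergman_kernel Omega p (w k) @[k --> \oo]
          --> (0 : R)) :
  Skwarczynski_complete Omega p.
Proof.
have [oO _ _] := hdom; have p2 := ltW hp.
have p1 : 1 <= p by rewrite (le_trans _ p2)// ler1n.
move=> w wO cw.
have [k [c [kinf c1 cG]]] := phased_subsequence oO hbnd p2 wO cw.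
have bG j : Bergman Omega p (fun x => c j * extremal Omega p (w (k j)) x).
  exact: (Bergman_phase oO p2 (c1 j) (extremal_Bergman oO hbnd p2 (wO _)).1).1.
have [F [bF _ GF]] := Bergman_complete oO p1 bG cG.
have vO j : Omega (w (k j)) by [].
have [z [Oz vz]] : exists z, Omega z /\ cluster (w (k j) @[j --> \oo]) z.
  apply: contrapT => /forallNP noz.
  (* If the subsequence had no cluster point in [Omega], the hypothesis for F would force (|F(v_j)|
     m(v_j))^p to tend to 0, since the kernel is m^-p. But [limit_eval] with e = 1/2 keeps it at
     least (1/2)^p. *)
  have /cvgrPdist_lt := hlim (fun j => w (k j)) vO
    (fun z Oz vz => noz z (conj Oz vz)) F bF.
  have h0 : 0 < (2^-1 : R) by [].
  have h1 : 0 < (2^-1 : R) `^ p by rewrite powR_gt0.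
  move=> /(_ _ h1) H; near \oo => j.
  have : `|0 - normc (F (w (k j))) `^ p / Bergman_kernel Omega p (w (k j))| < 2^-1 `^ p.
    by near: j.
  have Fj : 1 - 2^-1 <= normc (F (w (k j))) * min_norm Omega p (w (k j)).
    by near: j; exact: (limit_eval oO hbnd p2 vO c1 bF GF h0).
  have m0 := ltW (min_norm_gt0 oO hbnd p2 (vO j)).
  rewrite /Bergman_kernel powRN invrK -powRM ?normc_ge0//.
  rewrite sub0r normrN ger0_norm ?powR_ge0//; apply/negP; rewrite -leNgt.
  apply: ge0_ler_powR; rewrite ?nnegrE ?mulr_ge0 ?normc_ge0//.
    by rewrite (le_trans _ p1).
  by apply: le_trans Fj; rewrite {2}(splitr 1) div1r addrK.
exists z => //; apply/cvgrPdist_lt => e e0.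
have e20 : 0 < e / 2 by rewrite divr_gt0.
(* From the subsequence to the whole sequence: w_i is compared with one term w_(k j) such that k j
   >= N and its distance to z is at most e / 2. *)
have [N wN] := cw _ e20.
near \oo => j; exists N => // i /= Ni.
rewrite sub0r normrN ger0_norm ?rho_ge0//.
apply: (le_lt_trans (rho_triangle oO hbnd p2 (wO i) (vO j) Oz)).
rewrite (splitr e) ltr_leD//.
  by apply: wN => //; near: j; exact: kinf.
by near: j; exact: (limit_rho oO hbnd p2 vO c1 bF GF Oz vz e20).
Unshelve. all: by end_near. Qed.
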